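(* Let $C$ be a 2-$o$-homogeneous circle. (1) All holes in $C$ of countable character lie in the same orbit of $\mathrm{Aut}(C)$ on $\bar C$. (2) Suppose all points of $C$ have countable character. Then (a) $|\mathrm{Outer}(\mathrm{Aut}(C))|\in\{1,2,4\}$, and if it is 4 then $\mathrm{Outer}(\mathrm{Aut}(C))$ is the Klein 4-group; and $|\mathrm{Outer}(\mathrm{Aut}(C^{rel}))|\le 2$. (b) $\mathrm{Aut}(\mathrm{Aut}(C^{rel}))=\mathrm{Aut}(\mathrm{Aut}(C))$. (3) Suppose all points and all holes of $C$ have countable character. Then $\mathrm{Aut}(\mathrm{Aut}(C))=\mathrm{Aut}(C^{rel})$, and $\mathrm{Aut}(C^{rel})$ is a complete group.
   Context: A circle is $C=(L,\mathrm{Cr})$ with $L$ a dense linear order with at most one endpoint and $\mathrm{Cr}(x,y,z)$ iff $x<y<z$ or $y<z<x$ or $z<x<y$. $\mathrm{Aut}(C)$: bijections preserving $\mathrm{Cr}$. $C^{rel}$: the equal-orientation structure on $C$, whose automorphisms are the bijections of $C$ preserving or reversing orientation. $\bar C$: the Dedekind completion ($\bar L$ with an endpoint adjoined if it has none, circularized); automorphisms extend uniquely to $\bar C$. $C$ is 2-$o$-homogeneous if for any two pairs of distinct points $a_1\ne a_2$, $b_1\ne b_2$ some $g\in\mathrm{Aut}(C)$ maps $a_i$ to $b_i$. A hole is an element of $\bar C\setminus C$. An element $a\in\bar C$ has countable character if, for some (any) $b\in\bar C\setminus\{a\}$, the set $\{x\in C:\mathrm{Cr}(b,x,a)\}$ ordered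 counterclockwise (toward $a$) and the set $\{x\in C:\mathrm{Cr}(a,x,b)\}$ ordered clockwise (toward $a$) both have countable cofinality. Automorphisms of the groups $\mathrm{Aut}(C)$, $\mathrm{Aut}(C^{rel})$ are identified with the unique elements of $\mathrm{Aut}(\bar C^{rel})$ of which they are conjugation (in this setting every such automorphism is conjugation by a unique such element); equalities of automorphism groups refer to this identification. $\mathrm{Outer}(H)=\mathrm{Aut}(H)/\mathrm{Inner}(H)$; a group is complete if it has trivial center and all automorphisms are inner. *)

(* Defs.v *)
From HB Require Import structures.
From mathcomp Require Import all_boot all_order zmodp.
From mathcomp Require Import boolp classical_sets functions cardinality.

Set Implicit Arguments.
Unset Strict Implicit.
Unset Printing Implicit Defensive.

Import Order.TTheory.
Local Open Scope classical_set_scope.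
Local Open Scope group_scope.

Record bijn (T : Type) := Bijn {
  bijn_fun :> T -> T;
  bijn_inv : T -> T;
  bijn_funK : cancel bijn_fun bijn_inv;
  bijn_invK : cancel bijn_inv bijn_fun }.

HB.instance Definition _ (T : Type) := gen_eqMixin (bijn T).
HB.instance Definition _ (T : Type) := gen_choiceMixin (bijn T).

Lemma bijn_ext (T : Type) (f g : bijn T) : f =1 g -> f = g.
Proof.
case: f g => [f f' fK f'K] [g g' gK g'K] /= /funext efg; subst g.
have e : f' = g' by apply/funext => x; rewrite -{1}(g'K x) fK.
by subst g'; rewrite (Prop_irrelevance fK gK) (Prop_irrelevance f'K g'K).
Qed.

Section BijnGroup.
Variable T : Type.
Implicit Types f g h : bijn T.

Definition bijn_id : bijn T := @Bijn T id id (fun=> erefl) (fun=> erefl).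

Definition bijn_comp f g : bijn T :=
  Bijn (can_comp (bijn_funK f) (bijn_funK g))
       (can_comp (bijn_invK g) (bijn_invK f)).

Definition bijn_sym f : bijn T := Bijn (bijn_invK f) (bijn_funK f).

Fact bijn_compA : associative bijn_comp.
Proof. by move=> f g h; apply: bijn_ext. Qed.
Fact bijn_comp1 : left_id bijn_id bijn_comp.
Proof. by move=> f; apply: bijn_ext. Qed.
Fact bijn_1comp : right_id bijn_id bijn_comp.
Proof. by move=> f; apply: bijn_ext. Qed.
Fact bijn_symK : left_inverse bijn_id bijn_sym bijn_comp.
Proof. by move=> f; apply: bijn_ext => x /=; rewrite bijn_funK. Qed.
Fact bijn_Ksym : right_inverse bijn_id bijn_sym bijn_comp.
Proof. by move=> f; apply: bijn_ext => x /=; rewrite bijn_invK. Qed.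

(* The product is composition of functions: (f * g) x = f (g x). *)
HB.instance Definition _ :=
  isGroup.Build (bijn T) bijn_compA bijn_comp1 bijn_1comp bijn_symK bijn_Ksym.

End BijnGroup.

Section TernaryAut.
Variables (T : Type) (R : T -> T -> T -> Prop).

Definition preserving (f : T -> T) :=
  forall x y z, R (f x) (f y) (f z) <-> R x y z.

Definition reversing (f : T -> T) :=
  forall x y z, R (f x) (f y) (f z) <-> R z y x.

Definition preservingb : {pred bijn T} := fun g => `[< preserving g >].
Definition preserving_or_reversingb : {pred bijn T} :=
  fun g => `[< preserving g \/ reversing g >].

Fact preservingb_group : group_closed preservingb.
Proof.
split; first by apply/asboolP.
move=> f g /asboolP fP /asboolP gP; apply/asboolP => x y z /=.
by rewrite fP -gP /= !bijn_invK.
Qed.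

Fact preserving_or_reversingb_group : group_closed preserving_or_reversingb.
Proof.
split; first by apply/asboolP; left.
move=> f g /asboolP[fP|fP] /asboolP[gP|gP]; apply/asboolP;
  [left|right|right|left] => x y z /=; by rewrite fP -gP /= !bijn_invK.
Qed.

Record aut := Aut { aut_bijn :> bijn T; _ : aut_bijn \in preservingb }.

HB.instance Definition _ := [isSub of aut for aut_bijn].
HB.instance Definition _ := [Choice of aut by <:].
HB.instance Definition _ :=
  SubChoice_isSubGroup.Build (bijn T) preservingb aut preservingb_group.

(* When R is the cyclic order of a circle C, this is Aut(C^rel). *)
Record autrel :=
  Autrel { autrel_bijn :> bijn T; _ : autrel_bijn \in preserving_or_reversingb }.

HB.instance Definition _ := [isSub of autrel for autrel_bijn].
HB.instance Definition _ := [Choice of autrel by <:].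
HB.instance Definition _ :=
  SubChoice_isSubGroup.Build (bijn T) preserving_or_reversingb autrel
    preserving_or_reversingb_group.

End TernaryAut.

Section GroupAut.
Variable G : groupType.

Definition morphicb : {pred bijn G} :=
  fun f => `[< {morph f : x y / x * y} >].

Fact morphicb_group : group_closed morphicb.
Proof.
split; first by apply/asboolP.
move=> f g /asboolP fP /asboolP gP; apply/asboolP => x y /=.
rewrite -fP; congr (f _); apply: (can_inj (bijn_funK g)).
by rewrite gP !bijn_invK.
Qed.

Record gaut := Gaut { gaut_bijn :> bijn G; gautP : gaut_bijn \in morphicb }.

HB.instance Definition _ := [isSub of gaut for gaut_bijn].
HB.instance Definition _ := [Choice of gaut by <:].
HB.instance Definition _ :=
  SubChoice_isSubGroup.Build (bijn G) morphicb gaut morphicb_group.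

Definition inner (a : gaut) := exists g : G, forall x, a x = g * x * g^-1.

Definition inner_eq : rel gaut := fun a b => `[< inner (a^-1 * b) >].

Lemma gautM (a b : gaut) x : (a * b) x = a (b x).
Proof. by []. Qed.

Lemma gautV (a : gaut) x : a^-1 (a x) = x.
Proof. exact: bijn_funK. Qed.

Lemma gaut_morph (a : gaut) : {morph a : x y / x * y}.
Proof. by case: a => f /= /asboolP. Qed.

Lemma gaut_morph1 (a : gaut) : a 1 = 1.
Proof. by apply: (@mulgI _ (a 1)); rewrite -gaut_morph !mulg1. Qed.

Lemma gaut_morphV (a : gaut) x : a x^-1 = (a x)^-1.
Proof. by apply: (@mulgI _ (a x)); rewrite -gaut_morph !mulgV gaut_morph1. Qed.

Lemma inner1 : inner 1.
Proof. by exists 1 => x; rewrite mul1g invg1 mulg1. Qed.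

Lemma innerM a b : inner a -> inner b -> inner (a * b).
Proof.
move=> [g ag] [h bh]; exists (g * h) => x.
by rewrite gautM ag bh invgM !mulgA.
Qed.

Lemma innerV a : inner a -> inner a^-1.
Proof.
move=> [g ag]; exists g^-1 => x.
by rewrite -[RHS](gautV a) ag !mulgA mulgV mul1g invgK -mulgA mulgV mulg1.
Qed.

Lemma innerJ a b : inner a -> inner (b^-1 * a * b).
Proof.
move=> [g ag]; exists (b^-1 g) => x.
by rewrite !gautM ag !gaut_morph gaut_morphV gautV.
Qed.

Fact inner_eq_equiv : equiv_class_of inner_eq.
Proof.
split=> [a|a b|b a c].
- by apply/asboolP; rewrite mulVg; exact: inner1.
- by apply/asboolP/asboolP => /innerV; rewrite invgM invgK.
- move=> /asboolP ab /asboolP bc; apply/asboolP.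
  by have := innerM ab bc; rewrite mulgA mulgK.
Qed.

Canonical inner_eq_equivrel := EquivRelPack inner_eq_equiv.

Definition outer := {eq_quot inner_eq}%qT.

HB.instance Definition _ := EqQuotient.on outer.
HB.instance Definition _ := Choice.on outer.

Local Open Scope quotient_scope.

Definition outer_mul (u v : outer) : outer := \pi_outer (repr u * repr v).
Definition outer_one : outer := \pi_outer 1.
Definition outer_inv (u : outer) : outer := \pi_outer (repr u)^-1.

Lemma outer_eqP (a b : gaut) :
  reflect (inner (a^-1 * b)) (\pi_outer a == \pi_outer b).
Proof. by rewrite eqmodE; apply: asboolP. Qed.

Lemma outer_repr (a : gaut) : inner (a^-1 * repr (\pi_outer a)).
Proof. by apply/outer_eqP; rewrite reprK. Qed.

Lemma outer_mulE (a b : gaut) :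
  outer_mul (\pi_outer a) (\pi_outer b) = \pi_outer (a * b).
Proof.
apply/esym/eqP/outer_eqP; set a' := repr _; set b' := repr _.
have -> : (a * b)^-1 * (a' * b') = (b^-1 * (a^-1 * a') * b) * (b^-1 * b').
  by rewrite invgM !mulgA mulgK.
by apply: innerM; [apply: innerJ|]; exact: outer_repr.
Qed.

Lemma outer_invE (a : gaut) : outer_inv (\pi_outer a) = \pi_outer a^-1.
Proof.
apply/esym/eqP/outer_eqP; set a' := repr _; rewrite invgK.
have -> : a * a'^-1 = a^-1^-1 * (a^-1 * a')^-1 * a^-1.
  by rewrite invgM !invgK mulgA mulgK.
by apply: innerJ; apply: innerV; exact: outer_repr.
Qed.

Fact outer_mulA : associative outer_mul.
Proof.
move=> u v w; rewrite -[u]reprK -[v]reprK -[w]reprK.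
move: (repr u) (repr v) (repr w) => a b c.
by rewrite (outer_mulE b) (outer_mulE a b) !outer_mulE mulgA.
Qed.
Fact outer_mul1 : left_id outer_one outer_mul.
Proof. by move=> u; rewrite -[u]reprK outer_mulE mul1g. Qed.
Fact outer_1mul : right_id outer_one outer_mul.
Proof. by move=> u; rewrite -[u]reprK outer_mulE mulg1. Qed.
Fact outer_mulV : left_inverse outer_one outer_inv outer_mul.
Proof. by move=> u; rewrite -[u]reprK outer_invE outer_mulE mulVg. Qed.
Fact outer_Vmul : right_inverse outer_one outer_inv outer_mul.
Proof. by move=> u; rewrite -[u]reprK outer_invE outer_mulE mulgV. Qed.

HB.instance Definition _ :=
  isGroup.Build outer outer_mulA outer_mul1 outer_1mul outer_mulV outer_Vmul.

Definition complete_group :=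
  (forall z : G, (forall x, commute z x) -> z = 1) /\
  (forall a : gaut, inner a).

End GroupAut.

Definition isomorphic (G H : groupType) :=
  exists2 f : G -> H, bijective f & {morph f : x y / x * y}.

(* 'I_2 is the additive group Z/2, written multiplicatively here. *)
Definition klein4 : groupType := ('I_2 * 'I_2)%type.

Definition circularize (T : Type) (lt : T -> T -> Prop) (x y z : T) :=
  [\/ lt x y /\ lt y z, lt y z /\ lt z x | lt z x /\ lt x y].

Section Circle.
Variables (d : Order.disp_t) (L : orderType d).
Local Open Scope order_scope.

Definition densely_ordered :=
  forall x y : L, x < y -> exists2 z : L, x < z & z < y.

Definition endpoint (x : L) := (forall y : L, x <= y) \/ (forall y : L, y <= x).

Definition at_most_one_endpoint :=
  forall x y : L, endpoint x -> endpoint y -> x = y.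

Definition cr : L -> L -> L -> Prop := circularize (fun x y => x < y).

(* An element c of the completion is encoded by the set A of all x in L lying
   strictly below c.  If L has no endpoint, the adjoined one is placed at the
   bottom, so it is encoded by the empty set. *)
Definition dedekind_cut (A : set L) :=
  (exists a, A = [set x | x < a]) \/
  [/\ A !=set0, A != setT,
      forall x y, x <= y -> A y -> A x
    & forall x, A x -> exists2 y, A y & x < y].

Definition completion_cut (A : set L) :=
  dedekind_cut A \/ (~ (exists x, endpoint x) /\ A = set0).

Record cbar := Cbar { cut :> set L; cutP : completion_cut cut }.

Definition pt (a : L) : cbar :=
  Cbar (or_introl (or_introl (ex_intro _ a (erefl [set x | x < a])))).

Definition crbar : cbar -> cbar -> cbar -> Prop :=
  circularize (fun A B : cbar => cut A `<` cut B).

Definition two_o_homogeneous :=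
  forall a1 a2 b1 b2 : L, a1 != a2 -> b1 != b2 ->
    exists g : aut cr, g a1 = b1 /\ g a2 = b2.

Definition hole (c : cbar) := ~ exists a, c = pt a.

Definition countable_cofinality (S : set L) (before : L -> L -> Prop) :=
  exists D : set L, [/\ D `<=` S, countable D
    & forall x, S x -> exists2 y, D y & x = y \/ before x y].

(* On either arc from b to a, "before x y" means that x is met earlier than y
   when travelling from b to a. *)
Definition countable_character (a : cbar) :=
  exists b : cbar, [/\ b <> a,
    countable_cofinality [set x | crbar b (pt x) a]
                         (fun x y => crbar b (pt x) (pt y))
  & countable_cofinality [set x | crbar a (pt x) b]
                         (fun x y => crbar (pt y) (pt x) b)].

Definition extends (g : bijn L) (h : bijn cbar) := forall x, h (pt x) = pt (g x).

(* a is conjugation by c, each element of H being read as its extension to the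
   completion; H is Aut(C) or Aut(C^rel), acting on C through val. *)
Definition conjugation_by (H : groupType) (val : H -> bijn L)
    (a : gaut H) (c : autrel crbar) :=
  forall h : H, exists2 k : autrel crbar,
    extends (val h) k & extends (val (a h)) (c * k * c^-1)%g.

(* The identification of Aut(H) with conjugation_set is meaningful. *)
Definition uniquely_conjugating (H : groupType) (val : H -> bijn L) :=
  forall a : gaut H, exists! c, conjugation_by val a c.

Definition conjugation_set (H : groupType) (val : H -> bijn L) :
    set (autrel crbar) :=
  [set c | exists a : gaut H, conjugation_by val a c].

Definition extension_set (H : groupType) (val : H -> bijn L) :
    set (autrel crbar) :=
  [set c | exists h : H, extends (val h) c].

End Circle.

Arguments cr {d} L.
Arguments crbar {d} L.
Arguments densely_ordered {d} L.
Arguments at_most_one_endpoint {d} L.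
Arguments two_o_homogeneous {d} L.

(* Main.v *)
(* Let X be the completed circle.  Two-o-homogeneity makes all arcs of C with
   endpoints in C isomorphic, so automorphisms can be glued along arcs, and the
   automorphism group moves points locally inside every arc of X.

   Reconstruction.  Rubin's double-commutator formula expresses in group terms that
   two automorphisms have disjoint supports, hence also that the support of one lies
   in the regularized support of another, and that a regularized support is an arc.
   By Zorn's lemma every proper arc of X arises in this way.  So a group automorphism
   permutes the arcs, respecting inclusion and strict inclusion, and by compactness of
   X it is induced by a bijection of X, which preserves or reverses orientation.

   Holes of countable character are conjugate because X minus such a hole is an
   increasing union of a sequence of closed arcs with endpoints in C.  Hence an element
   normalizing Aut(C) maps C to itself or exchanges C with the set D of holes of
   countable character; together with the orientation this embeds Outer(Aut(C)) in the
   Klein group.  If all holes lie in D then no element exchanges C and D: composing it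
   with an automorphism of C one would get a map of a closed arc into its interior,
   whose fixed point would lie neither in C nor in D. *)
Require Import Defs.
From HB Require Import structures.
From mathcomp Require Import all_boot all_order zmodp fingroup gproduct.
From mathcomp Require Import boolp classical_sets functions cardinality.
From Stdlib Require Import Lia.

Set Implicit Arguments.
Unset Strict Implicit.
Unset Printing Implicit Defensive.

Import Order.TTheory.
Local Open Scope classical_set_scope.
Local Open Scope card_scope.
Local Open Scope group_scope.

(** Homogeneity moves points of [C] only, while ends of arcs may be holes; so local movement is
    assumed for arcs with arbitrary ends but only for points of a dense set. An element may fix
    points inside its arc, hence the use of regularized supports, which ignore nowhere dense sets of
    fixed points. Torsion is the obstacle to recovering disjointness: Rubin's formula says nothing
    about points that return under one of the first four powers of [g], and passing to [g ^+ 12],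
    with 12 the least common multiple of 1, 2, 3, 4, makes all of these fixed. The two groups Aut(C)
    and Aut(C^rel) are treated at once, as an abstract group embedded in Aut(C^rel) whose image
    contains Aut(C). The fixed-point argument must also cover reversing maps; for these completeness
    and monotonicity do not suffice, and the surjectivity of the map enters. *)

Definition strict_total (T : Type) (lt : T -> T -> Prop) :=
  [/\ forall x, ~ lt x x, forall x y z, lt x y -> lt y z -> lt x z
    & forall x y, [\/ lt x y, x = y | lt y x]].

(** * Ranks of finitely many points, for reduction to arithmetic *)

Section Rank.
Variables (T : Type) (lt : T -> T -> Prop).
Hypothesis lt_st : strict_total lt.

Lemma linear_rank (s : seq T) : exists rk : T -> nat,
  (forall x y, List.In x s -> List.In y s -> lt x y = (rk x < rk y)%coq_nat) /\
  (forall x y, List.In x s -> List.In y s -> (x = y) = (rk x = rk y)).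
Proof.
have [irr tr tot] := lt_st.
pose rk x := count (fun y => `[< lt y x >]) s.
have rkle x y : lt x y -> (rk x <= rk y)%N.
  by move=> xy; apply: sub_count => z /asboolP zx; apply/asboolP; apply: tr zx xy.
have rklt x y : List.In x s -> lt x y -> (rk x < rk y)%N.
  move=> + xy; rewrite /rk; elim: (s) => //= a t IH [->|/IH {}IH].
    rewrite (asboolF (irr x)) asboolT // add0n add1n ltnS.
    by apply: sub_count => z /asboolP zx; apply/asboolP; apply: tr zx xy.
  rewrite -addnS leq_add //.
  have [ax|ax] := pselect (lt a x); last by rewrite (asboolF ax).
  by rewrite !asboolT //; apply: tr ax xy.
exists rk; split => x y xs ys; apply/propext; split.
- by move=> /(rklt _ _ xs) /ssrnat.ltP.
- move=> /ssrnat.ltP; case: (tot x y) => // [->|/rkle]; first by rewrite ltnn.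
  by move=> + xy; rewrite leqNgt xy.
- by move->.
- case: (tot x y) => // [/(rklt _ _ xs)|/(rklt _ _ ys)] => + e; by rewrite e ltnn.
Qed.
End Rank.

Lemma circularizeE (T : Type) (lt : T -> T -> Prop) x y z :
  circularize lt x y z =
  (lt x y /\ lt y z \/ lt y z /\ lt z x \/ lt z x /\ lt x y).
Proof.
apply/propext; split; first by move=> []; tauto.
by move=> [?|[?|?]]; [apply: Or31|apply: Or32|apply: Or33].
Qed.

Section CyclicRank.
Variables (T : Type) (lt : T -> T -> Prop).
Hypothesis lt_st : strict_total lt.

Definition nat_cyclic (i j k : nat) :=
  ((i < j)%coq_nat /\ (j < k)%coq_nat) \/ ((j < k)%coq_nat /\ (k < i)%coq_nat) \/
  ((k < i)%coq_nat /\ (i < j)%coq_nat).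

Lemma cyclic_rank (b : T) (s : seq T) : exists rk : T -> nat,
  [/\ rk b = 0,
      forall x y, List.In x (b :: s) -> List.In y (b :: s) -> (x = y) = (rk x = rk y)
    & forall x y z, List.In x (b :: s) -> List.In y (b :: s) -> List.In z (b :: s) ->
       circularize lt x y z = nat_cyclic (rk x) (rk y) (rk z)].
Proof.
have [rk [rk_lt rk_eq]] := linear_rank lt_st (b :: s).
pose M := \max_(x <- map rk (b :: s)) x.
have rkM x : List.In x (b :: s) -> (rk x <= M)%coq_nat.
  rewrite /M; elim: (b :: s) => //= y t IH; rewrite big_cons.
  by move=> [->|/IH /ssrnat.leP xM]; apply/ssrnat.leP; rewrite leq_max ?leqnn // xM orbT.
have bb : List.In b (b :: s) by left.
clearbody M.
(* Ranks below that of [b] are lifted above all others: a rotation, which keeps the cyclic order and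
   sends [b] to 0. *)
pose rk' x := if rk b <= rk x then rk x - rk b else rk x + M.+1 - rk b.
have rk'E x : List.In x (b :: s) ->
    ((rk b <= rk x)%coq_nat /\ (rk x = rk b + rk' x)%coq_nat) \/
    ((rk x < rk b)%coq_nat /\ (rk' x + rk b = rk x + M.+1)%coq_nat).
  move=> xs; have := rkM _ xs; have := rkM _ bb; rewrite /rk'.
  by case: leqP => /ssrnat.leP; rewrite -?plusE -?minusE; move: (rk b) (rk x) => i j; lia.
have rk'0 : rk' b = 0 by rewrite /rk' leqnn subnn.
clearbody rk'; exists rk'; split=> //.
- move=> x y xs ys; rewrite (rk_eq x y xs ys); apply/propext.
  move: (rk'E _ xs) (rk'E _ ys) (rkM _ xs) (rkM _ ys) (rkM _ bb); lia.
- move=> x y z xs ys zs; rewrite circularizeE !rk_lt // /nat_cyclic; apply/propext.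
  move: (rk'E _ xs) (rk'E _ ys) (rk'E _ zs) (rkM _ xs) (rkM _ ys) (rkM _ zs) (rkM _ bb).
  move: (rk x) (rk y) (rk z) (rk b) (rk' x) (rk' y) (rk' z) => ? ? ? ? ? ? ?.
  lia.
Qed.

Lemma nat_cyclic0 j k : nat_cyclic 0 j k = ((0 < j)%coq_nat /\ (j < k)%coq_nat).
Proof. by apply/propext; rewrite /nat_cyclic; lia. Qed.

Lemma nat_cyclic_rot i j k : nat_cyclic i j k = nat_cyclic j k i.
Proof. by apply/propext; rewrite /nat_cyclic; lia. Qed.

End CyclicRank.

(* Facts about the cyclic order of the points of [b :: l] are transferred along a
   rank function into [nat], with [b] as origin, and left to [lia]. *)
Ltac cyclia st l :=
  let mem := (simpl; repeat first [left; reflexivity | right]) in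
  let ty := type of st in
  lazymatch ty with @strict_total ?T ?lt =>
  lazymatch l with ?b :: ?s =>
  let rk := fresh "rk" in let E0 := fresh "E0" in
  let E1 := fresh "E1" in let E2 := fresh "E2" in
  destruct (cyclic_rank st b s) as [rk [E0 E1 E2]];
  repeat match goal with
  | H : context [@circularize T lt ?x ?y ?z] |- _ =>
    rewrite (E2 x y z) in H; [|solve [mem]|solve [mem]|solve [mem]]
  | |- context [@circularize T lt ?x ?y ?z] =>
    rewrite (E2 x y z); [|solve [mem]|solve [mem]|solve [mem]]
  | H : context [@eq T ?x ?y] |- _ => rewrite (E1 x y) in H; [|solve [mem]|solve [mem]]
  | |- context [@eq T ?x ?y] => rewrite (E1 x y); [|solve [mem]|solve [mem]]
  end;
  clear E1 E2;
  repeat match goal with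
  | H : context [rk b] |- _ => lazymatch H with E0 => fail | _ => rewrite E0 in H end
  | |- context [rk b] => rewrite E0
  end; clear E0;
  repeat match goal with
  | H : context [nat_cyclic 0 ?j ?k] |- _ => rewrite (nat_cyclic0 j k) in H
  | |- context [nat_cyclic 0 ?j ?k] => rewrite (nat_cyclic0 j k)
  | H : context [nat_cyclic ?j 0 ?k] |- _ => rewrite (nat_cyclic_rot j 0 k) in H
  | |- context [nat_cyclic ?j 0 ?k] => rewrite (nat_cyclic_rot j 0 k)
  | H : context [nat_cyclic ?j ?k 0] |- _ =>
    rewrite -(nat_cyclic_rot 0 j k) in H
  | |- context [nat_cyclic ?j ?k 0] => rewrite -(nat_cyclic_rot 0 j k)
  end; unfold nat_cyclic in *; lia
  end end.

(** For goals that mix [lt] with the cyclic order: no origin may be chosen, so the cyclic relation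
    is unfolded first. *)
Ltac linlia st l :=
  let mem := (simpl; repeat first [left; reflexivity | right]) in
  let rk := fresh "rk" in let E1 := fresh "E1" in let E2 := fresh "E2" in
  destruct (linear_rank st l) as [rk [E1 E2]];
  let ty := type of st in
  lazymatch ty with @strict_total ?T ?lt =>
  repeat match goal with
  | H : context [@circularize T lt ?x ?y ?z] |- _ =>
    rewrite (circularizeE lt x y z) in H
  | |- context [@circularize T lt ?x ?y ?z] => rewrite (circularizeE lt x y z)
  end;
  repeat match goal with
  | H : context [lt ?x ?y] |- _ => rewrite (E1 x y) in H; [|solve [mem]|solve [mem]]
  | |- context [lt ?x ?y] => rewrite (E1 x y); [|solve [mem]|solve [mem]]
  | H : context [@eq T ?x ?y] |- _ => rewrite (E2 x y) in H; [|solve [mem]|solve [mem]]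
  | |- context [@eq T ?x ?y] => rewrite (E2 x y); [|solve [mem]|solve [mem]]
  end end; clear E1 E2; lia.

(** * Neighbourhoods, density and completeness in a cyclic order *)

Section Neighbourhoods.
Variables (X : Type) (lt : X -> X -> Prop).
Hypothesis lt_st : strict_total lt.
Local Notation R := (circularize lt).

Definition dense_in (P : X -> Prop) :=
  forall a b, a <> b -> exists2 z, P z & R a z b.

(** Cutting the circle at [p] gives a line in which [R p s u] means that [s] precedes [u]; this is
    the least upper bound property of all these lines. *)
Definition complete_circle := forall p s0 u (S : X -> Prop),
  S s0 -> u <> p -> (forall s, S s -> s = u \/ R p s u) ->
  exists m, [/\ m <> p, forall s, S s -> s = m \/ R p s m
    & forall v, v <> p -> (forall s, S s -> s = v \/ R p s v) -> m = v \/ R p m v].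

Lemma complete_inf : complete_circle -> forall p s0 u (S : X -> Prop),
  S s0 -> u <> p -> (forall s, S s -> u = s \/ R p u s) -> s0 <> p ->
  exists m, [/\ m <> p, forall s, S s -> m = s \/ R p m s
    & forall v, v <> p -> (forall s, S s -> v = s \/ R p v s) -> v = m \/ R p v m].
Proof.
move=> cplt p s0 u S Ss0 up uS s0p.
have sp s : S s -> s <> p by move=> /uS; cyclia lt_st [:: u; s; p].
pose B v := v <> p /\ forall s, S s -> v = s \/ R p v s.
have [|//|s [_ /(_ _ Ss0)] //|m [mp Bm lm]] := @cplt p u s0 B; first by split.
exists m; split=> // [s Ss|v vp vS]; last by apply: Bm; split.
by apply: lm (sp _ Ss) _ => v [_ /(_ _ Ss)].
Qed.

Variable P : X -> Prop.
Hypothesis P_dense : dense_in P.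

Definition nbhd x (V : X -> Prop) :=
  exists a b, R a x b /\ forall y, R a y b -> V y.

Lemma nbhd_mem x V : nbhd x V -> V x.
Proof. by move=> [a [b [axb]]]; apply. Qed.

Lemma nbhdS x (V W : X -> Prop) : (forall y, V y -> W y) -> nbhd x V -> nbhd x W.
Proof. by move=> VW [a [b [axb abV]]]; exists a, b; split=> // y /abV /VW. Qed.

Lemma nbhd_arc a b x : R a x b -> nbhd x (fun y => R a y b).
Proof. by move=> axb; exists a, b. Qed.

(** Two arcs can meet in two pieces, so only the piece around [x] is kept, bounded on each side by
    the nearer end. *)
Lemma nbhdI x (V W : X -> Prop) : nbhd x V -> nbhd x W -> nbhd x (fun y => V y /\ W y).
Proof.
move=> [a [b [axb abV]]] [a' [b' [axb' abW]]].
have [a1 [b1 [axb1 sub]]] : exists a1 b1, R a1 x b1 /\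
    forall y, R a1 y b1 -> R a y b /\ R a' y b'.
  have [aa'|aa'] := pselect (R a a' x); have [bb'|bb'] := pselect (R x b b').
  - exists a', b; split; first by cyclia lt_st [:: a; b; a'; b'; x].
    by move=> y; split; cyclia lt_st [:: a; b; a'; b'; x; y].
  - exists a', b'; split; first by cyclia lt_st [:: a; b; a'; b'; x].
    by move=> y; split; cyclia lt_st [:: a; b; a'; b'; x; y].
  - exists a, b; split; first by cyclia lt_st [:: a; b; a'; b'; x].
    by move=> y; split; cyclia lt_st [:: a; b; a'; b'; x; y].
  - exists a, b'; split; first by cyclia lt_st [:: a; b; a'; b'; x].
    by move=> y; split; cyclia lt_st [:: a; b; a'; b'; x; y].
exists a1, b1; split => // y /sub [/abV ? /abW ?]; by split.
Qed.

Lemma nbhd_nbhd x V : nbhd x V -> nbhd x (nbhd^~ V).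
Proof. by move=> [a [b [axb abV]]]; exists a, b; split=> // y ayb; exists a, b. Qed.

Lemma nbhd_dense x V : nbhd x V -> exists2 y, P y & V y.
Proof.
move=> [a [b [axb abV]]].
have [y Py ayx] := @P_dense a x (ltac:(cyclia lt_st [:: a; b; x])).
by exists y => //; apply: abV; cyclia lt_st [:: a; b; x; y].
Qed.

Lemma nbhd_sep x y : x <> y ->
  exists V W, [/\ nbhd x V, nbhd y W & forall z, V z -> W z -> False].
Proof.
move=> xy; have [a _ xay] := P_dense xy; have [b _ ybx] := P_dense (nesym xy).
exists (fun z => R b z a), (fun z => R a z b); split.
- by apply: nbhd_arc; cyclia lt_st [:: a; b; x; y].
- by apply: nbhd_arc; cyclia lt_st [:: a; b; x; y].
- by move=> z; cyclia lt_st [:: a; b; z].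
Qed.

(** The condition [R a b y] keeps even the closed arc away from [y], so that near [x] the circle can
    be treated as a line. *)
Lemma nbhd_small x y V : x <> y -> nbhd x V -> exists a b,
  [/\ R a x b, R a b y & forall z, R a z b -> V z].
Proof.
move=> xy xV; have [U [W [xU yW UW]]] := nbhd_sep xy.
have [a [b [axb abUV]]] := nbhdI xV xU.
have [a' a'P axa'] := @P_dense a x (ltac:(cyclia lt_st [:: a; b; x])).
have [b' b'P xb'b] := @P_dense x b (ltac:(cyclia lt_st [:: a; b; x])).
have [/abUV [_ Uy]|ayb] := pselect (R a y b).
  by case: (UW _ Uy (nbhd_mem yW)).
exists a', b'; split; first by cyclia lt_st [:: a; b; x; a'; b'].
  by cyclia lt_st [:: a; b; x; a'; b'; y].
by move=> z azb; apply: (abUV z _).1; cyclia lt_st [:: a; b; x; a'; b'; z].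
Qed.


(** Replacing one entry at a time links any two triples of distinct points. It serves to propagate
    the orientation found on one triple. *)
Lemma triples_connected (D : X -> X -> X -> Prop) :
  (forall x y z, D x y z -> D y z x /\ D y x z) ->
  (forall x y z w, x <> y -> y <> z -> z <> x -> w <> x -> w <> y -> D x y z -> D x y w) ->
  forall x0 y0 z0, x0 <> y0 -> y0 <> z0 -> z0 <> x0 -> D x0 y0 z0 ->
  forall x y z, x <> y -> y <> z -> z <> x -> D x y z.
Proof.
move=> Dperm Dstep x0 y0 z0 xy0 yz0 zx0 D0 x y z xy yz zx.
have [y1 [z1 [xy1 yz1 zx1 D1]]] : exists y1 z1, [/\ x <> y1, y1 <> z1, z1 <> x & D x y1 z1].
  have [->|xx0] := pselect (x = x0); first by exists y0, z0.
  have [->|xy0'] := pselect (x = y0).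
    by exists z0, x0; split=> //; apply: (Dperm _ _ _ D0).1.
  exists x0, y0; split=> //; first exact: nesym.
  have [/Dperm[? _] _] := Dperm _ _ _ (Dstep _ _ _ x xy0 yz0 zx0 xx0 xy0' D0).
  by [].
have [z2 [yz2 zx2 D2]] : exists z2, [/\ y <> z2, z2 <> x & D x y z2].
  have [->|yy1] := pselect (y = y1); first by exists z1.
  have [->|yz1'] := pselect (y = z1).
    exists y1; split; [exact: nesym|exact: nesym|].
    by have [/Dperm[/Dperm[_ ?] _] _] := Dperm _ _ _ D1.
  exists y1; split=> //; first exact: nesym.
  have D2 := Dstep _ _ _ y xy1 yz1 zx1 (nesym xy) yy1 D1.
  by have [/Dperm[/Dperm[_ ?] _] _] := Dperm _ _ _ D2.
by apply: Dstep D2 => //; exact: nesym.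
Qed.

(** An arc that contains [z], [w] and misses [x], [y] shows that the pair [x], [y] does not separate
    [z] from [w], and its image shows this for the image points. So [c] respects separation of
    pairs, which determines a cyclic order up to reversal. *)
Lemma arcs_monotone (c : X -> X) : injective c ->
  (forall a b, a <> b -> exists a' b', forall x, R a x b <-> R a' (c x) b') ->
  preserving R c \/ reversing R c.
Proof.
move=> c_inj c_arc.
have c_neq x y : x <> y -> c x <> c y by move=> xy /c_inj.
have same_side x y z w : x <> y -> R x y z -> R x z w ->
    R (c x) (c y) (c z) <-> R (c x) (c y) (c w).
  move=> xy xyz xzw.
  have [s _ ysz] := @P_dense y z (ltac:(cyclia lt_st [:: x; y; z])).
  have [t _ wtx] := @P_dense w x (ltac:(cyclia lt_st [:: x; z; w])).
  have [|a [b ab]] := c_arc s t; first by cyclia lt_st [:: x; y; z; w; s; t].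
  have : ~ R a (c x) b by rewrite -ab; cyclia lt_st [:: x; y; z; w; s; t].
  have : ~ R a (c y) b by rewrite -ab; cyclia lt_st [:: x; y; z; w; s; t].
  have : R a (c z) b by rewrite -ab; cyclia lt_st [:: x; y; z; w; s; t].
  have : R a (c w) b by rewrite -ab; cyclia lt_st [:: x; y; z; w; s; t].
  have := c_neq _ _ xy.
  by clear ab xyz xzw ysz wtx xy; cyclia lt_st [:: a; b; c x; c y; c z; c w].
pose distinct4 (x y z w : X) := [/\ x <> y, x <> z, x <> w, y <> z & y <> w].
have same_sides x y z w : distinct4 x y z w -> (R x y z <-> R x y w) ->
    (R (c x) (c y) (c z) <-> R (c x) (c y) (c w)).
  move=> [xy xz xw yz yw] S; have [->//|zw] := pselect (z = w).
  have [xyz|xyz] := pselect (R x y z); have [xzw|xzw] := pselect (R x z w).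
  - exact: same_side.
  - apply: iff_sym; apply: same_side => //; first exact: S.1.
    by cyclia lt_st [:: x; y; z; w].
  - have : R (c y) (c x) (c z) <-> R (c y) (c x) (c w).
      by apply: same_side; cyclia lt_st [:: x; y; z; w].
    have := c_neq _ _ xy; have := c_neq _ _ xz; have := c_neq _ _ xw.
    have := c_neq _ _ yz; have := c_neq _ _ yw.
    by move: (c x) (c y) (c z) (c w) => cx cy cz cw *; cyclia lt_st [:: cx; cy; cz; cw].
  - have : R (c y) (c x) (c w) <-> R (c y) (c x) (c z).
      by apply: same_side; cyclia lt_st [:: x; y; z; w].
    have := c_neq _ _ xy; have := c_neq _ _ xz; have := c_neq _ _ xw.
    have := c_neq _ _ yz; have := c_neq _ _ yw.
    by move: (c x) (c y) (c z) (c w) => cx cy cz cw *; cyclia lt_st [:: cx; cy; cz; cw].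
(* Of the three splittings of four points into two pairs exactly one is separating. If [c] undid a
   separation, none of the splittings of the image points would be. *)
have sides x y z w : distinct4 x y z w ->
    (R (c x) (c y) (c z) <-> R (c x) (c y) (c w)) -> (R x y z <-> R x y w).
  move=> [xy xz xw yz yw] S; apply: contrapT => nS.
  have zw : z <> w by move=> e; apply: nS; rewrite e.
  have := @same_sides x z y w (ltac:(by split=> //; apply: nesym))
    (ltac:(cyclia lt_st [:: x; y; z; w])).
  have := @same_sides x w y z (ltac:(by split=> //; apply: nesym))
    (ltac:(cyclia lt_st [:: x; y; z; w])).
  have := c_neq _ _ xy; have := c_neq _ _ xz; have := c_neq _ _ xw.
  have := c_neq _ _ yz; have := c_neq _ _ yw; have := c_neq _ _ zw.
  move: S; move: (c x) (c y) (c z) (c w) => cx cy cz cw *.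
  by clear nS; cyclia lt_st [:: cx; cy; cz; cw].
have [[x0 [y0 [z0 xyz0]]]|noR] := pselect (exists x y z, R x y z); last first.
  left=> x y z; split=> xyz; case: noR; first by exists (c x), (c y), (c z).
  by exists x, y, z.
have distinct x y z : R x y z -> [/\ x <> y, y <> z & z <> x].
  by split; cyclia lt_st [:: x; y; z].
have orient (T : X -> X -> X -> Prop) :
    (forall x y z, T x y z = R (c x) (c y) (c z)) \/
    (forall x y z, T x y z = R (c z) (c y) (c x)) ->
    T x0 y0 z0 -> forall x y z, T x y z <-> R x y z.
  move=> TE T0 x y z.
  have T_distinct : T x y z -> [/\ x <> y, y <> z & z <> x].
    by case: TE => -> /distinct[? ? ?]; split=> e; subst.
  suff D : x <> y -> y <> z -> z <> x -> T x y z <-> R x y z.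
    by split=> h; [have [? ? ?] := T_distinct h|have [? ? ?] := distinct _ _ _ h]; apply/D.
  pose D x y z := x <> y -> y <> z -> z <> x -> T x y z <-> R x y z.
  move=> xy yz zx.
  have [xy0 yz0 zx0] := distinct _ _ _ xyz0.
  apply: (@triples_connected D _ _ x0 y0 z0) => //.
  - move=> {xy yz zx T_distinct}x {}y {}z Dxyz.
    split=> yz zx xy; have := Dxyz (ltac:(auto)) (ltac:(auto)) (ltac:(auto));
      have := c_neq _ _ xy; have := c_neq _ _ yz; have := c_neq _ _ zx;
      by case: TE => TE; rewrite !TE; move: (c x) (c y) (c z) => cx cy cz;
         cyclia lt_st [:: x; y; z; cx; cy; cz].
  - move=> {xy yz zx T_distinct}x {}y {}z w xy yz zx wx wy Dxyz _ _ _.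
    have [->|wz] := pselect (w = z); first exact: Dxyz.
    have E u : u <> x -> u <> y -> R (c u) (c y) (c x) <-> ~ R (c x) (c y) (c u).
      move=> /c_neq + /c_neq; have := c_neq _ _ xy.
      by cyclia lt_st [:: c x; c y; c u].
    have d4 : distinct4 x y z w by split=> //; apply: nesym.
    have := Dxyz xy yz zx; have := @same_sides _ _ _ _ d4; have := @sides _ _ _ _ d4.
    have := c_neq _ _ xy; have := c_neq _ _ yz; have := c_neq _ _ zx.
    have := c_neq _ _ wx; have := c_neq _ _ wy.
    have := E z zx (nesym yz); have := E w wx wy.
    have [|] := pselect (R x y w); have [|] := pselect (R (c x) (c y) (c w));
      by case: TE => TE; rewrite !TE; tauto.

have [cx0 cy0 cz0] := distinct _ _ _ xyz0.
have : R (c x0) (c y0) (c z0) \/ R (c z0) (c y0) (c x0).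
  have := c_neq _ _ cx0; have := c_neq _ _ cy0; have := c_neq _ _ cz0.
  by move: (c x0) (c y0) (c z0) => x1 y1 z1; cyclia lt_st [:: x1; y1; z1].
case=> c0; [left|right] => x y z.
  by apply: (orient (fun x y z => R (c x) (c y) (c z))) => //; left.
by apply: (orient (fun x y z => R (c z) (c y) (c x))) => //; right.
Qed.

End Neighbourhoods.

(** * Groups acting with local movement inside arcs *)

Section LocalMovement.
Variables (X : Type) (lt : X -> X -> Prop).
Hypothesis lt_st : strict_total lt.
Local Notation R := (circularize lt).
Variable P : X -> Prop.
Hypothesis P_dense : dense_in lt P.
Local Notation nbhd := (nbhd lt).

Variables (H : groupType) (act : H -> X -> X).
Hypothesis act1 : forall x, act 1 x = x.
Hypothesis actM : forall g h x, act (g * h) x = act g (act h x).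
Hypothesis act_faithful : forall g, (forall x, act g x = x) -> g = 1.
Hypothesis act_mono : forall g, preserving R (act g) \/ reversing R (act g).
Hypothesis act_move : forall a b u v, P u -> P v -> R a u b -> R a v b ->
  exists2 g, forall x, ~ R a x b -> act g x = x & act g u = v.

Lemma actK g x : act g^-1 (act g x) = x.
Proof. by rewrite -actM mulVg act1. Qed.

Lemma actVK g x : act g (act g^-1 x) = x.
Proof. by rewrite -actM mulgV act1. Qed.

Lemma act_inj g x y : act g x = act g y -> x = y.
Proof. by move=> e; rewrite -(actK g x) e actK. Qed.

Lemma act_ext g h : (forall x, act g x = act h x) -> g = h.
Proof.
move=> gh; apply: (@mulgI _ h^-1); rewrite mulVg; apply: act_faithful => x.
by rewrite actM gh actK.
Qed.

Lemma act_fixV g x : act g x = x -> act g^-1 x = x.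
Proof. by move=> {1}<-; rewrite actK. Qed.

Lemma act_conj g h x : act (g * h * g^-1) (act g x) = act g (act h x).
Proof. by rewrite !actM actK. Qed.

Lemma act_nbhd g x V : nbhd (act g x) V -> nbhd x (fun y => V (act g y)).
Proof.
move=> [a [b [axb abV]]]; have [gR|gR] := act_mono g.
  exists (act g^-1 a), (act g^-1 b); split; first by rewrite -gR !actVK.
  by move=> y; rewrite -gR !actVK => /abV.
exists (act g^-1 b), (act g^-1 a); split; first by rewrite -gR !actVK.
by move=> y; rewrite -gR !actVK => /abV.
Qed.

Lemma moved_nbhd g x : act g x <> x ->
  exists2 V, nbhd x V & forall y, V y -> ~ V (act g y).
Proof.
move=> gx; have [V [W [gV xW VW]]] := nbhd_sep lt_st P_dense gx.
exists (fun y => W y /\ V (act g y)); first exact/(nbhdI lt_st)/act_nbhd.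
by move=> y [_ Vgy] [Wgy _]; exact: VW Vgy Wgy.
Qed.

Lemma supp_open g x : act g x <> x -> nbhd x (fun y => act g y <> y).
Proof.
move=> /moved_nbhd [V xV VgV]; apply: nbhdS xV => y Vy gy.
by apply: (VgV y); rewrite ?gy.
Qed.

Definition supp_in g (V : X -> Prop) := forall x, act g x <> x -> V x.

Lemma supp_inN g V x : supp_in g V -> ~ V x -> act g x = x.
Proof. by move=> gV; apply: contra_notP; apply: gV. Qed.

(** An element that fixes [a] and [b] and pushes [u] forward has powers that push [u] further
    forward, so none of them fixes [u]. *)
Lemma local_move x V : nbhd x V ->
  exists g y, supp_in g V /\ act (g ^+ 12) y <> y.
Proof.
move=> [a [b [axb abV]]].
have [u Pu aub] := @P_dense a b (ltac:(cyclia lt_st [:: a; b; x])).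
have [v Pv uvb] := @P_dense u b (ltac:(cyclia lt_st [:: a; b; u])).
have avb : R a v b by cyclia lt_st [:: a; b; u; v].
have [g g_id gu] := act_move Pu Pv aub avb.
have ga : act g a = a by apply: g_id; cyclia lt_st [:: a; b].
have gb : act g b = b by apply: g_id; cyclia lt_st [:: a; b].
have gR : preserving R (act g).
  have [//|gR] := act_mono g.
  by have := gR a u b; rewrite ga gb gu => -[/(_ avb) ? _]; cyclia lt_st [:: a; b; u].
have iter n : R a u (act (g ^+ n.+1) u).
  elim: n => [|n IH]; first by rewrite expg1 gu; cyclia lt_st [:: a; b; u; v].
  move: IH; rewrite -gR ga gu -actM -expgS.
  move: (act _ _) => w ?; cyclia lt_st [:: a; b; u; v; w].
exists g, u; split; first by move=> y; apply: contra_notP => yV; apply: g_id => /abV.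
by move=> e; move: (iter 11); rewrite e; cyclia lt_st [:: a; u].
Qed.

Lemma local_nontrivial x V : nbhd x V ->
  exists g y, supp_in g V /\ act g y <> y.
Proof.
move=> /local_move [g [y [gV gy]]]; exists g, y; split => // e; apply: gy.
by elim: 12 => [|n IH]; rewrite ?expg0 ?act1 // expgS actM IH.
Qed.

Lemma commute_disjoint g h : (forall x, act g x = x \/ act h x = x) -> commute g h.
Proof.
move=> dis; apply: act_ext => x; rewrite !actM.
have [gx|gx] := pselect (act g x = x).
  rewrite gx; have [//|ghx] := pselect (act g (act h x) = act h x).
  by case: (dis (act h x)) => // /act_inj ->; rewrite gx.
have hx : act h x = x by case: (dis x).
by rewrite hx; case: (dis (act g x)) => [/act_inj|->].
Qed.

Definition comm_of g h : H := g * h * g^-1 * h^-1.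

(** If [g] commutes with [h], it permutes the points moved by [h]; but it pushes all points of [V]
    out of [V]. *)
Lemma not_commute_moved g h V :
  (forall y, V y -> ~ V (act g y)) -> supp_in h V -> commute g h -> h = 1.
Proof.
move=> VgV hV gh; apply: act_faithful => x.
have [//|hx] := pselect (act h x = x); have Vx := hV _ hx.
have := VgV _ Vx; case; apply: hV => e.
by apply/hx/(@act_inj g); rewrite -actM gh actM.
Qed.

Lemma local_noncommuting x V : nbhd x V ->
  exists f g, [/\ supp_in f V, supp_in g V & ~ commute f g].
Proof.
move=> xV; have [f [y [fV fy]]] := local_nontrivial xV.
have [W yW WfW] := moved_nbhd fy.
have [g [z [gW gz]]] := local_nontrivial (nbhdI lt_st yW (supp_open fy)).
exists f, g; split => //; first by move=> t /gW [_ /fV].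
move=> fg; apply: gz; rewrite (not_commute_moved WfW _ fg) ?act1 // => t /gW[].
by [].
Qed.

(** * Rubin's algebraic description of disjointness of supports *)

(** Rubin's formula. It lies between disjointness of [f] from [g] and disjointness of [f] from
    [g ^+ 12], and it mentions nothing but the group. *)
Definition eta f g := forall h, ~ commute f h ->
  exists f1 f2, [/\ commute f1 g, commute f2 g, comm_of f1 (comm_of f2 h) <> 1
                  & commute (comm_of f1 (comm_of f2 h)) g].

Definition disjoint_supp f g := forall x, act f x = x \/ act g x = x.

(** Take non-commuting [f1], [f2] in a small [U] that [h] moves off itself. Then [comm_of f2 h] is
    [f2] times an element supported in the image of [U], which commutes with [f1]; the double
    commutator collapses to [comm_of f1 f2], supported where [g] is the identity. *)
Lemma eta_disjoint f g : disjoint_supp f g -> eta f g.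
Proof.
move=> fg h fh.
have [x fx hx] : exists2 x, act f x <> x & act h x <> x.
  apply: contra_notP fh => fh; apply: commute_disjoint => x.
  by apply: contra_notP fh => /not_orP[? ?]; exists x.
have [V xV VhV] := moved_nbhd hx.
pose U y := V y /\ act f y <> y.
have xU : nbhd x U := nbhdI lt_st xV (supp_open fx).
have UhU y : U y -> ~ U (act h y) by move=> [/VhV ? _] [].
have [f1 [f2 [f1U f2U f12]]] := local_noncommuting xU.
have gU k : supp_in k U -> commute k g.
  move=> kU; apply: commute_disjoint => y; move: (kU y).
  have [->|ky /(_ ky) [_ fy]] := pselect (act k y = y); first by left.
  by right; case: (fg y).
pose k := h * f2^-1 * h^-1.
have f1k : commute f1 k.
  apply: commute_disjoint => y; have [->|f1y] := pselect (act f1 y = y); first by left.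
  right; rewrite /k -{1}(actVK h y) act_conj -[RHS](actVK h); congr (act h _).
  apply: act_fixV; apply: (supp_inN f2U) => /UhU; rewrite actVK.
  by apply; apply: f1U.
have cE : comm_of f1 (comm_of f2 h) = comm_of f1 f2.
  have -> : comm_of f2 h = f2 * k by rewrite /comm_of /k !mulgA.
  clearbody k.
  have kf1 : k * f1^-1 = f1^-1 * k := commuteV (commute_sym f1k).
  by rewrite /comm_of invgM !mulgA -(mulgA _ k) kf1 !mulgA mulgK.
exists f1, f2; rewrite cE; split; [exact: gU|exact: gU| |].
  move=> c1; apply: f12; apply: (@mulIg _ f1^-1); rewrite mulgK.
  by apply: (@mulIg _ f2^-1); rewrite mulgV.
apply: gU => y cy; apply: contra_notP cy => Uy.
have f1y := supp_inN f1U Uy; have f2y := supp_inN f2U Uy.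
by rewrite /comm_of !actM (act_fixV f2y) (act_fixV f1y) f2y f1y.
Qed.
Lemma act_comm_fix f h x : act h x = x -> act h (act f^-1 x) = act f^-1 x ->
  act (comm_of f h) x = x.
Proof.
move=> hx hfx; rewrite /comm_of 3!actM (act_fixV hx) hfx.
by rewrite -actM mulgV act1.
Qed.

Lemma act_fix_pow g n m x : act (g ^+ n) x = x -> n %| m -> act (g ^+ m) x = x.
Proof.
move=> gx /dvdnP[q ->]; rewrite mulnC expgnA.
by elim: q => [|q IH]; rewrite ?expg0 ?act1 // expgS actM IH.
Qed.

Lemma powers_moved_nbhd g n x :
  nbhd x (fun=> True) -> (forall k, 0 < k <= n -> act (g ^+ k) x <> x) ->
  exists2 V, nbhd x V & forall k, 0 < k <= n -> forall y, V y -> ~ V (act (g ^+ k) y).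
Proof.
move=> xT; elim: n => [|n IH] gx; first by exists (fun=> True) => // -[].
have [k kn|V xV VgV] := IH; first by apply: gx; case/andP: kn => -> /leqW.
have [W xW WgW] := moved_nbhd (gx n.+1 (ltnSn _)).
exists (fun y => V y /\ W y); first exact: (nbhdI lt_st).
move=> k /andP[k0]; rewrite leq_eqVlt => /orP[/eqP->|kn] y [Vy Wy] [Vgy].
  exact: WgW.
by move=> _; apply: (VgV k _ y) => //; rewrite k0.
Qed.

(* Orders 1, 2, 3, 4 all divide 12, so a point moved by [g ^+ 12] has five
   distinct images under powers of [g], one more than the four translates of a
   small neighbourhood that can support a double commutator. *)
Lemma disjoint_eta f g : eta f g -> disjoint_supp f (g ^+ 12).
Proof.
move=> fg x; have [->|fx] := pselect (act f x = x); [by left|right].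
apply: contrapT => gx.
have [k|V xV VgV] := @powers_moved_nbhd g 4 x (nbhdS (fun _ _ => I) (supp_open fx)).
  by move=> kn gkx; apply/gx/(act_fix_pow gkx); case: k kn {gkx} => [|[|[|[|[|]]]]].
have [W xW WfW] := moved_nbhd fx.
have [h [z [hVW hz]]] := local_nontrivial (nbhdI lt_st xV xW).
have hV y : act h y <> y -> V y by move=> /hVW[].
have [|f1 [f2 [f1g f2g k1]]] := fg h.
  move=> fh; apply: hz; rewrite (not_commute_moved WfW _ fh) ?act1 //.
  by move=> t /hVW[].
set k := comm_of f1 _ in k1 * => kg.
have [y ky] : exists y, act k y <> y.
  by apply: contra_notP k1 => /forallNP k1; apply: act_faithful => y; apply: contrapT.
have kgy i : act k (act (g ^+ i) y) <> act (g ^+ i) y.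
  by rewrite -actM (commuteX i kg) actM => /act_inj.
(* If the double commutator moves a point, then [h] moves one of these four translates of it, which
   therefore lies in [V]. *)
pose t (j : 'I_4) := nth 1 [:: 1; f2^-1; f1^-1; f2^-1 * f1^-1] j.
have tg j : commute (t j) g.
  have f1g' := commute_sym (commuteV (commute_sym f1g)).
  have f2g' := commute_sym (commuteV (commute_sym f2g)).
  case: j => -[|[|[|[|//]]]] lt_j4; rewrite /t //=.
    exact/commute_sym/commute1.
  exact/commute_sym/commuteM/commute_sym.
have tV (i : 'I_5) : exists j, V (act (g ^+ i) (act (t j) y)).
  suff [j hj] : exists j, act h (act (t j) (act (g ^+ i) y)) <> act (t j) (act (g ^+ i) y).
    by exists j; apply: hV; rewrite -[act (g ^+ i) _]actM -(commuteX i (tg j)) actM.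
  apply: contra_notP (kgy i) => /forallNP hj.
  have {}hj j : act h (act (t j) (act (g ^+ i) y)) = act (t j) (act (g ^+ i) y).
    exact: contrapT.
  have := hj (Ordinal (isT : 0 < 4)); have := hj (Ordinal (isT : 1 < 4)).
  have := hj (Ordinal (isT : 2 < 4)); have := hj (Ordinal (isT : 3 < 4)).
  rewrite /t /= act1 actM => h3 h2 h1 h0.
  by apply: act_comm_fix; apply: act_comm_fix.
have [j jV] := choice tV.
have /injectivePn [i [i' ii' e]] : ~~ injectiveb j.
  by apply/negP => /injectiveP /leq_card; rewrite !card_ord.
wlog lt_ii' : i i' ii' e / i < i'.
  move=> wl; have [|i'i|/ord_inj/eqP] := ltngtP i i'; first exact: wl.
    by apply: (wl i' i) => //; rewrite eq_sym.
  by rewrite (negPf ii').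
apply: (VgV (i' - i) _ _ (jV i)).
  by rewrite subn_gt0 lt_ii' (leq_trans (leq_subr _ _)) // -ltnS ltn_ord.
by rewrite -actM -expgnDr subnK ?(ltnW lt_ii') // e.
Qed.

Definition int_fix f x := nbhd x (fun y => act f y = y).

(** [int_fix f] is the complement of the closure of the support of [f]. Supports being open, the
    condition places the support of [h] in the interior of that closure, the regularized support of
    [f]. *)
Definition le_supp h f := forall x, int_fix f x -> act h x = x.

Lemma int_fix_fix f x : int_fix f x -> act f x = x.
Proof. exact: nbhd_mem. Qed.

Lemma le_suppxx f : le_supp f f.
Proof. by move=> x /int_fix_fix. Qed.

Lemma le_supp_int_fix h f x : le_supp h f -> int_fix f x -> int_fix h x.
Proof. by move=> hf xf; apply: nbhdS (nbhd_nbhd xf) => y; apply: hf. Qed.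

Lemma fix_closed f x : (forall V, nbhd x V -> exists2 y, V y & act f y = y) ->
  act f x = x.
Proof. by move=> fV; apply: contrapT => /supp_open /fV [y]. Qed.

Lemma disjoint_int_fix f g x : disjoint_supp f g -> act f x <> x -> int_fix g x.
Proof. by move=> fg fx; apply: nbhdS (supp_open fx) => y; case: (fg y). Qed.

(** The elements [g ^+ 12] with [eta f g] act off the support of [f], and near every interior fixed
    point of [f] some of them is nontrivial. An [h] moving such a point would displace its support
    and could not commute with it. *)
Lemma le_suppP h f : le_supp h f <-> (forall g, eta f g -> commute h (g ^+ 12)).
Proof.
split=> [hf g /disjoint_eta fg|hf x fx].
  apply: commute_disjoint => x; have [->|gx] := pselect (act (g ^+ 12) x = x).
    by right.
  by left; apply/hf/(disjoint_int_fix _ gx) => y; case: (fg y); [right|left].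
apply: contrapT => /moved_nbhd [V xV VhV].
have [g [y [gV gy]]] := local_move (nbhdI lt_st xV fx).
have /hf/(not_commute_moved VhV) g1 : eta f g.
  apply: eta_disjoint => z; have [->|/gV[_]] := pselect (act g z = z); by [right|left].
apply: gy; rewrite g1 ?act1 // => z gz; apply: (gV z _).1 => e; apply: gz.
by elim: 12 => [|n IH]; rewrite ?expg0 ?act1 // expgS actM IH.
Qed.

(** With [le_supp] available, disjointness itself, free of the power 12, becomes a property of the
    group. *)
Lemma disjoint_suppP f g :
  disjoint_supp f g <-> (forall h, le_supp h f -> commute h g).
Proof.
split=> [fg h hf|fg x].
  apply: commute_disjoint => x; have [->|gx] := pselect (act g x = x); first by right.
  by left; apply/hf/(disjoint_int_fix _ gx) => y; case: (fg y); [right|left].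
have [->|fx] := pselect (act f x = x); [by left|right].
apply: contrapT => /moved_nbhd [V xV VgV].
have [h [y [hV hy]]] := local_nontrivial (nbhdI lt_st xV (supp_open fx)).
apply: hy; rewrite (not_commute_moved VgV _ (commute_sym (fg h _))) ?act1 //.
  by move=> z /hV[].
by move=> z fz; apply: contrapT => /hV [_]; apply; exact: int_fix_fix.
Qed.


(** * Arcs *)

Hypothesis R_complete : complete_circle lt.

(** The complement of the interior fixed points is the closed arc from [a] to [b], so the
    regularized support is the open one, although [f] may fix points inside it. *)
Definition is_arc f a b := a <> b /\ forall x, int_fix f x <-> R b x a.

Definition inarc f p := exists a b, is_arc f a b /\ R a p b.

Lemma arc_sub a b a' b' : a <> b -> a' <> b' ->
  (forall x, R b x a -> R b' x a') ->
  [/\ a' = a \/ R a a' b, b' = b \/ R a b' b, a' = a \/ R a a' b'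
    & b' = b \/ R a' b' b].
Proof.
move=> ab ab' sub; have [x _ bxa] := P_dense (nesym ab).
move: (sub _ bxa) (sub a') (sub b') => ? ? ?.
by split; cyclia lt_st [:: a; b; a'; b'; x].
Qed.

Lemma is_arc_uniq f a b a' b' : is_arc f a b -> is_arc f a' b' -> a = a' /\ b = b'.
Proof.
move=> [ab fab] [ab' fab'].
have sub x : R b x a -> R b' x a' by move=> /fab /fab'.
have sub' x : R b' x a' -> R b x a by move=> /fab' /fab.
have [? ? ? ?] := arc_sub ab ab' sub; have [? ? ? ?] := arc_sub ab' ab sub'.
by cyclia lt_st [:: a; b; a'; b'].
Qed.

Lemma int_fix_conj g f x : int_fix f x -> int_fix (g * f * g^-1) (act g x).
Proof.
rewrite /int_fix -{1}(actK g x) => /act_nbhd; apply: nbhdS => y fy.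
by rewrite !actM fy actVK.
Qed.

Lemma int_fix_conjE g f x : int_fix (g * f * g^-1) x <-> int_fix f (act g^-1 x).
Proof.
split; last by move=> /(int_fix_conj g); rewrite actVK.
by move=> /(int_fix_conj g^-1); rewrite invgK !mulgA mulVg mul1g -mulgA mulVg mulg1.
Qed.

Lemma is_arc_conj g f a b : preserving R (act g) ->
  is_arc f a b -> is_arc (g * f * g^-1) (act g a) (act g b).
Proof.
move=> gR [ab fab]; split=> [/act_inj //|x].
by rewrite int_fix_conjE fab -gR actVK.
Qed.

Lemma inarc_conj g f p : inarc f p -> inarc (g * f * g^-1) (act g p).
Proof.
move=> [a [b [fab apb]]]; have [gR|gR] := act_mono g.
  by exists (act g a), (act g b); split; [apply: is_arc_conj|rewrite gR].
exists (act g b), (act g a); split; last by rewrite gR.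
by split=> [/act_inj/esym/fab.1 //|x]; rewrite int_fix_conjE fab.2 -gR actVK.
Qed.

Lemma arc_ends_fixed f h a b : is_arc f a b -> le_supp h f ->
  act h a = a /\ act h b = b.
Proof.
move=> [ab fab] hf; split; apply: fix_closed => V.
  move=> /(nbhd_small lt_st P_dense ab) [s [t [sat stb stV]]].
  have [y _ ?] := @P_dense s a (ltac:(cyclia lt_st [:: a; s; t])).
  exists y; first by apply: stV; cyclia lt_st [:: a; s; t; y].
  by apply/hf/fab; cyclia lt_st [:: a; b; s; t; y].
move=> /(nbhd_small lt_st P_dense (nesym ab)) [s [t [sbt sta stV]]].
have [y _ ?] := @P_dense b t (ltac:(cyclia lt_st [:: b; s; t])).
exists y; first by apply: stV; cyclia lt_st [:: b; s; t; y].
by apply/hf/fab; cyclia lt_st [:: a; b; s; t; y].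
Qed.

Lemma supp_arc f h a b x : is_arc f a b -> le_supp h f -> act h x <> x -> R a x b.
Proof.
move=> fab hf hx; have [ha hb] := arc_ends_fixed fab hf.
have xa : x <> a by move=> e; apply: hx; rewrite e.
have xb : x <> b by move=> e; apply: hx; rewrite e.
have : ~ R b x a by move=> /fab.2 /hf.
by have := fab.1; cyclia lt_st [:: a; b; x].
Qed.

Lemma le_supp_arc f h a b : is_arc f a b ->
  le_supp h f <-> supp_in h (fun x => R a x b).
Proof.
move=> fab; split=> [hf x|hab x /fab.2 bxa]; first exact: (supp_arc fab hf).
by apply: (supp_inN hab); cyclia lt_st [:: a; b; x].
Qed.

Lemma fix3_preserving h a b c : R a b c -> act h a = a -> act h b = b ->
  act h c = c -> preserving R (act h).
Proof.
move=> abc ha hb hc; have [//|/(_ c b a)] := act_mono h.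
by rewrite ha hb hc => -[_ /(_ abc)]; cyclia lt_st [:: a; b; c].
Qed.

Lemma le_supp_arc_preserving f h a b : is_arc f a b -> le_supp h f ->
  preserving R (act h).
Proof.
move=> fab hf; have [ha hb] := arc_ends_fixed fab hf.
have [x _ bxa] := P_dense (nesym fab.1).
by apply: (fix3_preserving bxa) => //; apply/hf/fab.2.
Qed.

Lemma not_disjointP f g :
  ~ disjoint_supp f g <-> exists2 x, act f x <> x & act g x <> x.
Proof.
split; first by move=> /existsNP [x /not_orP[? ?]]; exists x.
by move=> [x fx gx] /(_ x) [].
Qed.

(** Being an arc in group terms: the first condition leaves room outside the support, and the last
    is a form of connectedness, since an interior fixed point would keep supports on its two sides
    apart. *)
Definition arc_like f :=
  [/\ exists2 g, g <> 1 & disjoint_supp f g, f <> 1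
    & forall v w, v <> 1 -> w <> 1 -> le_supp v f -> le_supp w f ->
      exists2 h, le_supp h f & ~ disjoint_supp (h * v * h^-1) w].

Lemma neq1_moved g : g <> 1 -> exists x, act g x <> x.
Proof.
by apply: contra_notP => /forallNP g1; apply: act_faithful => x; apply: contrapT.
Qed.

Lemma is_arc_like f a b : is_arc f a b -> arc_like f.
Proof.
move=> fab; have [x _ bxa] := P_dense (nesym fab.1).
have [y _ ayb] := P_dense fab.1.
split.
- have [g [t [gba gt]]] := local_nontrivial (nbhd_arc bxa).
  exists g; first by move=> g1; apply: gt; rewrite g1 act1.
  move=> z; have [->|/gba bza] := pselect (act g z = z); first by right.
  by left; apply/int_fix_fix/fab.2.
- move=> f1; have : R b y a.
    by apply/fab.2; exists a, b; split=> // t _; rewrite f1 act1.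
  by cyclia lt_st [:: a; b; y].
move=> v w /neq1_moved[s0 vs] /neq1_moved[t0 wt] vf wf.
have {vs}[s Ps vs] := nbhd_dense lt_st P_dense (supp_open vs).
have {wt}[t Pt wt] := nbhd_dense lt_st P_dense (supp_open wt).
have [h h_id hs] := act_move Ps Pt (supp_arc fab vf vs) (supp_arc fab wf wt).
exists h; first by apply/(le_supp_arc _ fab) => z; apply: contra_notP => /h_id.
by apply/not_disjointP; exists t => //; rewrite -hs act_conj => /act_inj.
Qed.

(** The closed support [K], seen from a point [z] outside it, has an infimum [a] and a supremum [b].
    An interior fixed point of [f] between them is fixed by every element below [f], so none can
    carry a support from one side of it to meet one on the other. *)
Lemma arc_like_is_arc f : arc_like f -> exists a b, is_arc f a b.
Proof.
move=> [[g /neq1_moved [z gz] fg] /neq1_moved[x0 fx0] conv].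
have zf : int_fix f z.
  by apply: disjoint_int_fix gz => y; case: (fg y); [right|left].
pose K x := ~ int_fix f x.
have Kx0 : K x0 by move=> /int_fix_fix.
have [s [t [szt stf]]] := nbhd_nbhd zf.
have Kst x : K x -> ~ R s x t by move=> Kx /stf.
have x0z : x0 <> z by move=> e; apply: Kx0; rewrite e.
have [|x /Kst|b [bz Kb lb]] := @R_complete z x0 s K Kx0.
- by cyclia lt_st [:: s; t; z].
- have := Kst x; cyclia lt_st [:: s; t; x; z].
have [|x /Kst|//|a [az aK ga]] := @complete_inf _ _ lt_st R_complete z x0 t K Kx0.
- by cyclia lt_st [:: s; t; z].
- by cyclia lt_st [:: s; t; x; z].
have Kclosed x : x <> z -> int_fix f x -> exists s t,
    [/\ R s x t, R s t z & forall y, K y -> ~ R s y t].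
  move=> xz fx; have [s' [t' [? ? sub]]] := nbhd_small lt_st P_dense xz (nbhd_nbhd fx).
  by exists s', t'; split=> // y Ky /sub.
have nb : K b.
  move=> /(Kclosed _ bz) [s' [t' [sbt stz sub]]].
  have : b = s' \/ R z b s'.
    apply: lb; first by cyclia lt_st [:: b; z; s'; t'].
    by move=> y Ky; move: (Kb y Ky) (sub y Ky); cyclia lt_st [:: b; z; s'; t'; y].
  by cyclia lt_st [:: b; z; s'; t'].
have na : K a.
  move=> /(Kclosed _ az) [s' [t' [sat stz sub]]].
  have : t' = a \/ R z t' a.
    apply: ga; first by cyclia lt_st [:: a; z; s'; t'].
    by move=> y Ky; move: (aK y Ky) (sub y Ky); cyclia lt_st [:: a; z; s'; t'; y].
  by cyclia lt_st [:: a; z; s'; t'].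
have ab_near y : K y -> (y = a \/ R z a y) /\ (y = b \/ R z y b).
  by move=> Ky; split; [case: (aK y Ky); [left|right]|exact: Kb].
have ab : a <> b.
  move=> ab; have [s' [t' [s'x0 sub]]] := supp_open fx0.
  have [y _ s'y] := @P_dense s' x0 (ltac:(cyclia lt_st [:: s'; t'; x0])).
  have /sub fy : R s' y t' by cyclia lt_st [:: s'; t'; x0; y].
  have Ky : K y by move=> /int_fix_fix.
  move: (ab_near _ Ky) (ab_near _ Kx0); rewrite -ab.
  by cyclia lt_st [:: s'; x0; y; a; z].
have zab : R z a b by case: (ab_near _ nb).1; [move/nesym|].
exists a, b; split=> // x; split; last first.
  by move=> bxa; apply: contrapT => /ab_near; cyclia lt_st [:: a; b; x; z].
move=> fx; apply: contrapT => bxa.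
have xa : x <> a by move=> e; apply: na; rewrite -e.
have xb : x <> b by move=> e; apply: nb; rewrite -e.
have [zax zxb] : R z a x /\ R z x b by split; cyclia lt_st [:: a; b; x; z].
have moved_in s' t' k : K k -> R s' k t' -> exists2 y, R s' y t' & act f y <> y.
  move=> Kk skt; apply: contra_notP Kk => /forall2NP sub; exists s', t'; split=> // y syt.
  by apply: contrapT; case: (sub y).
have [y zyx fy] := moved_in z x a na zax.
have [y' xyz fy'] := moved_in x z b nb (ltac:(cyclia lt_st [:: b; x; z])).
have [v [v0 [vV v1]]] := local_nontrivial (nbhdI lt_st (nbhd_arc zyx) (supp_open fy)).
have [w [w0 [wV w1]]] := local_nontrivial (nbhdI lt_st (nbhd_arc xyz) (supp_open fy')).
have le_f h V : supp_in h (fun u => V u /\ act f u <> u) -> le_supp h f.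
  move=> hV u /int_fix_fix fu; apply: (supp_inN hV) => -[_]; exact.
have [||h hf /not_disjointP [u hvu wu]] := conv v w _ _ (le_f _ _ vV) (le_f _ _ wV).
- by move=> e; apply: v1; rewrite e act1.
- by move=> e; apply: w1; rewrite e act1.
have [xuz _] := wV _ wu.
have [|zux _] := vV (act h^-1 u).
  by move=> e; apply: hvu; rewrite !actM e actVK.
have xz : x <> z by cyclia lt_st [:: a; x; z].
(* Fixing [x] and [z] alone would allow a reflection that exchanges the two sides; a third fixed
   point [z'] near [z] excludes it. *)
have [s' [t' [s'zt s'tx sub]]] := nbhd_small lt_st P_dense (nesym xz) (nbhd_nbhd zf).
have [z' _ s'z'z] := @P_dense s' z (ltac:(cyclia lt_st [:: s'; t'; z])).
have z'f : int_fix f z' by apply: sub; cyclia lt_st [:: s'; t'; z; z'].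
have z'zx : R z' z x by cyclia lt_st [:: s'; t'; z; z'; x].
have hR := fix3_preserving z'zx (hf _ z'f) (hf _ zf) (hf _ fx).
have := hR z (act h^-1 u) x; rewrite actVK (hf _ zf) (hf _ fx) => -[_ /(_ zux)].
by cyclia lt_st [:: x; z; u].
Qed.

Lemma arc_moved f a b x V : is_arc f a b -> R a x b -> nbhd x V ->
  exists2 y, V y & act f y <> y.
Proof.
move=> fab axb xV; have : ~ int_fix f x by move=> /fab.2; cyclia lt_st [:: a; b; x].
apply: contra_notP => /forall2NP fV; apply: nbhdS xV => y Vy.
by apply: contrapT; case: (fV y).
Qed.

Lemma disjoint_arcs f g a b a' b' x : is_arc f a b -> is_arc g a' b' ->
  disjoint_supp f g -> R a x b -> R a' x b' -> False.
Proof.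
move=> fab gab fg axb axb'.
have [y [ayb ayb'] fy] := arc_moved fab axb (nbhdI lt_st (nbhd_arc axb) (nbhd_arc axb')).
have [z fz gz] := arc_moved gab ayb' (supp_open fy).
by case: (fg z).
Qed.

(** Compact containment of arcs in group terms: if the two arcs share an end, elements below [f] fix
    that end and cannot displace the smaller arc off itself. *)
Definition well_inside f' f :=
  le_supp f' f /\ exists2 g, le_supp g f & disjoint_supp (g * f' * g^-1) f'.

Lemma arcs_well_inside f f' a b a' b' : is_arc f a b -> is_arc f' a' b' ->
  R a a' b' -> R a b' b -> well_inside f' f.
Proof.
move=> fab fab' aab abb.
have f'b x : act f' x <> x -> R a' x b' := supp_arc fab' (@le_suppxx f').
split; first by apply/(le_supp_arc _ fab) => x /f'b; cyclia lt_st [:: a; b; a'; b'; x].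
(* Sending a point before the inner arc to one behind it throws the whole inner arc off itself. *)
have [u Pu aua] := @P_dense a a' (ltac:(cyclia lt_st [:: a; b; a'; b'])).
have [v Pv bvb] := @P_dense b' b (ltac:(cyclia lt_st [:: a; b; a'; b'])).
have [||g g_id gu] := @act_move a b u v Pu Pv.
- by cyclia lt_st [:: a; b; a'; b'; u].
- by cyclia lt_st [:: a; b; a'; b'; v].
have gf : le_supp g f by apply/(le_supp_arc _ fab) => x; apply: contra_notP => /g_id.
exists g => // x; have [->|/f'b axb] := pselect (act f' x = x); first by right.
left; apply: contrapT => gfx.
have /f'b axb' : act f' (act g^-1 x) <> act g^-1 x.
  by move=> e; apply: gfx; rewrite !actM e actVK.
have := le_supp_arc_preserving fab gf u (act g^-1 x) b.
rewrite gu (arc_ends_fixed fab gf).2 actVK; move: axb'; move: (act _ x) => y ayb' [_ h].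
have /h : R u y b by cyclia lt_st [:: a; b; a'; b'; u; y].
by cyclia lt_st [:: a; b; a'; b'; v; x].
Qed.

Lemma well_inside_arcs f f' a b a' b' : is_arc f a b -> is_arc f' a' b' ->
  well_inside f' f -> R a a' b' /\ R a b' b.
Proof.
move=> fab fab' [f'f [g gf dis]].
have sub x : R b x a -> R b' x a' by move=> /fab.2 /(le_supp_int_fix f'f)/fab'.2.
have [] := arc_sub fab.1 fab'.1 sub.
have [ga gb] := arc_ends_fixed fab gf.
have gfab := is_arc_conj (le_supp_arc_preserving fab gf) fab'.
have [aa' _ bb' _ _|aa'] := pselect (a' = a).
  subst a'; rewrite ga in gfab.
  have [x [axb axgb]] : exists x, R a x b' /\ R a x (act g b').
    have := fab'.1; have := gfab.1; move: (act g b') => c ac ab'.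
    have [x _ axb] := P_dense ab'; have [y _ ayc] := P_dense ac.
    have [axc|axc] := pselect (R a x c); first by exists x.
    by exists y; split=> //; cyclia lt_st [:: a; b'; c; x; y].
  by case: (disjoint_arcs gfab fab' dis axgb axb).
have [bb' _ _ _ _|bb'] := pselect (b' = b).
  subst b'; rewrite gb in gfab.
  have [x [axb axgb]] : exists x, R a' x b /\ R (act g a') x b.
    have := fab'.1; have := gfab.1; move: (act g a') => c ac ab'.
    have [x _ axb] := P_dense ab'; have [y _ ayc] := P_dense ac.
    have [axc|axc] := pselect (R c x b); first by exists x.
    by exists y; split=> //; cyclia lt_st [:: a'; b; c; x; y].
  by case: (disjoint_arcs gfab fab' dis axgb axb).
by have := fab'.1; cyclia lt_st [:: a; b; a'; b'].
Qed.

Lemma inarc_uniq f p a b : is_arc f a b -> inarc f p -> R a p b.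
Proof. by move=> fab [a' [b' [/(is_arc_uniq fab)[<- <-]]]]. Qed.

Lemma inarc_arc_like f p : inarc f p -> arc_like f.
Proof. by move=> [a [b [/is_arc_like]]]. Qed.

Hypothesis act_bump : forall a b, a <> b -> exists f, is_arc f a b.
Hypothesis nontrivial : forall p : X, exists q, q <> p.

Lemma nbhdT p : nbhd p (fun=> True).
Proof.
have [q qp] := nontrivial p; have [a _ qap] := P_dense qp.
by exists a, q; split=> //; cyclia lt_st [:: a; p; q].
Qed.

Lemma inarc_ex p : exists f, inarc f p.
Proof.
have [a [b [apb _]]] := nbhdT p.
have [|f fab] := @act_bump a b; first by cyclia lt_st [:: a; b; p].
by exists f, a, b.
Qed.

Lemma inarc_refine f1 f2 p : inarc f1 p -> inarc f2 p ->
  exists f, [/\ inarc f p, well_inside f f1 & well_inside f f2].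
Proof.
move=> [a1 [b1 [f1ab apb1]]] [a2 [b2 [f2ab apb2]]].
have [a [b [apb sub]]] := nbhdI lt_st (nbhd_arc apb1) (nbhd_arc apb2).
have [a' _ aap] := @P_dense a p (ltac:(cyclia lt_st [:: a; b; p])).
have [b' _ pbb] := @P_dense p b (ltac:(cyclia lt_st [:: a; b; p])).
have [|f fab] := @act_bump a' b'; first by cyclia lt_st [:: a; b; p; a'; b'].
have [a1a' a2a'] := sub a' (ltac:(cyclia lt_st [:: a; b; p; a'])).
have [a1b' a2b'] := sub b' (ltac:(cyclia lt_st [:: a; b; p; b'])).
have na1 : ~ R a a1 b by move=> /sub []; cyclia lt_st [:: a1; b1].
have na2 : ~ R a a2 b by move=> /sub [_]; cyclia lt_st [:: a2; b2].
exists f; split.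
- by exists a', b'; split=> //; cyclia lt_st [:: a; b; p; a'; b'].
- by apply: (arcs_well_inside f1ab fab); cyclia lt_st [:: a; b; p; a'; b'; a1; b1].
- by apply: (arcs_well_inside f2ab fab); cyclia lt_st [:: a; b; p; a'; b'; a2; b2].
Qed.

Lemma inarc_sep p q : p <> q -> exists2 f, inarc f p & ~ inarc f q.
Proof.
move=> pq; have [a [b [apb abq _]]] := nbhd_small lt_st P_dense pq (nbhdT p).
have [|f fab] := @act_bump a b; first by cyclia lt_st [:: a; b; p].
exists f; first by exists a, b.
by move=> /(inarc_uniq fab); cyclia lt_st [:: a; b; q].
Qed.

Lemma gaut_commute (s : gaut H) g h : commute g h -> commute (s g) (s h).
Proof. by rewrite /commute -!gaut_morph => ->. Qed.
Arguments gaut_commute s [g h].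

Lemma gautVK (s : gaut H) g : s (s^-1 g) = g.
Proof. by rewrite -[RHS](gautV s^-1) invgK. Qed.

Lemma gaut_pow (s : gaut H) g n : s (g ^+ n) = s g ^+ n.
Proof. by elim: n => [|n IH]; rewrite ?expg0 ?gaut_morph1 // !expgS gaut_morph IH. Qed.

Lemma gaut_comm_of (s : gaut H) g h : s (comm_of g h) = comm_of (s g) (s h).
Proof. by rewrite /comm_of !gaut_morph !gaut_morphV. Qed.

Lemma gaut_neq1 (s : gaut H) g : g <> 1 -> s g <> 1.
Proof. by move=> g1 e; apply: g1; rewrite -(gautV s g) e gaut_morph1. Qed.
Arguments gaut_neq1 s [g].

Lemma gaut_eta (s : gaut H) f g : eta f g -> eta (s f) (s g).
Proof.
move=> fg h; rewrite -(gautVK s h); move: (s^-1 h) => {}h fh.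
have [|f1 [f2 [f1g f2g c1 cg]]] := fg h; first by move=> /(gaut_commute s).
exists (s f1), (s f2); rewrite -!gaut_comm_of.
by split; [exact: gaut_commute|exact: gaut_commute|exact: gaut_neq1|exact: gaut_commute].
Qed.
Arguments gaut_eta s [f g].

Lemma gaut_le_supp (s : gaut H) h f : le_supp h f -> le_supp (s h) (s f).
Proof.
move=> /le_suppP hf; apply/le_suppP => g /(gaut_eta s^-1); rewrite gautV => /hf.
by move=> /(gaut_commute s); rewrite gaut_pow gautVK.
Qed.
Arguments gaut_le_supp s [h f].

Lemma gaut_disjoint (s : gaut H) f g :
  disjoint_supp f g -> disjoint_supp (s f) (s g).
Proof.
move=> /disjoint_suppP fg; apply/disjoint_suppP => h /(gaut_le_supp s^-1).
by rewrite gautV => /fg /(gaut_commute s); rewrite gautVK.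
Qed.
Arguments gaut_disjoint s [f g].

Lemma gaut_conj (s : gaut H) g h : s (g * h * g^-1) = s g * s h * (s g)^-1.
Proof. by rewrite !gaut_morph gaut_morphV. Qed.

Lemma gaut_arc_like (s : gaut H) f : arc_like f -> arc_like (s f).
Proof.
move=> [[g g1 fg] f1 conv]; split; last 1 first.
- move=> v w /(gaut_neq1 s^-1) v1 /(gaut_neq1 s^-1) w1.
  move=> /(gaut_le_supp s^-1) + /(gaut_le_supp s^-1); rewrite gautV => vf wf.
  have [h hf dis] := conv _ _ v1 w1 vf wf.
  exists (s h); first exact: gaut_le_supp.
  apply: contra_not dis => /(gaut_disjoint s^-1).
  by rewrite gaut_conj gautV.
- by exists (s g); [exact: gaut_neq1|exact: gaut_disjoint].
- exact: gaut_neq1.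
Qed.
Arguments gaut_arc_like s [f].

Lemma gaut_well_inside (s : gaut H) f g :
  well_inside f g -> well_inside (s f) (s g).
Proof.
move=> [fg [h hg dis]]; split; first exact: gaut_le_supp.
by exists (s h); [exact: gaut_le_supp|rewrite -gaut_conj; exact: gaut_disjoint].
Qed.
Arguments gaut_well_inside s [f g].

(* The arcs of [s f], for [f] with [p] in its arc, are directed under [well_inside];
   the supremum of their left endpoints lies in all of them. *)
Lemma gaut_inarc (s : gaut H) p : exists q, forall f, inarc f p -> inarc (s f) q.
Proof.
have sarc f : inarc f p -> exists a b, is_arc (s f) a b.
  by move=> /inarc_arc_like/gaut_arc_like/arc_like_is_arc.
have [f0 f0p] := inarc_ex p; have [a0 [b0 f0ab]] := sarc _ f0p.
have [z _ bza] := P_dense (nesym f0ab.1).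
pose S a := exists f b, [/\ inarc f p, well_inside f f0 & is_arc (s f) a b].
have S_in f a b : well_inside f f0 -> is_arc (s f) a b -> R a0 a b /\ R a0 b b0.
  by move=> /(gaut_well_inside s) + sfab; apply: well_inside_arcs.
have [f1 [f1p f10 _]] := inarc_refine f0p f0p; have [a1 [b1 f1ab]] := sarc _ f1p.
have Sa1 : S a1 by exists f1, b1.
have [|a [f [b [fp ff0 fab]]]|m [mz mS ml]] := @R_complete z a1 b0 S Sa1.
- by cyclia lt_st [:: a0; b0; z].
- have [? ?] := S_in _ _ _ ff0 fab; right; cyclia lt_st [:: a0; b0; z; a; b].
exists m => f fp; have [a [b sfab]] := sarc _ fp.
have [f2 [f2p f2f f20]] := inarc_refine fp f0p.
have [a2 [b2 f2ab]] := sarc _ f2p.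
have [a0a2 a0b2] := S_in _ _ _ f20 f2ab.
have mb2 : m = b2 \/ R z m b2.
  apply: ml => [|a3 [f3 [b3 [f3p f30 f3ab]]]]; first by cyclia lt_st [:: a0; b0; z; a2; b2].
  have [a0a3 a0b3] := S_in _ _ _ f30 f3ab.
  have [f4 [f4p f42 f43]] := inarc_refine f2p f3p; have [a4 [b4 f4ab]] := sarc _ f4p.
  have [? ?] := well_inside_arcs f2ab f4ab (gaut_well_inside s f42).
  have [? ?] := well_inside_arcs f3ab f4ab (gaut_well_inside s f43).
  right; cyclia lt_st [:: a0; b0; z; a2; b2; a3; b3; a4; b4].
have am : a2 = m \/ R z a2 m by apply: mS; exists f2, b2.
have [? ?] := well_inside_arcs sfab f2ab (gaut_well_inside s f2f).
by exists a, b; split=> //; cyclia lt_st [:: a0; b0; z; a; b; a2; b2; m].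
Qed.

(** The point maps induced by [s] and its inverse are mutually inverse because arcs separate points.
    Equivariance holds because a point is determined by the elements whose arc contains it, and
    conjugation moves these arcs along with the point. *)
Lemma reconstruction (s : gaut H) : exists2 c : bijn X,
  preserving R c \/ reversing R c & forall h x, act (s h) (c x) = c (act h x).
Proof.
have [c sc] := choice (gaut_inarc s); have [c' sc'] := choice (gaut_inarc s^-1).
have cK : cancel c c'.
  move=> p; apply: contrapT => /nesym/inarc_sep [f fp]; apply.
  by have := sc' _ _ (sc _ _ fp); rewrite gautV.
have c'K : cancel c' c.
  move=> p; apply: contrapT => /nesym/inarc_sep [f fp]; apply.
  by have := sc _ _ (sc' _ _ fp); rewrite gautVK.
have scE f p : inarc (s f) (c p) <-> inarc f p.
  by split=> [/sc'|/sc //]; rewrite gautV cK.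
exists (Bijn cK c'K) => [|h x] /=.
  apply: (arcs_monotone lt_st P_dense (can_inj cK)) => a b ab.
  have [f fab] := act_bump ab.
  have [a' [b' fab']] := arc_like_is_arc (gaut_arc_like s (is_arc_like fab)).
  exists a', b' => x; split=> [axb|axb].
    by apply: (inarc_uniq fab'); apply/scE; exists a, b.
  by apply: (inarc_uniq fab); apply/scE; exists a', b'.
apply: contrapT => /nesym/inarc_sep [f]; rewrite -(gautVK s f).
move: (s^-1 f) => {}f /scE /(inarc_conj h^-1); rewrite actK => /sc fx nf.
apply: nf; move: fx => /(inarc_conj (s h)); rewrite gaut_conj gaut_morphV invgK !mulgA.
by rewrite mulgV mul1g -mulgA mulgV mulg1.
Qed.

(** Here the moved point is prescribed and may lie outside [P]; it moves because a point of [P]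
    before it is pushed past it. *)
Lemma local_move_at a b x : R a x b ->
  exists2 g, supp_in g (fun y => R a y b) & act g x <> x.
Proof.
move=> axb.
have [u Pu aux] := @P_dense a x (ltac:(cyclia lt_st [:: a; b; x])).
have [v Pv xvb] := @P_dense x b (ltac:(cyclia lt_st [:: a; b; x])).
have [||g g_id gu] := @act_move a b u v Pu Pv.
- by cyclia lt_st [:: a; b; x; u].
- by cyclia lt_st [:: a; b; x; v].
exists g => [y|gx]; first by apply: contra_notP => /g_id.
have ga : act g a = a by apply: g_id; cyclia lt_st [:: a; b].
have [gR|gR] := act_mono g.
  by have := gR a u x; rewrite ga gu gx; cyclia lt_st [:: a; b; x; u; v].
have gb : act g b = b by apply: g_id; cyclia lt_st [:: a; b].
by have := gR a x b; rewrite ga gb gx; cyclia lt_st [:: a; b; x].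
Qed.

Lemma centralizer_trivial (c : X -> X) : injective c ->
  (forall g x, c (act g x) = act g (c x)) -> forall x, c x = x.
Proof.
move=> c_inj cg x; apply: contrapT => cx.
have [a [b [axb abc _]]] := nbhd_small lt_st P_dense (nesym cx) (nbhdT x).
have [g gab gx] := local_move_at axb; apply: gx; apply: c_inj; rewrite cg.
by apply: (supp_inN gab); cyclia lt_st [:: a; b; c x].
Qed.

End LocalMovement.

(** * The Dedekind completion as a dense complete circle *)

Section Completion.
Variables (d : Order.disp_t) (L : orderType d).
Hypothesis L_dense : densely_ordered L.
Hypothesis L_endpoint : at_most_one_endpoint L.
Local Open Scope order_scope.

Definition cut_lt (A B : cbar L) := cut A `<` cut B.

Lemma cut_inj (A B : cbar L) : cut A = cut B -> A = B.
Proof. by case: A B => [A cA] [B cB] /= AB; subst B; congr Cbar; apply: Prop_irrelevance. Qed.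

Lemma cut_down (A : cbar L) x y : x <= y -> cut A y -> cut A x.
Proof.
case: A => A /= [[[a ->]|[_ _ down _]]|[_ ->]] // xy; last exact: down.
exact: le_lt_trans.
Qed.

Lemma cut_nomax (A : cbar L) x : cut A x -> exists2 y, cut A y & x < y.
Proof.
case: A => A /= [[[a ->]|[_ _ _ nomax]]|[_ ->]] //; last exact: nomax.
by move=> /L_dense [y]; exists y.
Qed.

Lemma cut_lt_st : strict_total cut_lt.
Proof.
split=> [A [//]|A B C [AB BA] [BC CB]|A B].
  by split=> [x /AB/BC//|CA]; apply: CB => x /CA/AB.
have [AB|/existsNP [x /not_implyP[Ax Bx]]] := pselect (cut A `<=` cut B).
  have [BA|BA] := pselect (cut B `<=` cut A); last by apply: Or31.
  by apply: Or32; apply: cut_inj; apply/seteqP.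
apply: Or33; split=> [y By|]; last by move=> /(_ _ Ax).
have [yx|xy] := leP y x; first exact: cut_down Ax.
by case: Bx; apply: cut_down By; apply: ltW.
Qed.

Lemma cut_leE (A B : cbar L) : (cut A `<=` cut B) <-> (A = B \/ cut_lt A B).
Proof.
split=> [AB|[->|[]]] //; have [BA|BA] := pselect (cut B `<=` cut A).
  by left; apply: cut_inj; apply/seteqP.
by right.
Qed.

Lemma cut_lt_pt x y : cut_lt (pt x) (pt y) <-> x < y.
Proof.
split=> [[_ yx]|xy].
  by rewrite ltNge; apply: contra_notN yx => yx z /=; move=> /lt_le_trans; apply.
split=> [z /= zx|]; first exact: lt_trans xy.
by move=> /(_ _ xy) /=; rewrite ltxx.
Qed.

Lemma pt_inj : injective (@pt d L).
Proof.
move=> x y e; have [irr _ _] := cut_lt_st.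
by case: (ltgtP x y) => // /cut_lt_pt; rewrite e => /irr.
Qed.

Lemma crbar_pt x y z : crbar L (pt x) (pt y) (pt z) <-> cr L x y z.
Proof.
rewrite /crbar /cr -/cut_lt !circularizeE.
by rewrite -!(propext (cut_lt_pt _ _)).
Qed.

Lemma cut_pt (A : cbar L) a : ~ cut A a -> cut A `<=` cut (pt a).
Proof.
move=> Aa x Ax /=; rewrite ltNge; apply/negP => ax.
by apply: Aa; apply: cut_down Ax.
Qed.

Lemma pt_cut (A : cbar L) a : cut A a -> cut_lt (pt a) A.
Proof.
move=> Aa; split=> [x /= xa|/(_ _ Aa) /=]; last by rewrite ltxx.
exact: cut_down (ltW xa) Aa.
Qed.

Lemma cut_lt_dense (A B : cbar L) : cut_lt A B ->
  exists z, cut_lt A (pt z) /\ cut_lt (pt z) B.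
Proof.
move=> [AB /existsNP [a /not_implyP[Ba Aa]]].
have [b Bb ab] := cut_nomax Ba; exists b; split; last exact: pt_cut.
have : cut_lt (pt a) (pt b) by apply/cut_lt_pt.
have /cut_leE := cut_pt Aa.
by linlia cut_lt_st [:: A; pt a; pt b].
Qed.

Lemma cut_neqT (A : cbar L) : (exists x : L, True) -> exists x, ~ cut A x.
Proof.
move=> [x _]; apply: contrapT => /forallNP AT.
case: A AT => A /= [[[a ->]|[_ AT _ _]]|[_ ->]] H.
- by apply: (H a); rewrite /= ltxx.
- by move/eqP: AT; apply; apply/seteqP; split=> // y _; apply: contrapT.
- by apply: (H x).
Qed.

(** The delicate arc passes through the ends of the line. It could miss [C] only if [A] were the
    greatest point of [L] and [B] had an empty cut. Then [B] is the least point of [L], a second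
    endpoint, or the adjoined element, which exists only when [L] has no endpoint. *)
Lemma crbar_dense (A B : cbar L) : A <> B -> exists z, crbar L A (pt z) B.
Proof.
move=> AB; rewrite /crbar -/cut_lt; have [irr tr tot] := cut_lt_st.
have [lAB|//|lBA] := tot A B.
  by have [z []] := cut_lt_dense lAB; exists z; linlia cut_lt_st [:: A; B; pt z].
have [x Ax] : exists x, ~ cut A x.
  by apply: cut_neqT; case: lBA => _ /existsNP [x _]; exists x.
have [Axx|e] := pselect (cut_lt A (pt x)).
  by exists x; linlia cut_lt_st [:: A; B; pt x].
have {e} Ae : A = pt x by have /cut_leE [] := cut_pt Ax.
have [[y Axy]|nA] := pselect (exists y, cut_lt A (pt y)).
  by exists y; linlia cut_lt_st [:: A; B; pt y].
have [[y By]|B0] := pselect (exists y, cut B y).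
  by exists y; have := pt_cut By; linlia cut_lt_st [:: A; B; pt y].
have xmax : endpoint x.
  right=> y; rewrite leNgt; apply/negP => xy; apply: nA; exists y.
  by rewrite Ae; apply/cut_lt_pt.
have [[[a BE]|[[y By] _ _ _]]|[noend _]] := cutP B.
- case: AB; rewrite Ae; apply: cut_inj; rewrite BE.
  suff -> : x = a by [].
  apply: L_endpoint xmax _; left=> y; rewrite leNgt; apply/negP => ya.
  by apply: B0; exists y; rewrite BE.
- by case: B0; exists y.
- by case: noend; exists x.
Qed.

(** If no member of [S] is greatest, the union of the cuts has no greatest element and is itself a
    cut. *)
Lemma cut_lub (S : cbar L -> Prop) s0 U : S s0 -> (forall s, S s -> s = U \/ cut_lt s U) ->
  exists M, (forall s, S s -> s = M \/ cut_lt s M) /\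
    forall V, (forall s, S s -> s = V \/ cut_lt s V) -> M = V \/ cut_lt M V.
Proof.
move=> S0 SU; have [irr tr tot] := cut_lt_st.
have [[M SM Mmax]|nomax] := pselect (exists2 M, S M & forall s, S s -> s = M \/ cut_lt s M).
  by exists M; split=> // V; apply.
have above s : S s -> exists2 s', S s' & cut_lt s s'.
  move=> Ss; apply: contra_notP nomax => /forall2NP ns; exists s => // s' Ss'.
  by case: (tot s' s) => [||ss']; [right|left|case: (ns s')].
pose A := [set x | exists2 s : cbar L, S s & cut s x].
have SA s : S s -> cut s `<=` A by move=> Ss x sx; exists s.
have AU : A `<=` cut U by move=> x [s Ss sx]; have /cut_leE := SU _ Ss; apply.
have cA : completion_cut A.
  left; right; split.
  - have [s1 Ss1 [_ /existsNP[x /not_implyP[s1x _]]]] := above _ S0.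
    by exists x, s1.
  - apply/eqP => AT; have [x] : exists x, ~ cut U x.
      apply: cut_neqT; have [s1 Ss1 [_ /existsNP[x _]]] := above _ S0.
      by exists x.
    by apply; apply: AU; rewrite AT.
  - by move=> x y xy [s Ss sy]; exists s => //; apply: cut_down sy.
  - move=> x [s Ss /cut_nomax [y sy xy]]; exists y => //; by exists s.
exists (Cbar cA); split=> [s /SA|V SV]; first by move=> ?; apply/cut_leE.
by apply/cut_leE => x [s /SV/cut_leE]; apply.
Qed.

Lemma cbar_bottom : (~ exists m : L, forall x, x <= m) -> exists A : cbar L, cut A = set0.
Proof.
move=> nomax; have [[e emin]|nomin] := pselect (exists m : L, forall x, m <= x).
  by exists (pt e); apply/seteqP; split=> x //=; rewrite ltNge emin.
have c0 : completion_cut (set0 : set L).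
  right; split=> // -[x [xmin|xmax]]; [by apply: nomin; exists x|].
  by apply: nomax; exists x.
by exists (Cbar c0).
Qed.

(** Read from [p], the circle runs to the top, restarts at the bottom and climbs back to [p]. So
    members of [S] below [p], if any, decide the supremum; otherwise it is a supremum in the line
    or, when [S] is unbounded there, the bottom element. *)
Lemma crbar_complete : complete_circle cut_lt.
Proof.
move=> p s0 u S Ss0 up Su; have [irr tr tot] := cut_lt_st.
have sp s : S s -> s <> p by move=> /Su; linlia cut_lt_st [:: s; u; p].
have [[s2 Ss2 s2p]|Sp] := pselect (exists2 s, S s & cut_lt s p).
  pose S2 s := S s /\ cut_lt s p.
  have [|s [_]|M [MS Ml]] := @cut_lub S2 s2 p; [by split|by right|].
  have uS2 s : S2 s -> s = u \/ cut_lt s u.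
    by move=> [/Su + ?]; linlia cut_lt_st [:: s; u; p].
  have Mu := Ml u uS2.
  have uP : cut_lt u p by have := Su _ Ss2; linlia cut_lt_st [:: s2; u; p].
  exists M; split; first by linlia cut_lt_st [:: M; u; p].
    move=> s Ss; have [sp1|sp1] := pselect (cut_lt s p).
      by have := MS s (conj Ss sp1); linlia cut_lt_st [:: M; u; p; s].
    by have := sp _ Ss; linlia cut_lt_st [:: M; u; p; s].
  move=> v vp Sv.
  have : M = v \/ cut_lt M v.
    by apply: Ml => s [/Sv + ?]; linlia cut_lt_st [:: s; v; p].
  have := Sv _ Ss2; linlia cut_lt_st [:: M; v; p; s2; u].
have ps s : S s -> cut_lt p s.
  move=> Ss; case: (tot p s) => // [ps|sp1]; first by case: (sp _ Ss).
  by case: Sp; exists s.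
have [[U SU]|noU] := pselect (exists U, forall s, S s -> s = U \/ cut_lt s U).
  have [M [MS Ml]] := cut_lub Ss0 SU.
  have pM : cut_lt p M by have := MS _ Ss0; have := ps _ Ss0; linlia cut_lt_st [:: M; s0; p].
  exists M; split; first by linlia cut_lt_st [:: M; p].
    by move=> s Ss; have := MS s Ss; have := ps s Ss; linlia cut_lt_st [:: M; p; s].
  move=> v vp Sv; have [pv|pv] := pselect (cut_lt p v).
    have : M = v \/ cut_lt M v.
      apply: Ml => s Ss; have := Sv _ Ss; have := ps _ Ss.
      by linlia cut_lt_st [:: s; v; p].
    by linlia cut_lt_st [:: M; v; p].
  by linlia cut_lt_st [:: M; v; p].
have [bot botE] : exists A : cbar L, cut A = set0.
  apply: cbar_bottom => -[m mmax]; apply: noU; exists (pt m) => s Ss.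
  apply/cut_leE => x /cut_nomax [y _ xy] /=; exact: lt_le_trans xy (mmax y).
have bot_le A : bot = A \/ cut_lt bot A by apply/cut_leE; rewrite botE.
have bp : cut_lt bot p.
  case: (bot_le p) => // bp; case: noU; exists u => s /[dup] /Su + /ps.
  by have := bot_le u; rewrite bp; linlia cut_lt_st [:: s; u; p].
exists bot; split; first by linlia cut_lt_st [:: bot; p].
  by move=> s Ss; have := ps _ Ss; linlia cut_lt_st [:: bot; p; s].
move=> v vp Sv; have [pv|pv] := pselect (cut_lt p v); last first.
  by have := bot_le v; linlia cut_lt_st [:: bot; p; v].
case: noU; exists v => s Ss; have := Sv _ Ss; have := ps _ Ss.
by linlia cut_lt_st [:: s; v; p].
Qed.

End Completion.

(** * The opposite orientation, for the extension of reversing maps *)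

Section Reverse.
Variables (X : Type) (lt : X -> X -> Prop).
Hypothesis lt_st : strict_total lt.
Local Notation gt := (fun x y => lt y x).

Lemma circularize_rev x y z : circularize gt x y z <-> circularize lt z y x.
Proof. by rewrite !circularizeE; tauto. Qed.

Lemma strict_total_rev : strict_total gt.
Proof.
have [irr tr tot] := lt_st; split=> // [x y z xy yz|x y]; first exact: tr yz xy.
by case: (tot x y); [apply: Or33|apply: Or32|apply: Or31].
Qed.

Lemma complete_circle_rev : complete_circle lt -> complete_circle gt.
Proof.
move=> cplt p s0 u S Ss0 up Su.
have Su' s : S s -> u = s \/ circularize lt p u s.
  by move=> /Su [->|/circularize_rev]; [left|right; cyclia lt_st [:: p; s; u]].
have [|m [mp mS ml]] := complete_inf lt_st cplt Ss0 up Su'.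
  by have := Su' _ Ss0; cyclia lt_st [:: p; s0; u].
exists m; split=> // [s /mS [->|msp]|v vp Sv]; first by left.
  by right; apply/circularize_rev; cyclia lt_st [:: p; s; m].
have [|->|pvm] := ml v vp; last 1 first.
- by right; apply/circularize_rev; cyclia lt_st [:: p; v; m].
- move=> s /Sv [->|/circularize_rev svp]; first by left.
  by right; cyclia lt_st [:: p; s; v].
- by left.
Qed.

End Reverse.

(** * Extending cyclic embeddings from a dense set *)

Section Extension.
Variables (X Y : Type) (lt : X -> X -> Prop) (lt' : Y -> Y -> Prop).
Hypotheses (lt_st : strict_total lt) (lt_st' : strict_total lt').
Local Notation R := (circularize lt).
Local Notation R' := (circularize lt').
Variables (I : Type) (e : I -> X) (e' : I -> Y).
Hypothesis e_dense : forall a b, a <> b -> exists i, R a (e i) b.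
Hypothesis e_dense' : forall a b, a <> b -> exists i, R' a (e' i) b.
Hypothesis complete' : complete_circle lt'.
Hypothesis e_cyclic : forall i j k, R (e i) (e j) (e k) -> R' (e' i) (e' j) (e' k).
Hypotheses (e_inj : injective e) (e_inj' : injective e').
Hypothesis nontrivial : forall p : X, exists q, q <> p.

Lemma e_two_sided x a b : R a x b -> exists i j,
  [/\ R a (e i) x, R x (e j) b & R (e i) x (e j)].
Proof.
move=> axb.
have [i aix] := @e_dense a x (ltac:(cyclia lt_st [:: a; b; x])).
have [j xjb] := @e_dense x b (ltac:(cyclia lt_st [:: a; b; x])).
by exists i, j; split=> //; cyclia lt_st [:: a; b; x; e i; e j].
Qed.

Lemma extension_point x : exists y, forall i j, R (e i) x (e j) -> R' (e' i) y (e' j).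
Proof.
have [q qx] := nontrivial x.
have [o xoq] := e_dense (nesym qx).
have ox : e o <> x by cyclia lt_st [:: x; e o; q].
have e_neq i j : e i <> e j -> e' i <> e' j by move=> ij /e_inj' ji; apply: ij; rewrite ji.
pose S y := exists2 i, y = e' i & R (e o) (e i) x.
have [s0 os0x] := e_dense ox; have [u xuo] := e_dense (nesym ox).
have below i j : R (e o) (e i) x -> R x (e j) (e o) -> R' (e' o) (e' i) (e' j).
  by move=> oix xjo; apply: e_cyclic; cyclia lt_st [:: e o; e i; e j; x].
have Ss0 : S (e' s0) by exists s0.
have [||y [yo Sy yl]] := @complete' (e' o) (e' s0) (e' u) S Ss0.
- by apply: e_neq; cyclia lt_st [:: x; e o; e u].
- by move=> s [i -> oix]; right; apply: below.
exists y => i j ixj.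
(* The supremum [y] gives weak inequalities only. They become strict by comparing with [i1] and
   [j1], which are closer to [x] than [i], [j] and the origin [o]. *)
have [i1 [j1 [oi1x xj1o i1xj1]]] : exists i1 j1,
    [/\ R (e o) (e i1) x /\ R (e i) (e i1) x, R x (e j1) (e o) /\ R x (e j1) (e j)
      & R (e i1) x (e j1)].
  have nb := nbhdI lt_st (nbhd_arc ixj) (nbhd_arc (_ : R (e s0) x (e u))).
  have [|a [b [axb sub]]] := nb; first by cyclia lt_st [:: e o; e s0; e u; x].
  have [i1 [j1 [ai1x xj1b i1xj1]]] := e_two_sided axb.
  have := sub (e i1) (ltac:(cyclia lt_st [:: x; a; b; e i1])).
  have := sub (e j1) (ltac:(cyclia lt_st [:: x; a; b; e j1])).
  move=> [? ?] [? ?]; exists i1, j1.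
  have nio : ~ R a (e i) b by move=> /sub[]; cyclia lt_st [:: e i; e j].
  have nio' : ~ R a (e j) b by move=> /sub[]; cyclia lt_st [:: e i; e j].
  have nso : ~ R a (e s0) b by move=> /sub[]; cyclia lt_st [:: e s0; e u].
  have nuo : ~ R a (e u) b by move=> /sub[]; cyclia lt_st [:: e s0; e u].
  by split=> //; try split; cyclia lt_st [:: x; e o; e i; e j; a; b; e i1; e j1; e s0; e u].
have y1 : e' i1 = y \/ R' (e' o) (e' i1) y by apply: Sy; exists i1 => //; case: oi1x.
have y2 : y = e' j1 \/ R' (e' o) y (e' j1).
  apply: yl => [|s [k -> okx]].
    by apply: e_neq; case: xj1o; cyclia lt_st [:: x; e o; e j1].
  by right; apply: below => //; case: xj1o.
have [oi1 ii1] := oi1x; have [j1o j1j] := xj1o.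
have r1 : R' (e' i) (e' i1) (e' j1).
  by apply: e_cyclic; cyclia lt_st [:: x; e i; e i1; e j1; e j].
have r2 : R' (e' i1) (e' j1) (e' j).
  by apply: e_cyclic; cyclia lt_st [:: x; e i; e i1; e j1; e j].
have r4 : R' (e' o) (e' i1) (e' j1).
  by apply: e_cyclic; cyclia lt_st [:: x; e o; e i1; e j1].
have r3 : R' (e' i) (e' i1) (e' j).
  by apply: e_cyclic; cyclia lt_st [:: x; e i; e i1; e j1; e j].
by cyclia lt_st' [:: e' o; e' i1; e' j1; e' i; e' j; y].
Qed.

Lemma extension : exists f : X -> Y,
  (forall x y z, R x y z -> R' (f x) (f y) (f z)) /\ (forall i, f (e i) = e' i).
Proof.
have [f fP] := choice extension_point.
exists f; split=> [x y z xyz|i].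
  have [i xiy] := @e_dense x y (ltac:(cyclia lt_st [:: x; y; z])).
  have [j yjz] := @e_dense y z (ltac:(cyclia lt_st [:: x; y; z])).
  have [k zkx] := @e_dense z x (ltac:(cyclia lt_st [:: x; y; z])).
  have := fP x k i (ltac:(cyclia lt_st [:: x; y; z; e i; e j; e k])).
  have := fP y i j (ltac:(cyclia lt_st [:: x; y; z; e i; e j; e k])).
  have := fP z j k (ltac:(cyclia lt_st [:: x; y; z; e i; e j; e k])).
  have := @e_cyclic i j k (ltac:(cyclia lt_st [:: x; y; z; e i; e j; e k])).
  by cyclia lt_st' [:: f x; f y; f z; e' i; e' j; e' k].
apply: contrapT => fi; have [j fji] := e_dense' fi; have [k ikf] := e_dense' (nesym fi).
have e_neq a b : e' a <> e' b -> e a <> e b by move=> ab /e_inj ba; apply: ab; rewrite ba.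
have ji : e j <> e i by apply: e_neq; cyclia lt_st' [:: f (e i); e' i; e' j].
have ki : e k <> e i by apply: e_neq; cyclia lt_st' [:: f (e i); e' i; e' k].
have jk : e j <> e k by apply: e_neq; cyclia lt_st' [:: f (e i); e' i; e' j; e' k].
have [jik|kij] : R (e j) (e i) (e k) \/ R (e k) (e i) (e j).
  by cyclia lt_st [:: e i; e j; e k].
- by have := fP _ _ _ jik; cyclia lt_st' [:: f (e i); e' i; e' j; e' k].
- by have := e_cyclic kij; cyclia lt_st' [:: f (e i); e' i; e' j; e' k].
Qed.

End Extension.

Lemma cyclic_fix_dense (X : Type) (lt : X -> X -> Prop) (I : Type) (e : I -> X)
    (f : X -> X) : strict_total lt ->
  (forall a b, a <> b -> exists i, circularize lt a (e i) b) ->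
  (forall x y z, circularize lt x y z -> circularize lt (f x) (f y) (f z)) ->
  (forall i, f (e i) = e i) -> forall x, f x = x.
Proof.
move=> lt_st e_dense f_cyc fe x; apply: contrapT => fx.
have [i fxi] := e_dense _ _ fx; have [j xjf] := e_dense _ _ (nesym fx).
have := f_cyc (e i) x (e j); rewrite !fe => h.
have : circularize lt (e i) (f x) (e j) by apply: h; cyclia lt_st [:: x; f x; e i; e j].
by cyclia lt_st [:: x; f x; e i; e j].
Qed.

(** Extensions in both directions compose to maps that fix a dense set, hence to identities. Two
    orders on [X] are allowed so that [lt'] can be the reverse of [lt]. *)
Lemma extension_bijn (X : Type) (lt lt' : X -> X -> Prop) (I : Type) (e e' : I -> X) :
  strict_total lt -> strict_total lt' ->
  (forall a b, a <> b -> exists i, circularize lt a (e i) b) ->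
  (forall a b, a <> b -> exists i, circularize lt' a (e' i) b) ->
  complete_circle lt -> complete_circle lt' ->
  (forall i j k, circularize lt (e i) (e j) (e k) <->
                 circularize lt' (e' i) (e' j) (e' k)) ->
  injective e -> injective e' -> (forall p : X, exists q, q <> p) ->
  exists f : bijn X,
    (forall x y z, circularize lt x y z <-> circularize lt' (f x) (f y) (f z)) /\
    (forall i, f (e i) = e' i).
Proof.
move=> st st' dense dense' cplt cplt' ee' inj inj' nontriv.
have [f [fR fe]] := extension st st' dense dense' cplt'
  (fun i j k => (ee' i j k).1) inj inj' nontriv.
have [g [gR ge]] := extension st' st dense' dense cplt
  (fun i j k => (ee' i j k).2) inj' inj nontriv.
have fK : cancel f g.
  move=> x; apply: (cyclic_fix_dense (f := g \o f) st dense) => [a b c /fR/gR //|i /=].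
  by rewrite fe ge.
have gK : cancel g f.
  move=> x; apply: (cyclic_fix_dense (f := f \o g) st' dense') => [a b c /gR/fR //|i /=].
  by rewrite ge fe.
exists (Bijn fK gK); split=> // x y z; split; first exact: fR.
by move=> /gR /=; rewrite !fK.
Qed.

(** * Automorphisms and their pointwise limits *)

Section AutFacts.
Variables (T : Type) (R : T -> T -> T -> Prop).

Lemma aut_preserving (g : aut R) : preserving R g.
Proof. by case: g => f fR; apply/asboolP. Qed.

Lemma autrel_mono (g : autrel R) : preserving R g \/ reversing R g.
Proof. by case: g => f fR; apply/asboolP. Qed.

Lemma aut_inj (g h : aut R) : (forall x, g x = h x) -> g = h.
Proof. by move=> gh; apply: val_inj; apply: bijn_ext. Qed.

Lemma autrel_inj (g h : autrel R) : (forall x, g x = h x) -> g = h.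
Proof. by move=> gh; apply: val_inj; apply: bijn_ext. Qed.

Lemma autM (g h : aut R) x : (g * h) x = g (h x).
Proof. by []. Qed.

Lemma autrelM (g h : autrel R) x : (g * h) x = g (h x).
Proof. by []. Qed.

Lemma autK (g : aut R) x : g^-1 (g x) = x.
Proof. exact: bijn_funK. Qed.

Lemma autVK (g : aut R) x : g (g^-1 x) = x.
Proof. exact: bijn_invK. Qed.

Lemma autrelK (g : autrel R) x : g^-1 (g x) = x.
Proof. exact: bijn_funK. Qed.

Lemma autrelVK (g : autrel R) x : g (g^-1 x) = x.
Proof. exact: bijn_invK. Qed.

Lemma aut_make (f : bijn T) : preserving R f -> exists g : aut R, forall x, g x = f x.
Proof. by move=> fR; exists (Aut (introT (asboolP _) fR)). Qed.

Lemma autrel_make (f : bijn T) : preserving R f \/ reversing R f ->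
  exists g : autrel R, forall x, g x = f x.
Proof. by move=> fR; exists (Autrel (introT (asboolP _) fR)). Qed.

Fact aut_autrel_proof (g : aut R) : aut_bijn g \in preserving_or_reversingb R.
Proof. by apply/asboolP; left; apply: aut_preserving. Qed.

Definition aut_autrel (g : aut R) : autrel R := Autrel (aut_autrel_proof g).

Lemma aut_autrelM (g h : aut R) : aut_autrel (g * h) = aut_autrel g * aut_autrel h.
Proof. exact: autrel_inj. Qed.

(** Stability of the inverses makes the limit onto. The lemma bounds chains in Zorn's lemma and
    yields the limit map that takes one hole to another. *)
Lemma aut_limit (I : Type) (ord : I -> I -> Prop) (F : I -> aut R) :
  (forall i j k, ord i j -> ord j k -> ord i k) ->
  (forall i j, exists2 k, ord i k & ord j k) ->
  (forall x, exists i, forall j, ord i j -> F j x = F i x) ->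
  (forall x, exists i, forall j, ord i j -> (F j)^-1 x = (F i)^-1 x) ->
  exists f : aut R, forall x, exists i, forall j, ord i j -> f x = F j x.
Proof.
move=> tr dir stab stabV.
have [a aP] := choice stab; have [b bP] := choice stabV.
pose f x := F (a x) x; pose g x := (F (b x))^-1 x.
have fE x j : ord (a x) j -> f x = F j x by move=> /aP ->.
have gE x j : ord (b x) j -> g x = (F j)^-1 x by move=> /bP ->.
have fK : cancel f g.
  move=> x; have [k ak bk] := dir (a x) (b (f x)).
  by rewrite (gE _ k) // (fE _ k) // autK.
have gK : cancel g f.
  move=> x; have [k ak bk] := dir (a (g x)) (b x).
  by rewrite (fE _ k) // (gE _ k) // autVK.
have fR : preserving R (Bijn fK gK).
  move=> x y z /=; have [k xk yk] := dir (a x) (a y); have [l kl zl] := dir k (a z).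
  rewrite (fE x l) ?(fE y l) ?(fE z l) //; first exact: aut_preserving.
    exact: tr kl.
  exact: tr kl.
have [h hf] := aut_make fR; exists h => x; exists (a x) => j xj.
by rewrite hf /= (fE _ j).
Qed.

End AutFacts.

(** * Gluing automorphisms along arcs *)

Section Gluing.
Variables (X : Type) (lt : X -> X -> Prop).
Hypothesis lt_st : strict_total lt.
Local Notation R := (circularize lt).

Lemma based_cyclic (f : X -> X) p :
  (forall x y, R p x y -> R (f p) (f x) (f y)) ->
  forall x y z, R x y z -> R (f x) (f y) (f z).
Proof.
move=> fp x y z xyz.
have [e|xp] := pselect (x = p).
  by subst x; apply: fp.
have [e|yp] := pselect (y = p).
  by subst y; have := fp z x; cyclia lt_st [:: p; x; z; f p; f x; f z].
have [e|zp] := pselect (z = p).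
  by subst z; have := fp x y; cyclia lt_st [:: p; x; y; f p; f x; f y].
have := fp x y; have := fp y z; have := fp z x.
have [pxy|pxy] := pselect (R p x y); have [pyz|pyz] := pselect (R p y z).
- move=> _ /(_ pyz) ? /(_ pxy) ?; clear pxy pyz xyz xp yp zp.
  by cyclia lt_st [:: f p; f x; f y; f z].
- have pzx : R p z x by cyclia lt_st [:: p; x; y; z].
  move=> /(_ pzx) ? _ /(_ pxy) ?; clear pxy pyz xyz xp yp zp pzx.
  by cyclia lt_st [:: f p; f x; f y; f z].
- have pzx : R p z x by cyclia lt_st [:: p; x; y; z].
  move=> /(_ pzx) ? /(_ pyz) ? _; clear pxy pyz xyz xp yp zp pzx.
  by cyclia lt_st [:: f p; f x; f y; f z].
- by cyclia lt_st [:: p; x; y; z].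
Qed.

(** Meant for [h1] fixing [p], [h2] fixing [q] and both sending [u] to the same [v]; the pieces then
    fit together, and gluing the inverses at [v] gives the inverse. *)
Definition glue p u q (h1 h2 : X -> X) x :=
  if `[< R p x u >] then h1 x else if `[< x = u \/ R u x q >] then h2 x else x.

Lemma glueP p u v q (h1 h2 : bijn X) : preserving R h1 -> preserving R h2 ->
  R p u q -> R p v q -> h1 p = p -> h1 u = v -> h2 u = v -> h2 q = q ->
  forall x, [\/ [/\ R p x u, glue p u q h1 h2 x = h1 x & R p (h1 x) v],
    [/\ x = u \/ R u x q, glue p u q h1 h2 x = h2 x & h2 x = v \/ R v (h2 x) q]
  | (x = p \/ x = q \/ R q x p) /\ glue p u q h1 h2 x = x].
Proof.
move=> h1R h2R puq pvq h1p h1u h2u h2q x; rewrite /glue.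
case: asboolP => [pxu|pxu].
  by apply: Or31; split=> //; have := (h1R p x u).2 pxu; rewrite h1p h1u.
case: asboolP => [uxq|uxq].
  apply: Or32; split=> //; case: uxq => [->|uxq]; first by left.
  by right; have := (h2R u x q).2 uxq; rewrite h2u h2q.
by apply: Or33; split=> //; cyclia lt_st [:: p; u; q; x].
Qed.

Lemma glue_cyclic p u v q (h1 h2 : bijn X) : preserving R h1 -> preserving R h2 ->
  R p u q -> R p v q -> h1 p = p -> h1 u = v -> h2 u = v -> h2 q = q ->
  forall x y z, R x y z ->
    R (glue p u q h1 h2 x) (glue p u q h1 h2 y) (glue p u q h1 h2 z).
Proof.
move=> h1R h2R puq pvq h1p h1u h2u h2q.
have gP := glueP h1R h2R puq pvq h1p h1u h2u h2q.
have gp : glue p u q h1 h2 p = p.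
  case: (gP p) => [[]|[]|[_ ->]] //; first by cyclia lt_st [:: p; u].
  by cyclia lt_st [:: p; u; q].
apply: (@based_cyclic _ p) => x y; rewrite gp => pxy.
case: (gP x) (gP y) => [[xu -> hx]|[ux -> hx]|[qx ->]] [[yu -> hy]|[uy -> hy]|[qy ->]].
- by have := (h1R p x y).2 pxy; rewrite h1p.
- by cyclia lt_st [:: p; u; v; q; x; y; h1 x; h2 y].
- by cyclia lt_st [:: p; u; v; q; x; y; h1 x].
- by cyclia lt_st [:: p; u; v; q; x; y].
- have [e|xu] := pselect (x = u).
    have uy' : R u y q by subst x; cyclia lt_st [:: p; u; q; y].
    rewrite e h2u; have := (h2R u y q).2 uy'; rewrite h2u h2q.
    by cyclia lt_st [:: p; v; q; h2 y].
  have uxy : R u x y by cyclia lt_st [:: p; u; q; x; y].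
  have := (h2R u x y).2 uxy; rewrite h2u.
  clear uxy ux uy pxy xu puq; move: hx hy; move: (h2 x) (h2 y) => a b *.
  by cyclia lt_st [:: p; v; q; a; b].
- by cyclia lt_st [:: p; u; v; q; x; y; h2 x].
- by cyclia lt_st [:: p; u; v; q; x; y].
- by cyclia lt_st [:: p; u; v; q; x; y].
- by [].
Qed.

Lemma glue_cancel p u v q (h1 h2 : bijn X) : preserving R h1 -> preserving R h2 ->
  R p u q -> R p v q -> h1 p = p -> h1 u = v -> h2 u = v -> h2 q = q ->
  cancel (glue p u q h1 h2) (glue p v q (bijn_sym h1) (bijn_sym h2)).
Proof.
move=> h1R h2R puq pvq h1p h1u h2u h2q x.
case: (glueP h1R h2R puq pvq h1p h1u h2u h2q x) => [[pxu -> hx]|[uxq -> hx]|[qx ->]].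
- by rewrite /glue asboolT //= bijn_funK.
- rewrite /glue asboolF; first by rewrite asboolT //= bijn_funK.
  by clear uxq; cyclia lt_st [:: p; v; q; h2 x].
- by rewrite /glue !asboolF //; cyclia lt_st [:: p; v; q; x].
Qed.

(** Distinct points not in cyclic order are so in the reverse order, and then their images are
    too. *)
Lemma cyclic_bijn_preserving (f : bijn X) :
  (forall x y z, R x y z -> R (f x) (f y) (f z)) -> preserving R f.
Proof.
move=> fR x y z; split; last exact: fR.
move=> fxyz; apply: contrapT => xyz.
have f_neq a b : f a <> f b -> a <> b by move=> ab e; apply: ab; rewrite e.
have : [/\ x <> y, y <> z & z <> x].
  by split; apply: f_neq; cyclia lt_st [:: f x; f y; f z].
move=> [xy yz zx]; have := fR z y x (ltac:(cyclia lt_st [:: x; y; z])).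
by clear xy yz zx xyz; cyclia lt_st [:: f x; f y; f z].
Qed.

Lemma glue_exists p u v q (h1 h2 : aut R) : R p u q -> R p v q ->
  h1 p = p -> h1 u = v -> h2 u = v -> h2 q = q ->
  exists g : aut R, g u = v /\ forall x, ~ R p x q -> g x = x.
Proof.
move=> puq pvq h1p h1u h2u h2q.
have h1R := aut_preserving h1; have h2R := aut_preserving h2.
have gK := glue_cancel h1R h2R puq pvq h1p h1u h2u h2q.
have sR (h : aut R) : preserving R (bijn_sym h) by exact: (aut_preserving h^-1).
have sE (h : aut R) a b : h a = b -> bijn_sym h b = a by move=> <- /=; rewrite bijn_funK.
have gVK := glue_cancel (sR h1) (sR h2) pvq puq (sE _ _ _ h1p) (sE _ _ _ h1u)
  (sE _ _ _ h2u) (sE _ _ _ h2q).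
have bs (h : bijn X) : bijn_sym (bijn_sym h) = h by apply: bijn_ext.
rewrite !bs in gVK.
have [g gE] : exists g : aut R, forall x, g x = glue p u q h1 h2 x.
  apply: (@aut_make _ _ (Bijn gK gVK)); apply: cyclic_bijn_preserving.
  exact: (glue_cyclic h1R h2R puq pvq h1p h1u h2u h2q).
exists g; split=> [|x pxq]; rewrite gE /glue.
  by rewrite asboolF ?asboolT //; [left|cyclia lt_st [:: p; u]].
have [//|pxu] := asboolP (R p x u); first by cyclia lt_st [:: p; u; q; x].
case: asboolP => // -[xu|]; last by cyclia lt_st [:: p; u; q; x].
by subst x; case: pxq.
Qed.

End Gluing.

(** * Embedding outer automorphism groups and counting them *)

Section Outer.
Variables (G Q : groupType) (chi : gaut G -> Q).
Hypothesis chiM : {morph chi : s t / s * t}.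
Hypothesis chi_inner : forall s, chi s = 1 <-> inner s.
Local Open Scope quotient_scope.

Lemma chi1 : chi 1 = 1.
Proof. by apply/chi_inner; exact: inner1. Qed.

Lemma chiV s : chi s^-1 = (chi s)^-1.
Proof. by apply: (@mulgI _ (chi s)); rewrite -chiM !mulgV chi1. Qed.

Definition outer_map (u : outer G) : Q := chi (generic_quotient.repr u).

Lemma outer_mapE s : outer_map (\pi_(outer G) s) = chi s.
Proof.
apply: (@mulgI _ (chi s)^-1); rewrite mulVg -chiV -chiM.
by apply/chi_inner; exact: outer_repr.
Qed.

Lemma outer_mapM : {morph outer_map : u v / u * v}.
Proof.
move=> u v; rewrite -[u]reprK -[v]reprK.
move: (generic_quotient.repr u) (generic_quotient.repr v) => s t.
rewrite -[_ * _]/(outer_mul _ _) outer_mulE !outer_mapE; exact: chiM.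
Qed.

Lemma outer_map_inj : injective outer_map.
Proof.
move=> u v; rewrite -[u]reprK -[v]reprK.
move: (generic_quotient.repr u) (generic_quotient.repr v) => s t.
rewrite !outer_mapE => st; apply/eqP/outer_eqP/chi_inner.
by rewrite chiM chiV st mulVg.
Qed.

End Outer.

Lemma card_set_inj (T : Type) (U : finType) (f : T -> U) (S : {set U}) :
  injective f -> (forall x, x \in S <-> exists u, f u = x) -> [set: T] #= `I_#|S|.
Proof.
move=> f_inj SP.
have fS : f @` [set: T] #= [set: T] by apply: inj_card_eq => x y _ _; exact: f_inj.
rewrite card_eq_sym in fS; apply: card_eq_trans fS _.
have -> : f @` [set: T] = (@enum_val U S) @` [set: 'I_#|S|].
  apply/seteqP; split=> [x [u _ ux]|x [i _ <-]].
    have xS : x \in S by apply/SP; exists u.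
    by exists (enum_rank_in xS x) => //; rewrite enum_rankK_in.
  by have [u ue] := (SP _).1 (enum_valP i); exists u.
rewrite card_eq_sym; apply: card_eq_trans (card_II) _.
by rewrite card_eq_sym; apply: inj_card_eq => i j _ _; exact: enum_val_inj.
Qed.

(** By Lagrange's theorem the order divides 4. *)
Lemma klein4_subgroup (S : {set 'I_2 * 'I_2}) : (1 : klein4) \in S ->
  (forall x y : klein4, x \in S -> y \in S -> (x * y : klein4) \in S) ->
  [\/ #|S| = 1%N, #|S| = 2 | #|S| = 4].
Proof.
move=> S1 SM.
pose gT : finGroupType := ('I_2 * 'I_2)%type.
have gS : @group_set gT S.
  apply/group_setP; split=> // x y xS yS; exact: SM.
have := @cardSg gT [set: gT]%G (Group gS) (finset.subsetT _).
rewrite cardsT card_prod !card_ord /=.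
have : (#|S| <= 4)%N by rewrite (leq_trans (max_card _)) // card_prod !card_ord.
case: #|S| => [|[|[|[|[|]]]]] // _ _; [by apply: Or31|by apply: Or32|by apply: Or33].
Qed.

Lemma injective_klein4 (G : groupType) (f : G -> klein4) : injective f ->
  {morph f : x y / x * y} ->
  [\/ [set: G] #= `I_1, [set: G] #= `I_2 | [set: G] #= `I_4] /\
  ([set: G] #= `I_4 -> isomorphic G klein4).
Proof.
move=> f_inj fM.
pose S : {set 'I_2 * 'I_2} := [set x | `[< exists u, f u = x >]]%SET.
have SP x : x \in S <-> exists u, f u = x by rewrite inE; split=> [/asboolP|/asboolP].
have cardS := card_set_inj f_inj SP.
have S1 : (1 : klein4) \in S.
  by apply/SP; exists 1; apply: (@mulgI _ (f 1)); rewrite -fM !mulg1.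
have SM (x y : klein4) : x \in S -> y \in S -> (x * y : klein4) \in S.
  by move=> /SP[u <-] /SP[v <-]; apply/SP; exists (u * v); rewrite fM.
split.
  by case: (klein4_subgroup S1 SM) cardS => ->; [exact: Or31|exact: Or32|exact: Or33].
move=> card4; exists f => //.
have S4 : #|S| = 4.
  by apply/(@card_eq_II #|S| 4); apply: card_eq_trans card4; rewrite card_eq_sym.
have ST : S = [set: 'I_2 * 'I_2]%SET.
  by apply/eqP; rewrite eqEcard finset.subsetT /= cardsT card_prod !card_ord S4.
have ex x : exists u, f u = x by apply/SP; rewrite ST inE.
have [g gK] := choice ex.
by exists g => // x; apply: f_inj; rewrite gK.
Qed.

Lemma injective_card2 (T : Type) (f : T -> 'I_2) : injective f -> [set: T] #<= `I_2.
Proof.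
move=> f_inj; pose S : {set 'I_2} := [set x | `[< exists u, f u = x >]]%SET.
have SP x : x \in S <-> exists u, f u = x by rewrite inE; split=> [/asboolP|/asboolP].
have cardS := card_set_inj f_inj SP.
rewrite (card_le_eql cardS) card_le_II.
by rewrite (leq_trans (max_card _)) // card_ord.
Qed.

(** * Automorphisms of the circle acting on its completion *)

Section Circle.
Variables (d : Order.disp_t) (L : orderType d).
Hypothesis L_dense : densely_ordered L.
Hypothesis L_endpoint : at_most_one_endpoint L.
Hypothesis L_hom : two_o_homogeneous L.
Hypothesis cbar_nontrivial : exists A B : cbar L, A <> B.
Local Notation X := (cbar L).
Local Notation R := (circularize (@cut_lt d L)).
Local Notation st := (cut_lt_st L).
Local Ltac cyc l := cyclia (cut_lt_st L) l.
Local Notation K := (autrel (crbar L)).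

Lemma pt_cyclic x y z : R (pt x) (pt y) (pt z) <-> cr L x y z.
Proof. exact: crbar_pt. Qed.

Definition is_pt (x : X) := exists a, x = pt a.

Lemma is_pt_pt a : is_pt (pt a). Proof. by exists a. Qed.

Lemma dense_pt (a b : X) : a <> b -> exists i, R a (pt i) b.
Proof. exact: crbar_dense. Qed.

Lemma is_pt_dense : dense_in (@cut_lt d L) is_pt.
Proof. by move=> a b /dense_pt [i aib]; exists (pt i) => //; exists i. Qed.

Lemma cbar_other (p : X) : exists q, q <> p.
Proof.
have [A [B AB]] := cbar_nontrivial.
by have [Ap|] := pselect (A = p); [exists B; rewrite -Ap; exact: nesym|exists A].
Qed.

Lemma three_points : exists a b c : L, R (pt a) (pt b) (pt c).
Proof.
have [A [B AB]] := cbar_nontrivial; have [a Aa] := dense_pt AB.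
have [b ab] := @dense_pt (pt a) B (ltac:(cyc [:: A; B; pt a])).
have [c bc] := @dense_pt (pt b) B (ltac:(cyc [:: A; B; pt a; pt b])).
by exists a, b, c; cyc [:: A; B; pt a; pt b; pt c].
Qed.

Lemma K_mono (k : K) : preserving R k \/ reversing R k.
Proof. exact: autrel_mono. Qed.

Lemma K_fix_pt (k : K) : (forall a, k (pt a) = pt a) -> k = 1.
Proof.
move=> kpt; apply: autrel_inj => x.
have kR : preserving R k.
  have [//|kR] := K_mono k; have [a [b [c abc]]] := three_points.
  by have := (kR (pt c) (pt b) (pt a)).2 abc; rewrite !kpt; cyc [:: pt a; pt b; pt c].
apply: (cyclic_fix_dense st dense_pt) kpt _ => y z t; exact: (kR y z t).2.
Qed.

Lemma extends_uniq (g : bijn L) (k k' : K) : extends g k -> extends g k' -> k = k'.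
Proof.
move=> gk gk'; apply: (@mulgI _ k'^-1); rewrite mulVg; apply: K_fix_pt => a.
by rewrite autrelM gk -gk' autrelK.
Qed.

Lemma not_preserving_reversing (k : K) : preserving R k -> reversing R k -> False.
Proof.
move=> kp kr; have [a [b [c abc]]] := three_points.
have cab : R (pt c) (pt a) (pt b) by cyc [:: pt a; pt b; pt c].
have := (kp _ _ _).2 abc; have := (kr _ _ _).2 cab.
have := (kp _ _ _).1; move: (kr (pt b) (pt a) (pt c)) (kp (pt a) (pt b) (pt c)).
by cyc [:: pt a; pt b; pt c; k (pt a); k (pt b); k (pt c)].
Qed.

(** A reversing [g] is a cyclic isomorphism onto the opposite order, so both orientations come from
    [extension_bijn]. *)
Lemma extension_exists (g : autrel (cr L)) : exists k : K,
  extends g k /\ (preserving (cr L) g -> preserving R k).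
Proof.
have gpt_inj : injective (fun a => pt (g a)).
  by move=> a b /(@pt_inj d L) /(can_inj (bijn_funK g)).
have pt_inj := @pt_inj d L.
have gdense (lt : X -> X -> Prop) :
    (forall a b, a <> b -> exists i, circularize lt a (pt i) b) ->
    forall a b, a <> b -> exists i, circularize lt a (pt (g i)) b.
  by move=> dense a b /dense [i aib]; exists (g^-1 i); rewrite autrelVK.
have cplt := crbar_complete L_dense.
have [gR|gR] := autrel_mono g.
  have [|f [fR fe]] := extension_bijn st st dense_pt (gdense _ dense_pt) cplt cplt
     _ pt_inj gpt_inj cbar_other.
    by move=> i j k; rewrite !pt_cyclic gR.
  have fp : preserving R f by move=> x y z; rewrite -fR.
  by have [k kf] := autrel_make (or_introl fp); exists k; split=> [a|_ x y z]; rewrite ?kf.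
have rst := strict_total_rev st.
have rdense : forall a b : X, a <> b ->
    exists i : L, circularize (fun x y => cut_lt y x) a (pt i) b.
  by move=> a b /nesym/dense_pt [i bia]; exists i; apply/circularize_rev.
have rcplt := complete_circle_rev st cplt.
have [|f [fR fe]] := extension_bijn st rst dense_pt (gdense _ rdense) cplt rcplt
     _ pt_inj gpt_inj cbar_other.
  by move=> i j k; rewrite (circularize_rev (@cut_lt d L)) !pt_cyclic gR.
have fr : reversing R f.
  by move=> x y z; rewrite -(circularize_rev (@cut_lt d L)) -fR.
have [k kf] := autrel_make (or_intror fr); exists k; split=> [a|gp]; rewrite ?kf //.
have [a [b [c abc]]] := three_points; move: (abc); rewrite pt_cyclic -gp gR -pt_cyclic.
by cyc [:: pt a; pt b; pt c].
Qed.

Definition Ext (g : autrel (cr L)) : K := sval (cid (extension_exists g)).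

Lemma Ext_pt g a : Ext g (pt a) = pt (g a).
Proof. by rewrite /Ext; case: cid => k [gk _] /=. Qed.

Lemma Ext_uniq (g : autrel (cr L)) (k : K) : extends g k -> k = Ext g.
Proof. by move=> gk; apply: extends_uniq gk _ => a; rewrite Ext_pt. Qed.

Lemma Ext_preserving (g : autrel (cr L)) : preserving (cr L) g -> preserving R (Ext g).
Proof. by rewrite /Ext; case: cid => k [_] /=. Qed.

Lemma ExtM g h : Ext (g * h) = Ext g * Ext h.
Proof. by apply/esym/Ext_uniq => a; rewrite autrelM !Ext_pt. Qed.

Lemma Ext1 : Ext 1 = 1.
Proof. by apply/esym/Ext_uniq. Qed.

Lemma ExtV g : Ext g^-1 = (Ext g)^-1.
Proof. by apply: (@mulgI _ (Ext g)); rewrite -ExtM !mulgV Ext1. Qed.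

Lemma Ext_inj : injective Ext.
Proof.
move=> g h gh; apply: autrel_inj => a; apply: (@pt_inj d L).
by rewrite -!Ext_pt gh.
Qed.

Definition pt_stable (k : K) := forall x, is_pt (k x) <-> is_pt x.

Lemma Ext_stable g : pt_stable (Ext g).
Proof.
move=> x; split=> [[a e]|[a ->]]; last by exists (g a); rewrite Ext_pt.
by exists (g^-1 a); rewrite -(autrelK (Ext g) x) e -ExtV Ext_pt.
Qed.

Lemma pt_stableP (k : K) : pt_stable k <-> exists g, k = Ext g.
Proof.
split=> [kP|[g ->]]; last exact: Ext_stable.
have ex a : exists b, k (pt a) = pt b.
  by have [b ->] := (kP (pt a)).2 (is_pt_pt a); exists b.
have exV a : exists b, k^-1 (pt a) = pt b.
  by have [|b ->] := (kP (k^-1 (pt a))).1; [rewrite autrelVK; exists a|exists b].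
have [f fP] := choice ex; have [f' f'P] := choice exV.
have pt_inj := @pt_inj d L.
have fK : cancel f f' by move=> a; apply: pt_inj; rewrite -f'P -fP autrelK.
have f'K : cancel f' f by move=> a; apply: pt_inj; rewrite -fP -f'P autrelVK.
have [|g gf] := @autrel_make _ (cr L) (Bijn fK f'K).
  have [kR|kR] := K_mono k; [left|right] => x y z /=.
    by rewrite -!pt_cyclic -!fP; apply: kR.
  by rewrite -!pt_cyclic -!fP; apply: kR.
by exists g; apply: Ext_uniq => a; rewrite fP gf.
Qed.

Lemma Ext_preservingE (g : autrel (cr L)) : preserving R (Ext g) <-> preserving (cr L) g.
Proof.
split=> [gR x y z|]; last exact: Ext_preserving.
by rewrite -!pt_cyclic -!Ext_pt; apply: gR.
Qed.

(** Between a moved point and its image lies a point of [C], which is fixed; monotonicity forbids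
    that the image passes it. *)
Lemma fix_outside (k : K) a b : preserving R k -> a <> b -> k a = a -> k b = b ->
  (forall i, R b (pt i) a -> k (pt i) = pt i) -> forall x, R b x a -> k x = x.
Proof.
move=> kR ab ka kb kpt x bxa; apply: contrapT => kx.
have := (kR b x a).2 bxa; rewrite ka kb => bkxa.
have [bxk|bxk] := pselect (R b x (k x)).
  have [i xik] := dense_pt (nesym kx).
  have ki : k (pt i) = pt i by apply: kpt; cyc [:: b; a; x; k x; pt i].
  have := kR x (pt i) a; rewrite ki ka => -[_ h].
  have {}h := h (ltac:(cyc [:: b; a; x; k x; pt i])).
  by cyc [:: b; a; x; k x; pt i].
have [i kix] := dense_pt kx.
have ki : k (pt i) = pt i by apply: kpt; cyc [:: b; a; x; k x; pt i].
have := kR b (pt i) x; rewrite ki kb => -[_ h].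
have {}h := h (ltac:(cyc [:: b; a; x; k x; pt i])).
by cyc [:: b; a; x; k x; pt i].
Qed.

Lemma L_st : strict_total (fun x y : L => (x < y)%O).
Proof.
split=> [x|x y z|x y]; first by rewrite ltxx.
  exact: lt_trans.
by case: (ltgtP x y) => ?; [apply: Or31|apply: Or33|apply: Or32].
Qed.

(** Homogeneity gives [h1] fixing [p] and [h2] fixing [q], both sending [u] to [v], and these are
    glued. The points [p] and [q] of [C] are inserted because [a] and [b] may be holes. *)
Lemma aut_move a b (u v : L) : R a (pt u) b -> R a (pt v) b ->
  exists g : aut (cr L),
    (forall x, ~ R a x b -> Ext (aut_autrel g) x = x) /\ g u = v.
Proof.
wlog auv : u v / u = v \/ R a (pt u) (pt v).
  move=> wl aub avb; have [?|uv] := pselect (u = v); first by apply: wl => //; left.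
  have [?|auv] := pselect (R a (pt u) (pt v)); first by apply: wl => //; right.
  have puv : pt u <> pt v by move=> /(@pt_inj d L).
  have [|g [g_id gv]] := wl v u _ avb aub.
    by right; cyc [:: a; b; pt u; pt v].
  exists g^-1; split; last by rewrite -gv autK.
  move=> x /g_id gx.
  have -> : aut_autrel g^-1 = (aut_autrel g)^-1 by apply: autrel_inj.
  by rewrite ExtV -{1}gx autrelK.
case: auv => [<- _ _|auv aub avb].
  exists 1; split=> // x _.
  by rewrite (_ : aut_autrel 1 = 1) ?Ext1 //; apply: autrel_inj.
have [p apu] := @dense_pt a (pt u) (ltac:(cyc [:: a; b; pt u])).
have [q vqb] := @dense_pt (pt v) b (ltac:(cyc [:: a; b; pt v])).
have neq (x y : L) : pt x <> pt y -> x != y by move=> xy; apply/eqP => e; apply: xy; rewrite e.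
have [h1 [h1p h1u]] := @L_hom p u p v
  (neq p u (ltac:(cyc [:: a; pt p; pt u])))
  (neq p v (ltac:(cyc [:: a; pt p; pt u; pt v]))).
have [h2 [h2u h2q]] := @L_hom u q v q
  (neq u q (ltac:(cyc [:: a; b; pt u; pt v; pt q])))
  (neq v q (ltac:(cyc [:: a; b; pt v; pt q]))).
have [||g [gu g_id]] := glue_exists L_st (p := p) (q := q) _ _ h1p h1u h2u h2q.
- by apply/pt_cyclic; cyc [:: a; b; pt p; pt u; pt v; pt q].
- by apply/pt_cyclic; cyc [:: a; b; pt p; pt u; pt v; pt q].
exists g; split=> // x axb.
set k := Ext _.
have kid i : ~ R (pt p) (pt i) (pt q) -> k (pt i) = pt i.
  by rewrite pt_cyclic => pix; rewrite /k Ext_pt /= g_id.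
have [pq|->|xq] : [\/ x = pt p, x = pt q | R (pt q) x (pt p)].
- have : x = pt p \/ x = pt q \/ R (pt q) x (pt p).
    by cyc [:: a; b; pt p; pt u; pt v; pt q; x].
  by move=> [?|[?|?]]; [apply: Or31|apply: Or32|apply: Or33].
- by rewrite pq kid //; cyc [:: pt p; pt q].
- by rewrite kid //; cyc [:: pt p; pt q].
apply: (fix_outside (a := pt p) (b := pt q)) => // [||||i qip].
- exact/Ext_preserving/aut_preserving.
- by cyc [:: pt p; pt q; x].
- by rewrite kid //; cyc [:: pt p; pt q].
- by rewrite kid //; cyc [:: pt p; pt q].
- by rewrite kid //; cyc [:: pt p; pt q; pt i].
Qed.

(** * A common action for Aut(C) and Aut(C^rel) *)

Section Action.
Variables (H : groupType) (toR : H -> autrel (cr L)).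
Hypothesis toRM : {morph toR : x y / x * y}.
Hypothesis toR_inj : injective toR.
Hypothesis toR_aut : forall g : aut (cr L), exists h, toR h = aut_autrel g.

Definition act (h : H) (x : X) : X := Ext (toR h) x.

Lemma toR1 : toR 1 = 1.
Proof. by apply: (@mulgI _ (toR 1)); rewrite -toRM !mulg1. Qed.

Lemma act1 x : act 1 x = x.
Proof. by rewrite /act toR1 Ext1. Qed.

Lemma actM g h x : act (g * h) x = act g (act h x).
Proof. by rewrite /act toRM ExtM. Qed.

Lemma act_faithful g : (forall x, act g x = x) -> g = 1.
Proof.
move=> g1; apply: toR_inj; rewrite toR1; apply: Ext_inj; rewrite Ext1.
exact: autrel_inj.
Qed.

Lemma act_mono g : preserving R (act g) \/ reversing R (act g).
Proof. exact: K_mono. Qed.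

Lemma act_move a b u v : is_pt u -> is_pt v -> R a u b -> R a v b ->
  exists2 g, forall x, ~ R a x b -> act g x = x & act g u = v.
Proof.
move=> [u' ->] [v' ->] aub avb; have [g [g_id gu]] := aut_move aub avb.
have [h hg] := toR_aut g; exists h; rewrite /act hg //.
by rewrite Ext_pt /= gu.
Qed.

End Action.

Lemma aut_autrel_inj : injective (@aut_autrel L (cr L)).
Proof. by move=> g h gh; apply: aut_inj => x; have := congr1 (fun k : autrel _ => k x) gh. Qed.

Definition aut_act : aut (cr L) -> X -> X := act (@aut_autrel L (cr L)).

Lemma aut_act_pt g a : aut_act g (pt a) = pt (g a).
Proof. by rewrite /aut_act /act Ext_pt. Qed.

Lemma aut_act1 x : aut_act 1 x = x.
Proof. exact: (act1 (@aut_autrelM L (cr L))). Qed.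

Lemma aut_actM g h x : aut_act (g * h) x = aut_act g (aut_act h x).
Proof. exact: (actM (@aut_autrelM L (cr L))). Qed.

Lemma aut_act_mono g : preserving R (aut_act g) \/ reversing R (aut_act g).
Proof. exact: act_mono. Qed.

Lemma aut_act_move a b u v : is_pt u -> is_pt v -> R a u b -> R a v b ->
  exists2 g, forall x, ~ R a x b -> aut_act g x = x & aut_act g u = v.
Proof. by apply: act_move => g; exists g. Qed.

Lemma fix_dense_arc (g : aut (cr L)) a b :
  (forall i, R a (pt i) b -> g i = i) -> forall x, R a x b -> aut_act g x = x.
Proof.
move=> gab x axb.
apply: (fix_closed st is_pt_dense aut_act1 aut_actM aut_act_mono) => V xV.
have [y [i ->] [Vi aib]] := nbhd_dense st is_pt_dense (nbhdI st xV (nbhd_arc axb)).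
by exists (pt i) => //; rewrite aut_act_pt gab.
Qed.

(* A maximal element, for "extends the nontrivial part of", among the automorphisms
   supported in the arc from [a] to [b] moves a point of every subarc. *)
Lemma aut_bump a b : a <> b -> exists f, is_arc (@cut_lt d L) aut_act f a b.
Proof.
move=> ab.
pose T := {g : aut (cr L) | forall i, ~ R a (pt i) b -> g i = i}.
pose le (g h : T) := forall i, sval g i <> i -> sval h i = sval g i.
have le_refl g : le g g by [].
have le_trans g h k : le g h -> le h k -> le g k.
  by move=> gh hk i gi; rewrite hk gh.
have le_anti g h : le g h -> le h g -> g = h.
  move=> gh hg; apply: eq_sig_hprop => [k p q|]; first exact: Prop_irrelevance.
  apply: aut_inj => i.
  have [gi|gi] := pselect (sval g i = i); last by rewrite gh.
  have [hi|hi] := pselect (sval h i = i); first by rewrite gi hi.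
  by rewrite hg.
have le_inv (g h : T) i : le g h -> (sval g)^-1 i <> i -> (sval h)^-1 i = (sval g)^-1 i.
  move=> gh gi; have gj : sval g ((sval g)^-1 i) <> (sval g)^-1 i.
    by rewrite autVK; exact: nesym.
  by rewrite -{1}(autVK (sval g) i) -(gh _ gj) autK.
have id_ab i : ~ R a (pt i) b -> (1 : aut (cr L)) i = i by [].
have [||||g gmaxb] := @Zorn T (fun g h => `[< le g h >]).
- by move=> g; apply/asboolP; exact: le_refl.
- by move=> g h k /asboolP gh /asboolP hk; apply/asboolP; exact: le_trans gh hk.
- by move=> g h /asboolP gh /asboolP hg; exact: le_anti.
- move=> A totb.
  have totA g h : A g -> A h -> le g h \/ le h g.
    by move=> Ag Ah; case: (totb _ _ Ag Ah) => /asboolP; [left|right].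
  suff [f fA] : exists f, forall g, A g -> le g f.
    by exists f => g /fA gf; apply/asboolP.
  have [[g0 Ag0]|A0] := pselect (exists g, A g); last first.
    by exists (exist _ 1 id_ab) => s As; case: A0; exists s.
  pose I := {g : T | A g}.
  have [|||i|] := @aut_limit _ (cr L) I (fun g h => le (sval g) (sval h)) (fun g => sval (sval g)).
  - by move=> g h k; apply: le_trans.
  - move=> [g Ag] [h Ah] /=; case: (totA _ _ Ag Ah) => gh.
      by exists (exist _ h Ah).
    by exists (exist _ g Ag).
  - move=> i; have [[g [Ag gi]]|ni] := pselect (exists g, A g /\ sval g i <> i).
      by exists (exist _ g Ag) => -[h Ah] /= /(_ i gi).
    exists (exist _ g0 Ag0) => -[h Ah] /= _.
    have fixi g : A g -> sval g i = i.
      by move=> Ag; apply: contrapT => gi; apply: ni; exists g.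
    by rewrite !fixi.
  - have [[g [Ag gi]]|ni] := pselect (exists g, A g /\ (sval g)^-1 i <> i).
      by exists (exist _ g Ag) => -[h Ah] /= gh; apply: le_inv.
    exists (exist _ g0 Ag0) => -[h Ah] /= _.
    have fixi g : A g -> (sval g)^-1 i = i.
      by move=> Ag; apply: contrapT => gi; apply: ni; exists g.
    exact: (etrans (fixi h Ah) (esym (fixi g0 Ag0))).
  move=> f fP.
  have f_id i : ~ R a (pt i) b -> f i = i.
    move=> aib; have [g gf] := fP i.
    by rewrite (gf g (le_refl _)); apply: (proj2_sig (sval g)).
  exists (exist _ f f_id) => s As i si /=; have [[g Ag] /= gf] := fP i.
  case: (totA _ _ As Ag) => sg; first by rewrite (gf (exist _ g Ag)) //= sg.
  by rewrite (gf (exist _ s As)).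
have gmax h : le g h -> h = g by move=> gh; apply: gmaxb; apply/asboolP.
exists (sval g); split=> // x.
have fix_out : forall y, R b y a -> aut_act (sval g) y = y.
  apply: fix_dense_arc => i bia; apply: (svalP g).
  by cyc [:: a; b; pt i].
split; last by move=> bxa; exists b, a.
move=> [s [t [sxt st_fix]]]; apply: contrapT => bxa.
(* As [x] may be an end of the arc from [a] to [b], a smaller arc is taken on its inner side, where
   the maximal [g] is still the identity. *)
have [s' [t' [st' sub]]] : exists s' t', s' <> t' /\
    forall y, R s' y t' -> R s y t /\ R a y b.
  have [xa|xa] := pselect (x = a).
    subst x; have [s' [t' [sat sb sub]]] := nbhd_small st is_pt_dense ab (nbhd_arc sxt).
    exists a, t'; split; first by cyc [:: a; s'; t'].
    move=> y ayt; split; last by cyc [:: a; b; s'; t'; y].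
    by apply: sub; cyc [:: a; b; s'; t'; y].
  have [xb|xb] := pselect (x = b).
    subst x; have [s' [t' [sat sb sub]]] := nbhd_small st is_pt_dense (nesym ab) (nbhd_arc sxt).
    exists s', b; split; first by cyc [:: b; s'; t'].
    move=> y ayt; split; last by cyc [:: a; b; s'; t'; y].
    by apply: sub; cyc [:: a; b; s'; t'; y].
  have axb : R a x b by cyc [:: a; b; x].
  have [s' [t' [sxt' sub]]] := nbhdI st (nbhd_arc sxt) (nbhd_arc axb).
  by exists s', t'; split=> //; cyc [:: s'; t'; x].
have [y s'yt'] := dense_pt st'.
have [v [z [v_supp vz]]] := local_nontrivial st is_pt_dense aut_act1 aut_actM
  aut_act_mono aut_act_move (nbhd_arc s'yt').
have v_id i : ~ R s' (pt i) t' -> v i = i.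
  by move=> /(supp_inN v_supp); rewrite aut_act_pt => /(@pt_inj d L).
have gv_id i : ~ R a (pt i) b -> (sval g * v) i = i.
  move=> aib; rewrite autM v_id ?(svalP g) //.
  by move=> /sub[].
(* Since [v] acts only where [g] is the identity, [g * v] extends [g], and maximality makes [v]
   trivial. *)
have : exist _ (sval g * v) gv_id = g.
  apply: gmax => i gi /=; rewrite v_id //.
  move=> /sub[/st_fix]; rewrite aut_act_pt => /(@pt_inj d L) gi' _; exact: gi.
move=> /(congr1 sval) /= gv; apply: vz.
have -> : v = 1 by apply: (@mulgI _ (sval g)); rewrite gv mulg1.
exact: aut_act1.
Qed.

(** * Group automorphisms as conjugations in the completion *)

Section Conjugation.
Variables (H : groupType) (toR : H -> autrel (cr L)).
Hypothesis toRM : {morph toR : x y / x * y}.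
Hypothesis toR_inj : injective toR.
Hypothesis toR_aut : forall g : aut (cr L), exists h, toR h = aut_autrel g.
Local Notation val := (fun h => autrel_bijn (toR h)).

Lemma toRV g : toR g^-1 = (toR g)^-1.
Proof. by apply: (@mulgI _ (toR g)); rewrite -toRM !mulgV toR1. Qed.

Lemma act_bump a b : a <> b -> exists h, is_arc (@cut_lt d L) (act toR) h a b.
Proof.
move=> /aut_bump [f fab]; have [h hf] := toR_aut f; exists h; move: fab.
by rewrite /is_arc /int_fix /aut_act /act hf.
Qed.

Lemma conjugation_byE (s : gaut H) (c : K) : conjugation_by val s c <->
  (forall h, Ext (toR (s h)) = c * Ext (toR h) * c^-1).
Proof.
split=> [sc h|sc h].
  by have [k /Ext_uniq -> /Ext_uniq ->] := sc h.
exists (Ext (toR h)); first by move=> a; rewrite Ext_pt.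
by rewrite -sc => a; rewrite Ext_pt.
Qed.

Lemma centralizer1 (c : K) : (forall h, commute c (Ext (toR h))) -> c = 1.
Proof.
move=> ch; apply: autrel_inj.
apply: (centralizer_trivial st is_pt_dense (act_mono toR) (act_move toR_aut) cbar_other).
  exact: can_inj (bijn_funK c).
by move=> h x; rewrite /act -autrelM ch.
Qed.

(** Existence is the reconstruction; two conjugators differ by an element centralizing the group,
    which is trivial by local movement. *)
Lemma uniquely_conjugatingP : uniquely_conjugating val.
Proof.
move=> s.
have [c cR cs] := reconstruction st is_pt_dense (act1 toRM) (actM toRM)
  (act_faithful toRM toR_inj) (act_mono toR) (act_move toR_aut)
  (crbar_complete L_dense) act_bump cbar_other s.
have [k kc] := autrel_make cR.
exists k; split.
  apply/conjugation_byE => h; apply: (@mulIg _ k); rewrite -mulgA mulVg mulg1.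
  by apply: autrel_inj => x; rewrite !autrelM !kc; apply: cs.
move=> k' /conjugation_byE k'h.
have kh h : Ext (toR (s h)) = k * Ext (toR h) * k^-1.
  apply: (@mulIg _ k); rewrite -mulgA mulVg mulg1.
  by apply: autrel_inj => x; rewrite !autrelM !kc; apply: cs.
apply: (@mulgI _ k^-1); rewrite mulVg; apply/esym/centralizer1 => h.
apply: (@mulgI _ k); rewrite /commute !mulgA mulgV mul1g.
apply: (@mulIg _ k'^-1); rewrite -(mulgA _ k') mulgV mulg1.
by rewrite -k'h kh.
Qed.

Definition in_image (k : K) := exists h, Ext (toR h) = k.

(** Both inclusions are required, so that conjugation by [c] is onto the group. *)
Definition normalizes (c : K) := forall h,
  in_image (c * Ext (toR h) * c^-1) /\ in_image (c^-1 * Ext (toR h) * c).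

Lemma conjugation_setP (c : K) : conjugation_set val c <-> normalizes c.
Proof.
split=> [[s /conjugation_byE sc] h|nc].
  split; first by exists (s h).
  exists (s^-1 h).
  by rewrite -{2}(gautVK s h) sc !mulgA mulVg mul1g -mulgA mulVg mulg1.
have [f fE] := choice (fun h => (nc h).1); have [f' f'E] := choice (fun h => (nc h).2).
have toE_inj g h : Ext (toR g) = Ext (toR h) -> g = h by move=> /Ext_inj/toR_inj.
have fK : cancel f f'.
  move=> h; apply: toE_inj; rewrite f'E fE !mulgA mulVg mul1g -mulgA mulVg.
  by rewrite mulg1.
have f'K : cancel f' f.
  move=> h; apply: toE_inj; rewrite fE f'E !mulgA mulgV mul1g -mulgA mulgV.
  by rewrite mulg1.
have fM : Bijn fK f'K \in @morphicb H.
  apply/asboolP => g h /=; apply: toE_inj; rewrite fE !toRM !ExtM !fE !mulgA.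
  by rewrite -(mulgA (c * Ext (toR g)) c^-1 c) mulVg mulg1.
by exists (Gaut fM); apply/conjugation_byE => h; rewrite -fE.
Qed.

Lemma conjugation_exists (s : gaut H) : exists c, conjugation_by val s c.
Proof. by have [c [sc _]] := uniquely_conjugatingP s; exists c. Qed.

Definition conj_of (s : gaut H) : K := sval (cid (conjugation_exists s)).

Lemma conj_ofP (s : gaut H) : conjugation_by val s (conj_of s).
Proof. by rewrite /conj_of; case: cid. Qed.

Lemma conj_ofE (s : gaut H) h : Ext (toR (s h)) = conj_of s * Ext (toR h) * (conj_of s)^-1.
Proof. exact: (conjugation_byE s (conj_of s)).1 (conj_ofP s) h. Qed.

Lemma conj_of_uniq (s : gaut H) c : (forall h, Ext (toR (s h)) = c * Ext (toR h) * c^-1) ->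
  conj_of s = c.
Proof.
move=> /conjugation_byE sc; have [c0 [_ uniq]] := uniquely_conjugatingP s.
by rewrite -(uniq _ (conj_ofP s)) (uniq _ sc).
Qed.

Lemma conj_ofM (s t : gaut H) : conj_of (s * t) = conj_of s * conj_of t.
Proof.
by apply: conj_of_uniq => h; rewrite gautM conj_ofE (conj_ofE t) invgM !mulgA.
Qed.

Lemma conj_of_inner (s : gaut H) : in_image (conj_of s) <-> inner s.
Proof.
split=> [[g gs]|[g gs]]; exists g.
  by move=> h; apply/toR_inj/Ext_inj; rewrite conj_ofE -gs !toRM !ExtM toRV ExtV.
by apply/esym/conj_of_uniq => h; rewrite gs !toRM !ExtM toRV ExtV.
Qed.

End Conjugation.

Lemma in_image_aut (k : K) :
  in_image (@aut_autrel L (cr L)) k <-> preserving R k /\ pt_stable k.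
Proof.
split=> [[g <-]|[kR /pt_stableP [g kg]]].
  by split; [apply/Ext_preserving/aut_preserving|exact: Ext_stable].
subst k; have gR := (Ext_preservingE g).1 kR.
have [h hg] := aut_make gR; exists h; congr Ext; exact: autrel_inj.
Qed.

Lemma in_image_autrel (k : K) : in_image (@id (autrel (cr L))) k <-> pt_stable k.
Proof.
by rewrite pt_stableP; split=> [[g <-]|[g ->]]; exists g.
Qed.


(** * Points of countable character *)

(** A form of countable character without base point or preferred side, which makes its invariance
    under [K], reversing maps included, immediate. *)
Definition first_countable (c : X) := exists V : nat -> X * X,
  (forall n, R (V n).1 c (V n).2) /\
  (forall y, (forall n, R (V n).1 y (V n).2) -> y = c).

Lemma first_countable_act (k : K) c : first_countable c -> first_countable (k c).
Proof.
move=> [V [Vc Vy]].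
have kV : forall y, k (k^-1 y) = y by move=> y; exact: autrelVK.
have [kR|kR] := K_mono k.
  exists (fun n => (k (V n).1, k (V n).2)); split=> [n|y yV] /=.
    exact: ((kR _ _ _).2 (Vc n)).
  by rewrite -(kV y); congr (k _); apply: Vy => n; apply: (kR _ _ _).1; rewrite kV; exact: yV.
exists (fun n => (k (V n).2, k (V n).1)); split=> [n|y yV] /=.
    exact: ((kR _ _ _).2 (Vc n)).
by rewrite -(kV y); congr (k _); apply: Vy => n; apply: (kR _ _ _).1; rewrite kV; exact: yV.
Qed.

Lemma first_countable_actE (k : K) c : first_countable (k c) <-> first_countable c.
Proof.
split; last exact: first_countable_act.
by move=> /(first_countable_act k^-1); rewrite autrelK.
Qed.

Lemma countable_enum (D : set L) x0 : countable D -> D x0 ->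
  exists e : nat -> L, (forall n, D (e n)) /\ forall y, D y -> exists n, e n = y.
Proof.
move=> /countable_injP [f f_inj] Dx0.
have ex n : exists y, D y /\ forall z, D z -> f z = n -> y = z.
  have [[y [Dy fy]]|ny] := pselect (exists y, D y /\ f y = n).
    by exists y; split=> // z Dz fz; apply: f_inj; rewrite ?inE // fy.
  by exists x0; split=> // z Dz fz; case: ny; exists z.
have [e eP] := choice ex; exists e; split=> [n|y Dy]; first by case: (eP n).
by exists (f y); apply: (eP _).2.
Qed.

Lemma countable_character_first_countable (c : X) :
  countable_character c -> first_countable c.
Proof.
move=> [b [bc [D1 [D1S D1c D1cof]] [D2 [D2S D2c D2cof]]]].
have [i bic] := dense_pt bc; have [j cjb] := dense_pt (nesym bc).
have [e1 [e1D e1s]] : exists e : nat -> L,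
    (forall n, D1 (e n)) /\ forall y, D1 y -> exists n, e n = y.
  by have [x D1x _] := D1cof i bic; apply: countable_enum D1c D1x.
have [e2 [e2D e2s]] : exists e : nat -> L,
    (forall n, D2 (e n)) /\ forall y, D2 y -> exists n, e n = y.
  by have [x D2x _] := D2cof j cjb; apply: countable_enum D2c D2x.
have e1R n : R b (pt (e1 n)) c by apply: D1S.
have e2R n : R c (pt (e2 n)) b by apply: D2S.
have VR n m : R (pt (e1 n)) c (pt (e2 m)).
  by have := e1R n; have := e2R m; cyc [:: b; c; pt (e1 n); pt (e2 m)].
clear i bic j cjb.
(* Pairing equal indices is enough, because a point other than [c] is shut out by the end on its own
   side alone. *)
exists (fun n => (pt (e1 n), pt (e2 n))); split=> [n|y yV] /=; first exact: VR.
apply: contrapT => yc.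
have [byc|byc] := pselect (R b y c).
  have [x yxc] := @dense_pt y c yc.
  have bxc : R b (pt x) c by cyc [:: b; y; c; pt x].
  have [z /e1s [n <-] xz] := D1cof x bxc.
  have {}xz : pt x = pt (e1 n) \/ R b (pt x) (pt (e1 n)).
    by case: xz => [->|]; [left|right].
  by have := yV n; have := e1R n; have := e2R n; have := VR n n => /=;
    cyc [:: b; c; y; pt x; pt (e1 n); pt (e2 n)].
have [cyb|cyb] := pselect (R c y b).
  have [x cxy] := @dense_pt c y (nesym yc).
  have cxb : R c (pt x) b by cyc [:: b; y; c; pt x].
  have [z /e2s [n <-] xz] := D2cof x cxb.
  have {}xz : pt x = pt (e2 n) \/ R (pt (e2 n)) (pt x) b.
    by case: xz => [->|]; [left|right].
  by have := yV n; have := e1R n; have := e2R n; have := VR n n => /=;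
    cyc [:: b; c; y; pt x; pt (e1 n); pt (e2 n)].
by have := yV 0; have := e1R 0; have := e2R 0 => /=; cyc [:: b; c; y; pt (e1 0); pt (e2 0)].
Qed.

(** Dependent choice; [t0] is the successor of a state that violates the invariant. *)
Lemma sequence_exists (T : Type) (inv : nat -> T -> Prop) (step : nat -> T -> T -> Prop) t0 :
  (forall n t, inv n t -> exists t', inv n.+1 t' /\ step n t t') -> inv 0 t0 ->
  exists u : nat -> T, forall n, inv n (u n) /\ step n (u n) (u n.+1).
Proof.
move=> ext inv0.
have ex (nt : nat * T) : exists t', inv nt.1 nt.2 -> inv nt.1.+1 t' /\ step nt.1 nt.2 t'.
  have [i|ni] := pselect (inv nt.1 nt.2); last by exists t0.
  by have [t' t'P] := ext _ _ i; exists t'.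
have [F FP] := choice ex.
pose u := nat_rect (fun=> T) t0 (fun n t => F (n, t)).
have uI n : inv n (u n) by elim: n => [//|n IH]; exact: (FP (n, u n) IH).1.
by exists u => n; split=> //; exact: (FP (n, u n) (uI n)).2.
Qed.

Definition shrinks_to (p q : nat -> L) (c : X) := [/\ forall n, R (pt (p n)) c (pt (q n)),
  forall n, R (pt (p n)) (pt (p n.+1)) c /\ R c (pt (q n.+1)) (pt (q n))
  & forall y, (forall n, R (pt (p n)) y (pt (q n))) -> y = c].

Lemma first_countable_shrinks c : first_countable c -> exists p q, shrinks_to p q c.
Proof.
move=> [V [Vc Vy]].
have step n (pq : L * L) : R (pt pq.1) c (pt pq.2) -> exists pq' : L * L,
    R (pt pq'.1) c (pt pq'.2) /\
    [/\ R (pt pq.1) (pt pq'.1) c, R c (pt pq'.2) (pt pq.2)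
      & forall y, R (pt pq'.1) y (pt pq'.2) -> R (V n).1 y (V n).2].
  case: pq => p q /= pcq.
  have [s [t [sct sub]]] := nbhdI st (nbhd_arc pcq) (nbhd_arc (Vc n)).
  have [p' spc] := @dense_pt s c (ltac:(cyc [:: s; t; c])).
  have [q' cqt] := @dense_pt c t (ltac:(cyc [:: s; t; c])).
  have psq : R (pt p) (pt p') (pt q) by apply: (sub _ _).1; cyc [:: s; t; c; pt p'].
  have qsq : R (pt p) (pt q') (pt q) by apply: (sub _ _).1; cyc [:: s; t; c; pt q'].
  have nps : ~ R s (pt p) t by move=> /sub[]; cyc [:: pt p; pt q].
  have nqs : ~ R s (pt q) t by move=> /sub[]; cyc [:: pt p; pt q].
  exists (p', q') => /=; split; first by cyc [:: s; t; c; pt p'; pt q'].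
  split; [by cyc [:: s; t; c; pt p'; pt q'; pt p; pt q]..|].
  by move=> y py; apply: (sub _ _).2; cyc [:: s; t; c; pt p'; pt q'; y].
have [p0 V0p] := @dense_pt (V 0).1 c (ltac:(have := Vc 0; cyc [:: (V 0).1; (V 0).2; c])).
have [q0 cqV] := @dense_pt c (V 0).2 (ltac:(have := Vc 0; cyc [:: (V 0).1; (V 0).2; c])).
have c0 : R (pt p0) c (pt q0).
  by have := Vc 0; cyc [:: (V 0).1; (V 0).2; c; pt p0; pt q0].
have [u uP] := @sequence_exists _ (fun _ pq => R (pt pq.1) c (pt pq.2)) _ (p0, q0) step c0.
exists (fun n => (u n).1), (fun n => (u n).2); split=> [n|n|y yu].
- exact: (uP n).1.
- by have [_ []] := uP n.
- by apply: Vy => n; have [_ [_ _ ]] := uP n; apply.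
Qed.

Lemma shrinks_outside p q c x n j : shrinks_to p q c -> n <= j ->
  ~ R (pt (p n)) x (pt (q n)) -> ~ R (pt (p j)) x (pt (q j)).
Proof.
move=> [pcq nest _] /subnK <-; elim: (j - n) => [//|m IH] nx; have {}nx := IH nx.
move: nx; rewrite addSn; have := nest (m + n); have := pcq (m + n); have := pcq (m + n).+1.
by move: (p _) (q _) (p _) (q _) => p' q' p1 q1; cyc [:: c; pt p'; pt q'; pt p1; pt q1; x].
Qed.

(** The image of [q1] is corrected first, so that the correction for [p1] can take place between
    [p'] and [q1'] without disturbing [q1']. *)
Lemma aut_adjust (f : aut (cr L)) p q p' q' p1 q1 p1' q1' :
  f p = p' -> f q = q' -> cr L p p1 q -> cr L p1 q1 q -> 
  cr L p' p1' q' -> cr L p1' q1' q' ->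
  exists g : aut (cr L), [/\ g p1 = p1', g q1 = q1' & forall x, ~ cr L p x q -> g x = f x].
Proof.
move=> fp fq; rewrite -!pt_cyclic => pp1q pq1q pp1q' pq1q'.
have fR := aut_preserving f.
have fqR : R (pt p') (pt (f q1)) (pt q').
  by rewrite pt_cyclic -fp -fq fR -pt_cyclic; cyc [:: pt p; pt q; pt p1; pt q1].
have [m1 [m1_id m1q]] := @aut_move (pt p') (pt q') (f q1) q1' fqR
  (ltac:(cyc [:: pt p'; pt q'; pt p1'; pt q1'])).
have m1E x : ~ R (pt p') (pt x) (pt q') -> m1 x = x.
  by move=> /m1_id; rewrite Ext_pt => /(@pt_inj d L).
have m1p : m1 p' = p' by apply: m1E; cyc [:: pt p'; pt q'].
have fpR : R (pt p') (pt (m1 (f p1))) (pt q1').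
  rewrite pt_cyclic -m1q -m1p (aut_preserving m1) -fp fR -pt_cyclic.
  by cyc [:: pt p; pt q; pt p1; pt q1].
have [m2 [m2_id m2p]] := @aut_move (pt p') (pt q1') (m1 (f p1)) p1' fpR
  (ltac:(cyc [:: pt p'; pt q'; pt p1'; pt q1'])).
have m2E x : ~ R (pt p') (pt x) (pt q1') -> m2 x = x.
  by move=> /m2_id; rewrite Ext_pt => /(@pt_inj d L).
exists (m2 * (m1 * f)); rewrite !autM; split=> //.
  by rewrite m1q m2E //; cyc [:: pt p'; pt q1'].
move=> x; rewrite -fR fp fq -pt_cyclic !autM => fx; rewrite (m1E _ fx) m2E //.
by cyc [:: pt p'; pt q'; pt q1'; pt p1'; pt (f x)].
Qed.

(** Each [f n.+1] differs from [f n] only between [p n] and [q n]. A point of [C] is not the hole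
    [c1], so it lies outside one of these arcs and its image is settled from then on; likewise the
    inverses are settled because [c2] is a hole. *)
Lemma holes_conjugate c1 c2 : ~ is_pt c1 -> first_countable c1 ->
  ~ is_pt c2 -> first_countable c2 ->
  exists g : aut (cr L), aut_act g c1 = c2.
Proof.
move=> h1 /first_countable_shrinks [p [q pq]] h2 /first_countable_shrinks [p' [q' pq']].
have [pc nest pqy] := pq; have [pc' nest' pqy'] := pq'.
have neq (r s : L) c : R (pt r) c (pt s) -> r != s.
  by move=> rs; apply/eqP => e; subst r; move: rs; cyc [:: pt s; c].
have [f0 [f0p f0q]] := @L_hom (p 0) (q 0) (p' 0) (q' 0) (neq _ _ _ (pc 0)) (neq _ _ _ (pc' 0)).
have nested r s c n : shrinks_to r s c ->
    cr L (r n) (r n.+1) (s n) /\ cr L (r n.+1) (s n.+1) (s n).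
  move=> [rc rn _]; rewrite -!pt_cyclic; have := rn n; have := rc n; have := rc n.+1.
  move: (r _) (s _) (r _) (s _) => r1 s1 r2 s2.
  by split; cyc [:: c; pt r1; pt s1; pt r2; pt s2].
have [f fP] := @sequence_exists (aut (cr L))
  (fun n g => g (p n) = p' n /\ g (q n) = q' n)
  (fun n g g' => forall x, ~ cr L (p n) x (q n) -> g' x = g x) f0
  (fun n g inv => let: conj a b := nested p q c1 n pq in
     let: conj a' b' := nested p' q' c2 n pq' in
     let: ex_intro g' (And3 gp gq gx) := aut_adjust inv.1 inv.2 a b a' b' in
     ex_intro _ g' (conj (conj gp gq) gx)) (conj f0p f0q).
have f_stable n j x : n <= j -> ~ R (pt (p n)) (pt x) (pt (q n)) -> f j x = f n x.
  move=> /subnK <-; elim: (j - n) => [//|m IH] nx; rewrite addSn.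
  rewrite (fP (m + n)).2 ?IH // -pt_cyclic.
  by apply: shrinks_outside pq _ nx; rewrite leq_addl.
have [|||x|F FP] := @aut_limit _ _ nat (fun i j => i <= j) f.
- by move=> i j k; exact: leq_trans.
- by move=> i j; exists (maxn i j); rewrite ?leq_maxl ?leq_maxr.
- move=> x; have [n nx] : exists n, ~ R (pt (p n)) (pt x) (pt (q n)).
    by apply/existsNP => xpq; apply: h1; exists x; rewrite (pqy _ xpq).
  by exists n => j nj; apply: f_stable.
- have [n nx] : exists n, ~ R (pt (p' n)) (pt x) (pt (q' n)).
    by apply/existsNP => xpq; apply: h2; exists x; rewrite (pqy' _ xpq).
  exists n => j nj; apply: (can_inj (autK (f j))); rewrite autVK.
  rewrite (f_stable n j _ nj) ?autVK //.
  rewrite pt_cyclic -(aut_preserving (f n)) autVK (fP n).1.1 (fP n).1.2.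
  by rewrite -pt_cyclic.
exists F; apply: pqy' => n.
have FE x : ~ R (pt (p n)) (pt x) (pt (q n)) -> F x = f n x.
  move=> nx; have [i Fi] := FP x.
  by rewrite (Fi (maxn i n)) ?leq_maxl // (@f_stable n) ?leq_maxr.
have [fp fq] := (fP n).1.
have := @Ext_preserving (aut_autrel F) (aut_preserving F) (pt (p n)) c1 (pt (q n)).
rewrite !Ext_pt /= !FE; last 2 first.
- by cyc [:: pt (p n); pt (q n)].
- by cyc [:: pt (p n); pt (q n)].
by rewrite fp fq => -[_]; apply.
Qed.


(** * The normalizer of the automorphism group *)

Hypothesis pt_countable : forall a : L, first_countable (pt a).

(** The preimage of [C] is the set of first countable holes. First countability being invariant, [k]
    also carries [C] onto that set. *)
Definition swaps (k : K) := forall x, is_pt (k x) <-> ~ is_pt x /\ first_countable x.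

Lemma first_countable_pt x : is_pt x -> first_countable x.
Proof. by move=> [a ->]; exact: pt_countable. Qed.

Lemma swaps_pt (k : K) : swaps k ->
  forall x, is_pt x <-> ~ is_pt (k x) /\ first_countable (k x).
Proof.
move=> kS x; rewrite first_countable_actE; split=> [Px|[nPk fx]].
  by split; [move=> /kS[]|exact: first_countable_pt].
by apply: contrapT => nP; apply: nPk; apply/kS.
Qed.

Lemma swapsV (k : K) : swaps k -> swaps k^-1.
Proof. by move=> kS x; rewrite (swaps_pt kS) autrelVK. Qed.

Lemma pt_stableV (k : K) : pt_stable k -> pt_stable k^-1.
Proof. by move=> kP x; rewrite -kP autrelVK. Qed.

Lemma pt_stableM (k l : K) : pt_stable k -> pt_stable l -> pt_stable (k * l).
Proof. by move=> kP lP x; rewrite autrelM kP lP. Qed.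

Lemma swaps_stable (k l : K) : swaps k -> pt_stable l -> swaps (k * l).
Proof. by move=> kS lP x; rewrite autrelM kS lP first_countable_actE. Qed.

Lemma stable_swaps (k l : K) : pt_stable k -> swaps l -> swaps (k * l).
Proof. by move=> kP lS x; rewrite autrelM kP. Qed.

Lemma swaps_swaps (k l : K) : swaps k -> swaps l -> pt_stable (k * l).
Proof. by move=> kS lS x; rewrite autrelM kS -swaps_pt. Qed.

Lemma L_inhabited : exists a : L, True.
Proof. by have [a _] := three_points; exists a. Qed.

Lemma swaps_not_stable (k : K) : swaps k -> ~ pt_stable k.
Proof.
have [a _] := L_inhabited => kS kP.
by have /kS [] := (kP (pt a)).2 (is_pt_pt a); case; exact: is_pt_pt.
Qed.

Lemma conj_preserving (k g : K) : preserving R g -> preserving R (k * g * k^-1).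
Proof.
move=> gR x y z; rewrite !autrelM; have [kR|kR] := K_mono k.
  by rewrite kR gR -kR !autrelVK.
by rewrite kR gR -kR !autrelVK.
Qed.

Lemma conj_stable (k g : K) : pt_stable k \/ swaps k -> pt_stable g ->
  pt_stable (k * g * k^-1).
Proof.
move=> [kP|kS] gP; first by do !apply: pt_stableM => //; exact: pt_stableV.
apply: swaps_swaps; last exact: swapsV.
exact: swaps_stable.
Qed.

Lemma conj_stableV (k g : K) : pt_stable k \/ swaps k -> pt_stable g ->
  pt_stable (k^-1 * g * k).
Proof.
move=> kP gP; rewrite -{2}(invgK k); apply: conj_stable => //.
by case: kP => [/pt_stableV|/swapsV]; [left|right].
Qed.

Lemma aut_transitive (a b : L) : exists g : aut (cr L), g a = b.
Proof.
have [->|ab] := eqVneq a b; first by exists 1.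
have [|g [gb _]] := @L_hom a b b a ab; first by rewrite eq_sym.
by exists g.
Qed.

(** A normalizing element permutes the orbits of Aut(C), and both [C] and the set of first countable
    holes are single orbits. If no point of [C] stays in [C], its image is the second orbit. *)
Lemma normalizes_aut (k : K) :
  normalizes (@aut_autrel L (cr L)) k <-> pt_stable k \/ swaps k.
Proof.
split=> [nk|kP]; last first.
  move=> g; have gR : preserving R (Ext (aut_autrel g)).
    exact/Ext_preserving/aut_preserving.
  have gP := Ext_stable (aut_autrel g).
  split; apply/in_image_aut; split; [exact: conj_preserving|exact: conj_stable|
    rewrite -{2}(invgK k); exact: conj_preserving|exact: conj_stableV].
have conj g : exists h, forall x, aut_act h (k x) = k (aut_act g x).
  have [[h hE] _] := nk g; exists h => x.
  by rewrite /aut_act /act hE !autrelM autrelK.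
have conjV g : exists h, forall x, k (aut_act h x) = aut_act g (k x).
  have [_ [h hE]] := nk g; exists h => x.
  by rewrite /aut_act /act hE !autrelM autrelVK.
have [[a [a' kaa']]|kpt] := pselect (exists a, is_pt (k (pt a))).
  left=> x; split=> [[b kxb]|[b ->]].
    have [g gb] := aut_transitive a' b; have [h hE] := conjV g.
    suff -> : x = pt (h a) by exact: is_pt_pt.
    apply: (can_inj (autrelK k)).
    by rewrite -aut_act_pt hE kaa' aut_act_pt gb.
  have [g gb] := aut_transitive a b; have [h hE] := conj g.
  by exists (h a'); rewrite -gb -aut_act_pt -hE kaa' aut_act_pt.
have {}kpt a : ~ is_pt (k (pt a)) by move=> ka; apply: kpt; exists a.
have [a _] := L_inhabited.
right=> x; split=> [kx|[hx fx]].
  split; first by move=> [b xb]; apply: (kpt b); rewrite -xb.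
  by rewrite -(first_countable_actE k); exact: first_countable_pt.
apply: contrapT => hkx.
have hole_in y : ~ is_pt y -> first_countable y -> exists b, y = k (pt b).
  move=> hy fy; have [|g gy] := holes_conjugate (kpt a) _ hy fy.
    exact: first_countable_act.
  by have [h hE] := conjV g; exists (h a); rewrite -aut_act_pt hE.
have [|b kxb] := hole_in _ hkx; first exact: first_countable_act.
by apply: hx; exists b; apply: (can_inj (autrelK k)).
Qed.

(** Conjugation respects preservation of orientation, so whatever normalizes the larger group
    normalizes Aut(C) as well. This is why both groups have the same automorphism group. *)
Lemma normalizes_autrel (k : K) :
  normalizes (@id (autrel (cr L))) k <-> pt_stable k \/ swaps k.
Proof.
split=> [nk|kP g]; last first.
  have gP := Ext_stable g.
  by split; apply/in_image_autrel; [apply: conj_stable|apply: conj_stableV].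
apply/normalizes_aut => g; have [] := nk (aut_autrel g).
move=> /in_image_autrel nk1 /in_image_autrel nk2.
have gR : preserving R (Ext (aut_autrel g)).
  exact/Ext_preserving/aut_preserving.
split; apply/in_image_aut; split=> //; first exact: conj_preserving.
by rewrite -{2}(invgK k); exact: conj_preserving.
Qed.

Lemma conj_set_autrel :
  conjugation_set (@autrel_bijn L (cr L)) = [set k | pt_stable k \/ swaps k].
Proof.
apply/seteqP; split=> k kc;
  have E := @conjugation_setP (autrel (cr L)) id (fun _ _ => erefl) (fun _ _ e => e) k.
  exact/normalizes_autrel/E.
exact/E/normalizes_autrel.
Qed.

Lemma conj_set_aut :
  conjugation_set (@aut_bijn L (cr L)) = [set k | pt_stable k \/ swaps k].
Proof.
apply/seteqP; split=> k kc;
  have E := @conjugation_setP (aut (cr L)) _ (@aut_autrelM L (cr L)) aut_autrel_inj k.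
  exact/normalizes_aut/E.
exact/E/normalizes_aut.
Qed.

(** * A fixed point rules out swapping *)

(** The fixed point is the supremum [m] of the points that are not moved backwards, as in Tarski's
    theorem. A decreasing map could jump over the diagonal; but a point [y] between [m] and [k m] is
    the image of some [v], and comparing [y] with [v] and [k y] gives a contradiction. *)
Lemma self_map_fixpoint (k : K) a b : a <> b ->
  (forall x, x = a \/ x = b \/ R a x b -> R a (k x) b) -> exists x, k x = x.
Proof.
move=> ab kab; have [z bza] := dense_pt (nesym ab); move: (pt z) bza => {}z bza.
pose I x := x = a \/ x = b \/ R a x b.
have Ia : I a by left.
have Ib : I b by right; left.
have kI x : I x -> R a (k x) b by exact: kab.
have RI x : R a x b -> I x by right; right.
have Iz x : I x -> x <> z /\ (x = b \/ R z x b) /\ (a = x \/ R z a x).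
  by rewrite /I; cyc [:: z; a; b; x].
(* Cutting at [w] or at [z] orders the closed arc in the same way, and [k] takes the first cut to
   the second. *)
pose w := k^-1 z.
have kw : k w = z by exact: autrelVK.
have bwa : R b w a.
  have : ~ I w by move=> /kI; rewrite kw; cyc [:: z; a; b].
  by rewrite /I; clear kw; clearbody w; cyc [:: w; a; b].
have wI x y : I x -> I y -> R z x y -> R w x y.
  by rewrite /I; clear kw; clearbody w; cyc [:: a; b; w; z; x; y].
pose S x := I x /\ (x = k x \/ R z x (k x)).
have S_ex s0 : S s0 -> exists m, [/\ I m, forall s, S s -> s = m \/ R z s m
    & forall v, v <> z -> (forall s, S s -> s = v \/ R z s v) -> m = v \/ R z m v].
  move=> Ss0.
  have [||m [mz Sm ml]] := crbar_complete L_dense Ss0 (_ : b <> z).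
  - by cyc [:: a; b; z].
  - by move=> s [Is _]; case: (Iz s Is) => _ [].
  exists m; split=> //.
  have := ml b (Iz b Ib).1 (fun s Ss => (Iz s Ss.1).2.1).
  have := Sm _ Ss0; have := (Iz _ Ss0.1).2.
  by rewrite /I; cyc [:: z; a; b; s0; m].
have [kR|kR] := K_mono k.
  have mono x y : I x -> I y -> R z x y -> R z (k x) (k y).
    by move=> Ix Iy /(wI _ _ Ix Iy) /(kR _ _ _).2; rewrite kw.
  have Sa : S a by split=> //; right; have := kI a Ia; cyc [:: z; a; b; k a].
  have [m [Im Sm ml]] := S_ex a Sa; exists m.
  have Ikm : I (k m) by apply/RI/kI.
  have mkm : m = k m \/ R z m (k m).
    apply: ml => [|s [Is sks]]; first by case: (Iz _ Ikm).
    have [e|sm] := Sm s (conj Is sks); first by rewrite -e.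
    by have := mono _ _ Is Im sm; cyc [:: z; s; k s; k m].
  have Skm : S (k m).
    by split=> //; case: mkm => [e|/(mono _ _ Im Ikm)]; [left; rewrite -e|right].
  by have := Sm _ Skm; cyc [:: z; m; k m].
have mono x y : I x -> I y -> R z x y -> R z (k y) (k x).
  by move=> Ix Iy /(wI _ _ Ix Iy) wxy; have := (kR y x w).2 wxy; rewrite kw; cyc [:: z; k x; k y].
have Ik x : I x -> I (k x) by move=> /kI/RI.
(* The lower bound [k b] of [m] is needed again, to locate the preimage [v] between [m] and [b]. *)
have Skb : S (k b).
  split; first exact: Ik.
  right; apply: mono => //; first exact: Ik.
  by have := kI b Ib; cyc [:: z; a; b; k b].
have [m [Im Sm ml]] := S_ex _ Skb; exists m; apply: contrapT => kmm.
have := Iz _ Im; have := Iz _ (Ik _ Im) => -[kmz [kmb akm]] [mz [mb am]].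
have [mkm|mkm] := pselect (R z m (k m)).
  have [y myk] := @dense_pt m (k m) (nesym kmm); move: (pt y) myk => {}y myk.
  have zmy : R z m y /\ R z y (k m) by cyc [:: z; m; y; k m].
  have Iy : I y by apply: RI; have := kI _ Im; cyc [:: z; a; b; m; y; k m].
  have above x : I x -> R z m x -> R z (k x) x.
    move=> Ix mx; have : ~ S x by move=> /Sm; cyc [:: z; m; x].
    have := Iz _ (Ik _ Ix); rewrite /S => -[kxz _] nS.
    have : x <> k x /\ ~ R z x (k x) by split=> h; apply: nS; split=> //; [left|right].
    by clear nS; cyc [:: z; m; x; k x].
  have yky := above _ Iy zmy.1.
  pose v := k^-1 y.
  have kv : k v = y by exact: autrelVK.
  have mvb : R m v b.
    by apply: (kR _ _ _).1; rewrite kv; have := Sm _ Skb; cyc [:: z; k b; m; y; k m].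
  have Iv : I v by apply: RI; clear kv; clearbody v; cyc [:: z; a; b; m; v].
  have zmv : R z m v by clear kv; clearbody v; cyc [:: z; a; b; m; v].
  have := above _ Iv zmv; rewrite kv => /(mono _ _ Iy Iv); rewrite kv.
  by cyc [:: z; y; k y].
have zkm : R z (k m) m by cyc [:: z; m; k m].
have [y kym] := @dense_pt (k m) m kmm; move: (pt y) kym => {}y kym.
have zmy : R z y m /\ R z (k m) y by cyc [:: z; m; y; k m].
have Iy : I y by apply: RI; have := kI _ Im; cyc [:: z; a; b; m; y; k m].
have below x : I x -> R z x m -> R z x (k x).
  move=> Ix xm; have [s Ss xs] : exists2 s, S s & R z x s.
    apply: contrapT => /forall2NP nS.
    have : m = x \/ R z m x.
      apply: ml => [|s Ss]; first by cyc [:: z; m; x].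
      have [//|nxs] := nS s; have := (Iz _ Ss.1).1; have := (Iz _ Ix).1.
      by cyc [:: z; s; x].
    by cyc [:: z; m; x].
  have := mono _ _ Ix Ss.1 xs; have := Ss.2.
  by cyc [:: z; x; s; k x; k s].
have yky := below _ Iy zmy.1.
have kya : k a = k y \/ R z (k y) (k a).
  have [->|ay] := pselect (a = y); first by left.
  by right; apply: mono => //; have := (Iz _ Iy).2.2; cyc [:: z; a; y].
pose v := k^-1 y.
have kv : k v = y by exact: autrelVK.
have avm : R a v m.
  by apply: (kR _ _ _).1; rewrite kv; cyc [:: z; k m; y; k a; k y].
have Iv : I v by apply: RI; clear kv; clearbody v; cyc [:: z; a; b; m; v].
have zvm : R z v m by clear kv; clearbody v; cyc [:: z; a; b; m; v].
have := below _ Iv zvm; rewrite kv => /(mono _ _ Iv Iy); rewrite kv.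
by cyc [:: z; y; k y].
Qed.

Lemma no_swap (k : K) : (forall x, ~ is_pt x -> first_countable x) -> ~ swaps k.
Proof.
move=> hole_fc kS.
have kP x : is_pt (k x) <-> ~ is_pt x.
  by split=> [/kS[]|nx] //; apply/kS; split=> //; exact: hole_fc.
have [a [b [c abc]]] := three_points.
have ab : pt a <> pt b by cyc [:: pt a; pt b; pt c].
have [s' asb] := dense_pt ab.
have [t' stb] := @dense_pt (pt s') (pt b) (ltac:(cyc [:: pt a; pt b; pt s'])).
have [x [y [xy kxy]]] : exists x y, x <> y /\
    forall u, u = pt a \/ u = pt b \/ R (pt a) u (pt b) -> k u = x \/ k u = y \/ R x (k u) y.
  have kk u v : k u = k v -> u = v by move=> /(can_inj (autrelK k)).
  have [kR|kR] := K_mono k.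
    exists (k (pt a)), (k (pt b)); split=> [/kk//|u [->|[->|aub]]]; [by left|by right; left|].
    by right; right; exact/kR.
  exists (k (pt b)), (k (pt a)); split=> [/kk/esym//|u [->|[->|aub]]]; [by right; left|by left|].
  by right; right; exact/kR.
(* Both [s] and [t] lie off the image of the closed arc, so that image is between [s] and [t], and
   [g] squeezes it into the open arc. *)
have [s ysx] := dense_pt (nesym xy).
have [t yts] := @dense_pt y (pt s) (ltac:(cyc [:: x; y; pt s])).
have neq (i j : L) : pt i <> pt j -> i != j by move=> ij; apply/eqP => e; apply: ij; rewrite e.
have [g [gs gt]] := @L_hom s t s' t' (neq s t (ltac:(cyc [:: y; pt t; pt s])))
  (neq s' t' (ltac:(cyc [:: pt s'; pt t'; pt b]))).
pose h : K := Ext (aut_autrel g) * k.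
have [|f hf] := @self_map_fixpoint h (pt a) (pt b) ab.
  move=> u /kxy uab; rewrite /h autrelM.
  have := Ext_preserving (g := aut_autrel g) (aut_preserving g) (pt s) (k u) (pt t).
  rewrite !Ext_pt /= gs gt => -[_ gR].
  have {}gR : R (pt s') (Ext (aut_autrel g) (k u)) (pt t').
    by apply: gR; cyc [:: x; y; pt s; pt t; k u].
  by cyc [:: pt a; pt b; pt s'; pt t'; Ext (aut_autrel g) (k u)].
have : is_pt (h f) <-> ~ is_pt f by rewrite /h autrelM Ext_stable.
by rewrite hf; tauto.
Qed.


(** * The two characters of the outer automorphism group *)

Definition of_bool (b : bool) : 'I_2 := if b then inZp 1 else 1.

Lemma of_boolM a b : of_bool a * of_bool b = of_bool (a (+) b).
Proof. by case: a b => [] []; apply: val_inj. Qed.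

Lemma of_bool_eq1 b : of_bool b = 1 -> b = false.
Proof. by case: b => // /(congr1 val). Qed.

Definition reversingb (k : K) := `[< ~ preserving R k >].
Definition swapsb (k : K) := `[< ~ pt_stable k >].

Lemma reversingbM (k l : K) : reversingb (k * l) = reversingb k (+) reversingb l.
Proof.
have E (m : K) : (preserving R m /\ reversingb m = false) \/ (reversing R m /\ reversingb m).
  have [mR|mR] := K_mono m; [left|right]; split=> //; first by apply/asboolPn; case.
  by apply/asboolP => mp; exact: not_preserving_reversing mp mR.
have [[klR ->]|[klR ->]] := E (k * l); have [[kR ->]|[kR ->]] := E k;
  have [[lR ->]|[lR ->]] := E l => //; exfalso.
- by apply: (not_preserving_reversing klR) => x y z; rewrite !autrelM kR lR.
- by apply: (not_preserving_reversing klR) => x y z; rewrite !autrelM kR lR.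
- by apply: (fun h => not_preserving_reversing h klR) => x y z; rewrite !autrelM kR lR.
- by apply: (fun h => not_preserving_reversing h klR) => x y z; rewrite !autrelM kR lR.
Qed.

Lemma swapsbM (k l : K) : pt_stable k \/ swaps k -> pt_stable l \/ swaps l ->
  swapsb (k * l) = swapsb k (+) swapsb l.
Proof.
have P (m : K) : pt_stable m -> swapsb m = false by move=> mP; apply/asboolPn; case.
have S (m : K) : swaps m -> swapsb m by move=> mS; apply/asboolP/swaps_not_stable.
move=> [kP|kS] [lP|lS].
- by rewrite !P //; exact: pt_stableM.
- by rewrite (P k) // !S //; exact: stable_swaps.
- by rewrite (P l) // !S //; exact: swaps_stable.
- by rewrite (S k) // (S l) // P //; exact: swaps_swaps.
Qed.

Lemma aut_onto (g : aut (cr L)) : exists h, aut_autrel h = aut_autrel g.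
Proof. by exists g. Qed.

Lemma autrel_onto (g : aut (cr L)) : exists h : autrel (cr L), id h = aut_autrel g.
Proof. by exists (aut_autrel g). Qed.

Lemma autrel_idM : {morph @id (autrel (cr L)) : g h / g * h}.
Proof. by []. Qed.

Lemma autrel_id_inj : injective (@id (autrel (cr L))).
Proof. by []. Qed.

Definition conj_aut : gaut (aut (cr L)) -> K :=
  conj_of (@aut_autrelM L (cr L)) aut_autrel_inj aut_onto.

Definition conj_autrel : gaut (autrel (cr L)) -> K :=
  conj_of autrel_idM autrel_id_inj autrel_onto.

Lemma conj_aut_kind s : pt_stable (conj_aut s) \/ swaps (conj_aut s).
Proof.
have : conjugation_set (@aut_bijn L (cr L)) (conj_aut s).
  by exists s; exact (conj_ofP (@aut_autrelM L (cr L)) aut_autrel_inj aut_onto s).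
by rewrite conj_set_aut.
Qed.

Lemma conj_autrel_kind s : pt_stable (conj_autrel s) \/ swaps (conj_autrel s).
Proof.
have : conjugation_set (@autrel_bijn L (cr L)) (conj_autrel s).
  by exists s; exact (conj_ofP autrel_idM autrel_id_inj autrel_onto s).
by rewrite conj_set_autrel.
Qed.

(** Both characters vanish exactly on conjugations by preserving maps that stabilize [C], which are
    the inner automorphisms. *)
Lemma outer_aut_klein4 : exists2 f : outer (aut (cr L)) -> klein4,
  injective f & {morph f : x y / x * y}.
Proof.
pose chi s : klein4 := (of_bool (reversingb (conj_aut s)), of_bool (swapsb (conj_aut s))).
have chiM : {morph chi : s t / s * t}.
  move=> s t; rewrite /chi /conj_aut conj_ofM -/conj_aut reversingbM.
  rewrite swapsbM; [|exact: conj_aut_kind..].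
  by rewrite -!of_boolM.
have chi_inner s : chi s = 1 <-> inner s.
  rewrite -(conj_of_inner (@aut_autrelM L (cr L)) aut_autrel_inj aut_onto) in_image_aut.
  split=> [[/of_bool_eq1/asboolPn/contrapT kR /of_bool_eq1/asboolPn/contrapT kP] //|].
  by move=> [kR kP]; rewrite /chi /reversingb /swapsb !asboolF.
exists (outer_map chi); [exact: outer_map_inj|exact: outer_mapM].
Qed.

(** Reversing maps of [C] act as inner automorphisms here, so only the swapping character
    remains. *)
Lemma outer_autrel_card2 : exists f : outer (autrel (cr L)) -> 'I_2, injective f.
Proof.
pose chi s : 'I_2 := of_bool (swapsb (conj_autrel s)).
have chiM : {morph chi : s t / s * t}.
  move=> s t; rewrite /chi /conj_autrel conj_ofM -/conj_autrel.
  rewrite swapsbM; [|exact: conj_autrel_kind..].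
  by rewrite of_boolM.
have chi_inner s : chi s = 1 <-> inner s.
  rewrite -(conj_of_inner autrel_idM autrel_id_inj autrel_onto) in_image_autrel.
  split=> [/of_bool_eq1/asboolPn/contrapT //|kP].
  by rewrite /chi /swapsb asboolF.
exists (outer_map chi); exact: outer_map_inj.
Qed.

Lemma extension_setE : extension_set (@autrel_bijn L (cr L)) = [set k | pt_stable k].
Proof.
apply/seteqP; split=> [k [g /Ext_uniq ->]|k /pt_stableP [g ->]]; first exact: Ext_stable.
by exists g => a; rewrite Ext_pt.
Qed.

Lemma autrel_complete : (forall x, ~ is_pt x -> first_countable x) ->
  complete_group (autrel (cr L)).
Proof.
move=> hole_fc; split=> [z zc|s].
  apply: Ext_inj; rewrite Ext1.
  apply: (centralizer1 autrel_onto) => h.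
  by rewrite /commute -!ExtM zc.
apply/(conj_of_inner autrel_idM autrel_id_inj autrel_onto)/in_image_autrel.
by case: (conj_autrel_kind s) => // /(no_swap hole_fc).
Qed.

End Circle.

(** * Completions with a single point *)

Section Degenerate.
Variables (d : Order.disp_t) (L : orderType d).
Hypothesis cbar_trivial : forall A B : cbar L, A = B.

Lemma not_countable_character (c : cbar L) : ~ countable_character c.
Proof. by move=> [b [bc _ _]]; apply: bc. Qed.

Lemma bijn_subsingleton (T : Type) (f g : bijn T) : (forall x y : T, x = y) -> f = g.
Proof. by move=> T1; apply: bijn_ext. Qed.

Lemma outer_subsingleton (G : groupType) : (forall g h : G, g = h) ->
  forall u v : outer G, u = v.
Proof.
move=> G1 u v; rewrite -[u]generic_quotient.reprK -[v]generic_quotient.reprK.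
by congr (_ _); apply: val_inj; apply: bijn_subsingleton.
Qed.

Hypothesis L_empty : forall x : L, False.

Lemma empty_outer_klein4 : exists2 f : outer (aut (cr L)) -> klein4,
  injective f & {morph f : x y / x * y}.
Proof.
exists (fun=> 1) => [u v _|u v]; last by rewrite mulg1.
by apply: outer_subsingleton => g h; apply: aut_inj => x; case: (L_empty x).
Qed.

Lemma empty_outer_card2 : exists f : outer (autrel (cr L)) -> 'I_2, injective f.
Proof.
exists (fun=> 1) => u v _.
by apply: outer_subsingleton => g h; apply: autrel_inj => x; case: (L_empty x).
Qed.

(** Without points [extends] holds vacuously. *)
Lemma empty_conjugation_by (H : groupType) (val : H -> bijn L) (s : gaut H) c :
  conjugation_by val s c.
Proof. by move=> h; exists 1 => x; case: (L_empty x). Qed.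

Lemma empty_uniquely_conjugating (H : groupType) (val : H -> bijn L) :
  uniquely_conjugating val.
Proof.
move=> s; exists 1; split; first exact: empty_conjugation_by.
by move=> c _; apply: autrel_inj.
Qed.

Lemma empty_conjugation_set (H : groupType) (val : H -> bijn L) :
  conjugation_set val = setT.
Proof.
by apply/seteqP; split=> // c _; exists 1; exact: empty_conjugation_by.
Qed.

End Degenerate.

Theorem theorem9p6 (d : Order.disp_t) (L : orderType d)
    (L_dense : densely_ordered L) (L_endpoint : at_most_one_endpoint L)
    (C_homogeneous : two_o_homogeneous L) :
  (forall c1 c2 : cbar L,
     hole c1 -> countable_character c1 -> hole c2 -> countable_character c2 ->
     exists (g : aut (cr L)) (gbar : aut (crbar L)),
       extends g gbar /\ gbar c1 = c2) /\
  ((forall x : L, countable_character (pt x)) ->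
     ([\/ [set: outer (aut (cr L))] #= `I_1,
          [set: outer (aut (cr L))] #= `I_2
        | [set: outer (aut (cr L))] #= `I_4] /\
      ([set: outer (aut (cr L))] #= `I_4 ->
         isomorphic (outer (aut (cr L))) klein4) /\
      [set: outer (autrel (cr L))] #<= `I_2) /\
     [/\ uniquely_conjugating (@autrel_bijn L (cr L)),
         uniquely_conjugating (@aut_bijn L (cr L))
       & conjugation_set (@autrel_bijn L (cr L)) =
         conjugation_set (@aut_bijn L (cr L))]) /\
  ((forall x : L, countable_character (pt x)) ->
   (forall c : cbar L, hole c -> countable_character c) ->
     [/\ uniquely_conjugating (@aut_bijn L (cr L)),
         conjugation_set (@aut_bijn L (cr L)) =
         extension_set (@autrel_bijn L (cr L))
       & complete_group (autrel (cr L))]).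
Proof.
(* Countable character asks for a second element [b], so nothing has it in a one-point completion.
   The first claim is then vacuous, the second concerns only the empty [L], and the hypotheses of
   the third fail at a point or at the adjoined hole. *)
have [nontriv|triv] := pselect (exists A B : cbar L, A <> B); last first.
  have {}triv (A B : cbar L) : A = B by apply: contrapT => AB; apply: triv; exists A, B.
  have nocc := not_countable_character triv.
  split; first by move=> c1 c2 _ /nocc.
  split=> [L_cc|L_cc hole_cc].
    have L_empty (x : L) : False := nocc _ (L_cc x).
    have [f f_inj fM] := empty_outer_klein4 L_empty.
    have [f2 f2_inj] := empty_outer_card2 L_empty.
    have [cards iso] := injective_klein4 f_inj fM.
    split; first by split=> //; split=> //; exact: injective_card2 f2_inj.
    by split; [exact: empty_uniquely_conjugating|exact: empty_uniquely_conjugating|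
      rewrite !empty_conjugation_set].
  have [[x _]|L_empty] := pselect (exists x : L, True); first by case: (nocc _ (L_cc x)).
  have c0 : completion_cut (set0 : set L) by right; split=> // -[x _]; apply: L_empty; exists x.
  have h0 : hole (Cbar c0) by move=> [x _]; apply: L_empty; exists x.
  by case: (nocc _ (hole_cc _ h0)).
have uc_aut := uniquely_conjugatingP L_dense L_endpoint C_homogeneous nontriv
  (@aut_autrelM L (cr L)) (@aut_autrel_inj _ L) (@aut_onto _ L).
have uc_autrel := uniquely_conjugatingP L_dense L_endpoint C_homogeneous nontriv
  (@autrel_idM _ L) (@autrel_id_inj _ L) (@autrel_onto _ L).
have fcE := @countable_character_first_countable _ _ L_dense L_endpoint.
split.
  move=> c1 c2 h1 /fcE f1 h2 /fcE f2.
  have [g gc] := holes_conjugate L_dense L_endpoint C_homogeneous nontriv h1 f1 h2 f2.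
  have [k kE] := aut_make (Ext_preserving L_dense L_endpoint nontriv
    (aut_preserving g : preserving _ (aut_autrel g))).
  exists g, k; split=> [x|]; rewrite kE //.
  exact: Ext_pt.
split=> [L_cc|L_cc hole_cc].
  have L_fc x := fcE _ (L_cc x).
  split.
    have [f f_inj fM] := outer_aut_klein4 L_dense L_endpoint C_homogeneous nontriv L_fc.
    have [f2 f2_inj] := outer_autrel_card2 L_dense L_endpoint C_homogeneous nontriv L_fc.
    have [cards iso] := injective_klein4 f_inj fM.
    by split=> //; split=> //; exact: injective_card2 f2_inj.
  split.
  - exact: uc_autrel.
  - exact: uc_aut.
  - by rewrite (conj_set_autrel L_dense L_endpoint C_homogeneous nontriv L_fc)
      (conj_set_aut L_dense L_endpoint C_homogeneous nontriv L_fc).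
have L_fc x := fcE _ (L_cc x).
have hole_fc x (hx : ~ is_pt x) : first_countable x := fcE _ (hole_cc x hx).
split.
- exact: uc_aut.
- rewrite (conj_set_aut L_dense L_endpoint C_homogeneous nontriv L_fc).
  rewrite (extension_setE L_dense L_endpoint nontriv).
  apply/seteqP; split=> k /=; last by left.
  by case=> // /(no_swap L_dense L_endpoint C_homogeneous nontriv hole_fc).
- exact: (autrel_complete L_dense L_endpoint C_homogeneous nontriv L_fc hole_fc).
Qed.
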